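(* Let $\alpha>5/2$ be a real number. Consider the bilinear control system $$\mathrm{i}\,\frac{\partial \psi}{\partial t} = -|\Delta|^{\alpha}\psi + u(t)\cos(\theta)\,\psi,\qquad \theta\in\Omega=\mathbf{R}/2\pi\mathbf{Z},$$ restricted to the space $H_o$ of odd functions in $L^2(\Omega,\mathbf{C})$, with propagator $\Upsilon^u_t$. Then for every $\psi_0,\psi_1$ in the Hilbert unit sphere of $H_o$, for every $\varepsilon>0$ and for every $T>0$, there exists a piecewise constant function $u:[0,T]\to\mathbf{R}$ such that $$\|\Upsilon^u_T\psi_0-\psi_1\|<\varepsilon .$$ In other words, if $\alpha>5/2$, then the temporal diameter of this system satisfies $\rho=0$.
   Context: $\Omega=\mathbf{R}/2\pi\mathbf{Z}$ is the one-dimensional torus, $\Delta$ is the Laplace-Beltrami operator on $\Omega$, and $H_o$ is the closed subspace of odd functions of $L^2(\Omega,\mathbf{C})$, which is stable under the dynamics. The functions $\phi_k:\theta\mapsto \sin(k\theta)/\sqrt{\pi}$, $k\ge 1$, form a Hilbert basis of $H_o$. Let $A=\mathrm{i}|\Delta_{|H_o}|^{\alpha}$, the skew-adjoint operator with $A\phi_k=\mathrm{i}k^{2\alpha}\phi_k$, and let $B$ be the bounded skew-adjoint operator on $H_o$ of multiplication by $-\mathrm{i}\cos\theta$. The system on $H_o$ reads $\frac{d}{dt}\psi=(A+u(t)B)\psi$. For piecewise constant $u$, $\Upsilon^u_t$ denotes the unitary operator sending an initial condition $\psi(0)=\psi_0$ to the solution at time $t$, obtained by concatenating (composing in chronological order)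 the unitary operators $e^{s(A+cB)}$, where $c$ runs through the successive constant values of $u$ and $s$ is the duration for which each value is taken. Reachable sets: $\mathcal{R}_t(\psi_0)=\{\Upsilon^u_t\psi_0 : u \text{ piecewise constant}\}$ and $\mathcal{R}_{<T}(\psi_0)=\bigcup_{0\le t<T}\mathcal{R}_t(\psi_0)$, $\mathcal{R}_{<+\infty}(\psi_0)=\bigcup_{T>0}\mathcal{R}_T(\psi_0)$. Let $\mathbf{S}_{H_o}$ be the unit sphere of $H_o$. When $\mathcal{R}_{<+\infty}(\phi_1)$ is dense in $\mathbf{S}_{H_o}$, the temporal diameter is $\rho=\inf\{T\ge 0 : \overline{\mathcal{R}_{<T}(\phi_1)}=\mathbf{S}_{H_o}\}$, the closure being in the norm of $H_o$. *)

(* Defs.v *)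
From HB Require Import structures.
From mathcomp Require Import all_boot all_order all_algebra.
From mathcomp Require Import all_classical all_reals all_analysis.
From mathcomp Require Import complex.
Set Implicit Arguments.
Unset Strict Implicit.
Unset Printing Implicit Defensive.
Import Order.TTheory GRing.Theory Num.Theory.
Import numFieldNormedType.Exports.
Local Open Scope classical_set_scope.
Local Open Scope ring_scope.
Local Open Scope complex_scope.

(* The torus R/2piZ is the fundamental domain ]-pi, pi] with Lebesgue measure.
   A wave function is a representative of its class: only its values on
   ]-pi, pi] matter, and equality in L^2 is equality almost everywhere. *)
Definition torus (R : realType) : {measure set (measurableTypeR R) -> \bar R} :=
  mrestr lebesgue_measure (measurable_itv `](- pi : R), pi]).

Definition wave (R : realType) := measurableTypeR R -> R[i].

Definition L2 (R : realType) : set (wave R) :=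
  [set psi | (fun x => complex.Re (psi x)) \in Lfun (torus R) 2%:E /\
             (fun x => complex.Im (psi x)) \in Lfun (torus R) 2%:E].

Definition Ho (R : realType) : set (wave R) :=
  [set psi | L2 psi /\ \forall x \ae torus R, psi (- x) = - psi x].

Definition inner (R : realType) (f g : wave R) : R[i] :=
  (\int[torus R]_x complex.Re ((f x)^* * g x)) +i*
  (\int[torus R]_x complex.Im ((f x)^* * g x)).

Definition L2norm (R : realType) (f : wave R) : R :=
  Num.sqrt (complex.Re (inner f f)).

Definition sphere (R : realType) : set (wave R) :=
  [set psi | Ho psi /\ L2norm psi = 1].

Definition L2closure (R : realType) (X : set (wave R)) : set (wave R) :=
  [set psi | Ho psi /\ forall e : R, 0 < e ->
     exists2 chi, X chi & L2norm (fun x => chi x - psi x) < e].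

Definition phi (R : realType) (k : nat) : wave R :=
  fun x => (sin (k%:R * x) / Num.sqrt pi)%:C.

(* Unbounded operators on Ho are given by their graphs.  Since the phi k
   (k >= 1) form a Hilbert basis of Ho, with - Delta (phi k) = k ^ 2 phi k,
   i |Delta| ^ alpha is the maximal operator diagonal in that basis with
   eigenvalues i k ^ (2 alpha): its domain consists of the psi for which the
   sequence i k ^ (2 alpha) <phi k, psi> is that of the coefficients of an
   element chi of Ho. *)
Definition opA (R : realType) (alpha : R) (psi chi : wave R) : Prop :=
  [/\ Ho psi, Ho chi &
      forall k : nat, (0 < k)%N ->
        inner (phi k) chi =
        'i%C * (k%:R `^ (2 * alpha))%:C * inner (phi k) psi].

Definition opB (R : realType) (psi : wave R) : wave R :=
  fun x => - 'i%C * (cos x)%:C * psi x.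

Definition opAcB (R : realType) (alpha c : R) (psi chi : wave R) : Prop :=
  opA alpha psi (fun x => chi x - c%:C * opB psi x).

(* U is the strongly continuous one-parameter unitary group on Ho whose
   infinitesimal generator is exactly the operator with graph G.
   (Surjectivity of U t follows from the group law.) *)
Definition unitary_group (R : realType) (G : wave R -> wave R -> Prop)
    (U : R -> wave R -> wave R) : Prop :=
  [/\ (forall t psi, Ho psi -> Ho (U t psi)),
      (forall t (a : R[i]) psi chi, Ho psi -> Ho chi ->
         U t (fun x => a * psi x + chi x)
         = (fun x => a * U t psi x + U t chi x) %[ae torus R]) /\
      (forall t psi chi, Ho psi -> Ho chi ->
         inner (U t psi) (U t chi) = inner psi chi),
      (forall psi, Ho psi -> U 0 psi = psi %[ae torus R]) /\
      (forall s t psi, Ho psi ->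
         U (s + t) psi = U s (U t psi) %[ae torus R]),
      (forall psi, Ho psi ->
         L2norm (fun x => U t psi x - psi x) @[t --> (0 : R)] --> (0 : R)) &
      (forall psi chi, Ho psi -> Ho chi ->
         G psi chi <->
         L2norm (fun x => (t^-1)%:C * (U t psi x - psi x) - chi x)
           @[t --> (0 : R)^'] --> (0 : R))].

(* exp_op G t stands for e^{tG}, G skew-adjoint: by Stone's theorem a unitary
   group with generator G exists, and it is unique up to a.e. equality. *)
Definition exp_op (R : realType) (G : wave R -> wave R -> Prop) :
    R -> wave R -> wave R :=
  xget ((fun _ psi => psi) : R -> wave R -> wave R) [set U | unitary_group G U].

(* l lists the (duration, value) pairs of successive steps of u on [a, b].
   The values of u at the finitely many switching times are irrelevant. *)
Fixpoint steps (R : realType) (u : R -> R) (a : R) (l : seq (R * R)) (b : R) :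
    Prop :=
  if l is (s, c) :: l' then
    [/\ 0 < s, (forall x, a < x < a + s -> u x = c) & steps u (a + s) l' b]
  else a = b.

Definition piecewise_constant (R : realType) (u : R -> R) (t : R) : Prop :=
  exists l, steps u 0 l t.

Fixpoint propagate (R : realType) (alpha : R) (l : seq (R * R))
    (psi : wave R) : wave R :=
  if l is (s, c) :: l' then
    propagate alpha l' (exp_op (opAcB alpha c) s psi)
  else psi.

(* Any subdivision adapted to u may be used: by the group law the result does
   not depend on it up to a.e. equality. *)
Definition Upsilon (R : realType) (alpha : R) (u : R -> R) (t : R) :
    wave R -> wave R :=
  propagate alpha (xget [::] [set l | steps u 0 l t]).

Definition reach_at (R : realType) (alpha : R) (psi0 : wave R) (t : R) :
    set (wave R) :=
  [set psi | exists2 u, piecewise_constant u t & psi = Upsilon alpha u t psi0].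

Definition reach_before (R : realType) (alpha : R) (psi0 : wave R) (T : R) :
    set (wave R) :=
  \bigcup_(t in [set t | 0 <= t < T]) reach_at alpha psi0 t.

Definition reach_all (R : realType) (alpha : R) (psi0 : wave R) :
    set (wave R) :=
  \bigcup_(T in [set T | 0 < T]) reach_at alpha psi0 T.

(* The infimum is taken in the extended reals, so that it is +oo (and not 0)
   when no T qualifies. *)
Definition temporal_diameter (R : realType) (alpha : R) : \bar R :=
  ereal_inf [set T%:E | T in
    [set T | 0 <= T /\
       L2closure (reach_before alpha (phi 1) T) = @sphere R]].

(* Main.v *)
(* In the basis phi_k the system becomes x' = (i diag(k^(2 alpha)) + u B) x, with B tridiagonal.  Small
   times suffice for two kinds of motions.  A kick, the control c / s during a time s -> 0, realises
   exp (c B), that is, multiplication by exp (- i c cos); as |c| -> oo the coefficients of the image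
   in any fixed finite set of modes tend to 0, by integration by parts.  At high modes, an oscillating
   control in resonance with the transition k -> k + 1 rotates the plane (phi_k, phi_(k+1)) by any
   angle of bounded size: in time tau the error is O(1 / (tau * k^3)), since for alpha > 5/2 the
   spectral gaps of different transitions differ by at least 20 k^3.  With tau of order k^(-3/2) the
   total time and the total error of the rotations in all planes beyond N are O(N^(-1/2)).  So kick the
   initial state beyond N, rotate it plane after plane onto phi_N, go to phi_(N+1) with the right phase,
   run the reversed procedure for the target, and fill the remaining time with u = 0. *)
Require Import Defs.
From mathcomp Require Import all_boot all_order all_algebra.
From mathcomp Require Import all_classical all_reals all_analysis.
From mathcomp Require Import measurable_realfun spectral sesquilinear.
From mathcomp Require Import ring lra zify.
From mathcomp Require Import complex.
Set Implicit Arguments.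
Unset Strict Implicit.
Unset Printing Implicit Defensive.
Import Order.TTheory GRing.Theory Num.Theory.
Import numFieldNormedType.Exports.
Local Open Scope classical_set_scope.
Local Open Scope ring_scope.
Local Open Scope complex_scope.
Local Notation "z ^*" := (Num.conj z) : complex_scope.

(** The propagator of the statement is chosen among the unitary groups with a prescribed generator,
    so such a group has to be constructed and identified first. Both happen on coefficient
    sequences: the truncated systems are solved explicitly, they converge because the weight [k]
    commutes with [cos] up to a bounded operator, and every group with the right generator acts on
    coefficients as the limit does. Dynamics are then compared by one tool: a curve satisfying the
    equation up to a residual of norm at most e stays within e times the elapsed time of the true
    solution. By skew-adjointness no bound on the frequencies enters. Two choices make the steering
    estimates close. The durations satisfy tau ^ 2 * k ^ 3 >= 1, hence 1 / (tau * k ^ 3) <= tau: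
    each rotation errs by at most 11 times its duration, so that a short procedure is an accurate
    one. And the source and target chains end on different modes, N and N + 1, because a transfer
    between two modes has a free phase: it absorbs the unknown relative phase, and only the moduli,
    both close to 1, have to match. *)

Section ComplexNorm.

(** * Euclidean norms of finite sections of complex sequences *)

Context {R : realType}.
Implicit Types (z w : R[i]) (x y : nat -> R[i]).

Lemma cplxP z w : complex.Re z = complex.Re w -> complex.Im z = complex.Im w -> z = w.
Proof. by case: z w => [a b] [c d] /= -> ->. Qed.

Lemma ReD z w : complex.Re (z + w) = complex.Re z + complex.Re w.
Proof. by case: z w => [a b] [c d]. Qed.

Lemma ImD z w : complex.Im (z + w) = complex.Im z + complex.Im w.
Proof. by case: z w => [a b] [c d]. Qed.

Lemma ReN z : complex.Re (- z) = - complex.Re z. Proof. by case: z. Qed.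
Lemma ImN z : complex.Im (- z) = - complex.Im z. Proof. by case: z. Qed.

Lemma ReM z w : complex.Re (z * w) =
  complex.Re z * complex.Re w - complex.Im z * complex.Im w.
Proof. by case: z w => [a b] [c d]. Qed.

Lemma ImM z w : complex.Im (z * w) =
  complex.Re z * complex.Im w + complex.Im z * complex.Re w.
Proof. by case: z w => [a b] [c d] /=; rewrite addrC. Qed.

Lemma ReJ z : complex.Re z^* = complex.Re z. Proof. by case: z. Qed.
Lemma ImJ z : complex.Im z^* = - complex.Im z. Proof. by case: z. Qed.

Lemma conj_real (a : R) : a%:C^* = a%:C.
Proof. by apply: cplxP; rewrite ?ReJ ?ImJ //= oppr0. Qed.

Lemma ReC (a : R) : complex.Re a%:C = a. Proof. by []. Qed.
Lemma ImC (a : R) : complex.Im a%:C = 0. Proof. by []. Qed.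

Definition cpxE := (ReD, ImD, ReN, ImN, ReM, ImM, ReJ, ImJ).

Lemma Re_sum I (r : seq I) (P : pred I) (F : I -> R[i]) :
  complex.Re (\sum_(i <- r | P i) F i) = \sum_(i <- r | P i) complex.Re (F i).
Proof. by apply: (big_morph _ ReD). Qed.

(** The squared modulus, valued in [R] rather than in [R[i]] so that real order and real arithmetic
    apply to it directly. *)
Definition sqn z : R := complex.Re z ^+ 2 + complex.Im z ^+ 2.

Lemma sqn_ge0 z : 0 <= sqn z.
Proof. by rewrite addr_ge0 ?sqr_ge0. Qed.

Lemma sqn0 : sqn 0 = 0. Proof. by rewrite /sqn /= expr0n /= addr0. Qed.

Lemma sqn_eq0 z : sqn z = 0 -> z = 0.
Proof.
move=> /eqP; rewrite paddr_eq0 ?sqr_ge0 // !sqrf_eq0 => /andP[/eqP a /eqP b].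
exact: cplxP.
Qed.

Lemma sqnM z w : sqn (z * w) = sqn z * sqn w.
Proof. by rewrite /sqn !cpxE; ring. Qed.

Lemma sqnN z : sqn (- z) = sqn z.
Proof. by rewrite /sqn !cpxE !sqrrN. Qed.

Lemma sqnJ z : sqn z^* = sqn z.
Proof. by rewrite /sqn !cpxE sqrrN. Qed.

Lemma sqn_real (a : R) : sqn a%:C = a ^+ 2.
Proof. by rewrite /sqn /= expr0n addr0. Qed.

Lemma sqn_i : sqn 'i%C = 1.
Proof. by rewrite /sqn /= expr0n expr1n add0r. Qed.

Lemma sqnD_le z w : sqn (z + w) <= 2 * (sqn z + sqn w).
Proof.
rewrite /sqn !cpxE.
have h (a b : R) : (a + b) ^+ 2 <= 2 * (a ^+ 2 + b ^+ 2).
  by rewrite -subr_ge0 (_ : _ - _ = (a - b) ^+ 2) ?sqr_ge0 //; ring.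
have := h (complex.Re z) (complex.Re w); have := h (complex.Im z) (complex.Im w); lra.
Qed.

(** Both Cauchy-Schwarz inequalities of the development, for finite sums and for the [L2] inner
    product, come from this discriminant. *)
Lemma quad_disc (a b c : R) : (forall t, 0 <= a + 2 * b * t + c * t ^+ 2) ->
  0 <= c -> b ^+ 2 <= a * c.
Proof.
move=> h; rewrite le_eqVlt => /predU1P[c0|c0].
  subst c; rewrite mulr0; have [->|b0] := eqVneq b 0; first by rewrite expr0n.
  (* With no quadratic term, the affine function takes the value -1 at this point. *)
  exfalso; have := h (- (a + 1) / (2 * b)).
  rewrite [X in 0 <= X](_ : _ = -1); last by field.
  lra.
have := h (- b / c).
have -> : a + 2 * b * (- b / c) + c * (- b / c) ^+ 2 = (a * c - b ^+ 2) / c.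
  by field; rewrite gt_eqF.
by rewrite pmulr_lge0 ?invr_gt0 // subr_ge0.
Qed.

Definition nrm (K : nat) x : R := Num.sqrt (\sum_(k < K) sqn (x k)).

Lemma nrm_ge0 K x : 0 <= nrm K x. Proof. exact: sqrtr_ge0. Qed.

Lemma sum_sqn_ge0 K x : 0 <= \sum_(k < K) sqn (x k).
Proof. by apply: sumr_ge0 => i _; apply: sqn_ge0. Qed.

Lemma nrm_sqr K x : nrm K x ^+ 2 = \sum_(k < K) sqn (x k).
Proof. by rewrite sqr_sqrtr // sum_sqn_ge0. Qed.

Lemma nrm_leP K x e : 0 <= e -> (nrm K x <= e) = (\sum_(k < K) sqn (x k) <= e ^+ 2).
Proof. by move=> e0; rewrite -nrm_sqr ler_pXn2r // nnegrE nrm_ge0. Qed.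

Lemma le_nrm K x L y : \sum_(k < K) sqn (x k) <= \sum_(k < L) sqn (y k) ->
  nrm K x <= nrm L y.
Proof. by move=> h; apply: ler_wsqrtr. Qed.

Lemma eq_nrm K x y : (forall k, (k < K)%N -> x k = y k) -> nrm K x = nrm K y.
Proof.
by move=> h; rewrite /nrm; congr Num.sqrt; apply: eq_bigr => i _; rewrite h.
Qed.

Lemma nrm_mono K L x : (K <= L)%N -> nrm K x <= nrm L x.
Proof.
move=> KL; apply: le_nrm.
rewrite -!(big_mkord xpredT (fun k => sqn (x k))) [leRHS](big_cat_nat (n := K)) //=.
rewrite lerDl sumr_ge0 // => i _; apply: sqn_ge0.
Qed.

Lemma nrm_supp K L x : (K <= L)%N -> (forall k, (K <= k)%N -> x k = 0) ->
  nrm L x = nrm K x.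
Proof.
move=> KL h; rewrite /nrm; congr Num.sqrt.
rewrite -!(big_mkord xpredT (fun k => sqn (x k))) (big_cat_nat (n := K)) //=.
rewrite [X in _ + X]big1_seq ?addr0 // => i /andP[_].
by rewrite mem_index_iota => /andP[Ki _]; rewrite h // sqn0.
Qed.

Lemma Re_dot_le K x y :
  `|complex.Re (\sum_(k < K) (x k)^* * y k)| <= nrm K x * nrm K y.
Proof.
set b := complex.Re _.
have h t : 0 <= \sum_(k < K) sqn (x k) + 2 * b * t + (\sum_(k < K) sqn (y k)) * t ^+ 2.
  suff -> : \sum_(k < K) sqn (x k) + 2 * b * t + (\sum_(k < K) sqn (y k)) * t ^+ 2
    = \sum_(k < K) sqn (x k + t%:C * y k).
    by apply: sumr_ge0 => i _; apply: sqn_ge0.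
  rewrite /b Re_sum mulr_sumr !mulr_suml -!big_split /=; apply: eq_bigr => i _.
  by rewrite /sqn !cpxE /=; ring.
have := quad_disc h (sum_sqn_ge0 K y); rewrite -!nrm_sqr -exprMn -[b ^+ 2]real_normK ?num_real //.
by rewrite ler_pXn2r // nnegrE ?mulr_ge0 ?nrm_ge0.
Qed.

Lemma nrmD K x y : nrm K (fun k => x k + y k) <= nrm K x + nrm K y.
Proof.
rewrite nrm_leP ?addr_ge0 ?nrm_ge0 //.
have -> : \sum_(k < K) sqn (x k + y k) = nrm K x ^+ 2 + nrm K y ^+ 2 +
  2 * complex.Re (\sum_(k < K) (x k)^* * y k).
  rewrite !nrm_sqr Re_sum mulr_sumr -!big_split /=; apply: eq_bigr => i _.
  by rewrite /sqn !cpxE; ring.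
have := Re_dot_le K x y; rewrite ler_norml => /andP[_]; lra.
Qed.

Lemma nrmN K x : nrm K (fun k => - x k) = nrm K x.
Proof. by rewrite /nrm; congr Num.sqrt; apply: eq_bigr => i _; rewrite sqnN. Qed.

Lemma nrmB K x y : nrm K (fun k => x k - y k) <= nrm K x + nrm K y.
Proof. by rewrite -[nrm K y]nrmN nrmD. Qed.

Lemma nrm_distC K x y : nrm K (fun k => x k - y k) = nrm K (fun k => y k - x k).
Proof.
by rewrite -nrmN; apply: eq_nrm => k _; rewrite opprB.
Qed.

Lemma nrm_triangle K y x (z : nat -> R[i]) :
  nrm K (fun k => x k - z k) <= nrm K (fun k => x k - y k) + nrm K (fun k => y k - z k).
Proof.
rewrite -[leLHS](@eq_nrm _ (fun k => (x k - y k) + (y k - z k))); first exact: nrmD.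
by move=> k _; rewrite addrA subrK.
Qed.

Lemma nrm_dist_ge K x y : nrm K x - nrm K y <= nrm K (fun k => x k - y k).
Proof.
rewrite lerBlDr; rewrite -[leLHS](@eq_nrm _ (fun k => (x k - y k) + y k)); first exact: nrmD.
by move=> k _; rewrite subrK.
Qed.

Lemma nrmZ K (c : R[i]) x : nrm K (fun k => c * x k) = Num.sqrt (sqn c) * nrm K x.
Proof.
rewrite /nrm -sqrtrM ?sqn_ge0 // mulr_sumr; congr Num.sqrt.
by apply: eq_bigr => i _; rewrite sqnM.
Qed.

Lemma nrmZr K (c : R) x : nrm K (fun k => c%:C * x k) = `|c| * nrm K x.
Proof. by rewrite nrmZ sqn_real sqrtr_sqr. Qed.

Lemma nrm_scale K (s : R) x y : 0 <= s ->
  (forall k, (k < K)%N -> sqn (y k) <= s ^+ 2 * sqn (x k)) -> nrm K y <= s * nrm K x.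
Proof.
move=> s0 h; rewrite nrm_leP ?mulr_ge0 ?nrm_ge0 // exprMn nrm_sqr mulr_sumr.
by apply: ler_sum => i _; apply: h.
Qed.

Lemma sqn_le_nrm K x k : (k < K)%N -> sqn (x k) <= nrm K x ^+ 2.
Proof.
move=> kK; rewrite nrm_sqr (bigD1 (Ordinal kK)) //= lerDl sumr_ge0 // => i _.
exact: sqn_ge0.
Qed.

Lemma coord_le_nrm K x k : (k < K)%N -> Num.sqrt (sqn (x k)) <= nrm K x.
Proof.
move=> kK; apply: ler_wsqrtr; rewrite (bigD1 (Ordinal kK)) //= lerDl sumr_ge0 // => i _.
exact: sqn_ge0.
Qed.

Lemma cmodE z : Num.sqrt (sqn z) = nrm 1 (fun=> z).
Proof. by rewrite /nrm big_ord1. Qed.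

Lemma cmodD z w : Num.sqrt (sqn (z + w)) <= Num.sqrt (sqn z) + Num.sqrt (sqn w).
Proof. by rewrite !cmodE; apply: (nrmD 1 (fun=> z) (fun=> w)). Qed.

Lemma cmodM z w : Num.sqrt (sqn (z * w)) = Num.sqrt (sqn z) * Num.sqrt (sqn w).
Proof. by rewrite sqnM sqrtrM ?sqn_ge0. Qed.

Lemma cmod_real (a : R) : Num.sqrt (sqn a%:C) = `|a|.
Proof. by rewrite sqn_real sqrtr_sqr. Qed.

Lemma cmod_eq0 z : Num.sqrt (sqn z) = 0 -> z = 0.
Proof.
move/eqP; rewrite sqrtr_eq0 => h; apply: sqn_eq0; apply/eqP.
by rewrite eq_le h sqn_ge0.
Qed.

Lemma sqn_nat n : sqn n%:R = n%:R ^+ 2 :> R.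
Proof. by rewrite -sqn_real rmorph_nat. Qed.

Lemma nrm0 K : nrm K (fun _ => 0) = 0.
Proof. by rewrite /nrm big1 ?sqrtr0 // => i _; rewrite sqn0. Qed.

End ComplexNorm.

(** * Derivatives of complex curves and the energy inequality *)

Section ComplexDerivative.
Context {R : realType}.
Implicit Types (f g : R -> R[i]) (t : R).

Definition cderive f t (df : R[i]) : Prop :=
  is_derive t 1 (fun s => complex.Re (f s)) (complex.Re df) /\
  is_derive t 1 (fun s => complex.Im (f s)) (complex.Im df).

Lemma cderive_eq f t a b : cderive f t a -> a = b -> cderive f t b.
Proof. by move=> h <-. Qed.

Lemma eq_cderive f g t a : cderive f t a -> (forall s, f s = g s) -> cderive g t a.
Proof. by move=> h /funext <-. Qed.

Lemma cderive_cst (a : R[i]) t : cderive (fun=> a) t 0.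
Proof. by split; apply: is_derive_cst. Qed.

Lemma cderiveD f g t a b : cderive f t a -> cderive g t b ->
  cderive (fun s => f s + g s) t (a + b).
Proof.
move=> [f1 f2] [g1 g2]; split; rewrite !cpxE.
  by rewrite (_ : (fun s => _) = (fun s => complex.Re (f s)) + (fun s => complex.Re (g s)));
    [apply: is_deriveD|apply/funext => s; rewrite !cpxE].
by rewrite (_ : (fun s => _) = (fun s => complex.Im (f s)) + (fun s => complex.Im (g s)));
    [apply: is_deriveD|apply/funext => s; rewrite !cpxE].
Qed.

Lemma cderiveN f t a : cderive f t a -> cderive (fun s => - f s) t (- a).
Proof.
move=> [f1 f2]; split; rewrite !cpxE.
  by rewrite (_ : (fun s => _) = - (fun s => complex.Re (f s)));
    [apply: is_deriveN|apply/funext => s; rewrite !cpxE].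
by rewrite (_ : (fun s => _) = - (fun s => complex.Im (f s)));
    [apply: is_deriveN|apply/funext => s; rewrite !cpxE].
Qed.

Lemma cderiveB f g t a b : cderive f t a -> cderive g t b ->
  cderive (fun s => f s - g s) t (a - b).
Proof. by move=> ? ?; apply: cderiveD => //; apply: cderiveN. Qed.

Lemma is_derive_mul (f g : R -> R) t (a b : R) : is_derive t 1 f a -> is_derive t 1 g b ->
  is_derive t 1 (fun s => f s * g s) (a * g t + f t * b).
Proof.
move=> fa gb; have := is_deriveM fa gb; rewrite /GRing.scale /=.
by rewrite [g t * a]mulrC addrC; apply.
Qed.

Lemma is_derive_add (f g : R -> R) t (a b : R) : is_derive t 1 f a -> is_derive t 1 g b ->
  is_derive t 1 (fun s => f s + g s) (a + b).
Proof. by move=> fa gb; apply: is_deriveD. Qed.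

Lemma is_derive_sub (f g : R -> R) t (a b : R) : is_derive t 1 f a -> is_derive t 1 g b ->
  is_derive t 1 (fun s => f s - g s) (a - b).
Proof. by move=> fa gb; apply: is_deriveB. Qed.

Lemma is_derive_ext (f g : R -> R) t (a b : R) : is_derive t 1 f a ->
  (forall s, f s = g s) -> a = b -> is_derive t 1 g b.
Proof. by move=> h /funext <- <-. Qed.

Lemma cderiveM f g t a b : cderive f t a -> cderive g t b ->
  cderive (fun s => f s * g s) t (a * g t + f t * b).
Proof.
move=> [f1 f2] [g1 g2]; split.
  apply: is_derive_ext (is_derive_sub (is_derive_mul f1 g1) (is_derive_mul f2 g2)) _ _.
    by move=> s; rewrite !cpxE.
  by rewrite !cpxE; ring.
apply: is_derive_ext (is_derive_add (is_derive_mul f1 g2) (is_derive_mul f2 g1)) _ _.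
  by move=> s; rewrite !cpxE.
by rewrite !cpxE; ring.
Qed.

Lemma cderiveZ (c : R[i]) f t a : cderive f t a -> cderive (fun s => c * f s) t (c * a).
Proof.
move=> h; apply: cderive_eq (cderiveM (cderive_cst c t) h) _.
by rewrite mul0r add0r.
Qed.

Lemma cderiveJ f t a : cderive f t a -> cderive (fun s => (f s)^*) t a^*.
Proof.
move=> [f1 f2]; split.
  by apply: is_derive_ext f1 _ _ => [s|]; rewrite !cpxE.
by apply: is_derive_ext (is_deriveN f2) _ _ => [s|]; rewrite !cpxE.
Qed.

Lemma cderive_affine f (c b t : R) a : cderive f (c * t + b) a ->
  cderive (fun s => f (c * s + b)) t (c%:C * a).
Proof.
have H (h : R -> R) (u : R) : is_derive (c * t + b) 1 h u ->
    is_derive t 1 (fun s => h (c * s + b)) (c * u).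
  move=> hu; have g : is_derive t (1:R) (fun s : R => c * s + b) c.
    apply: is_derive_ext (is_derive_add (is_derive_mul (is_derive_cst c t 1)
      (is_derive_id t 1)) (is_derive_cst b t 1)) _ _ => //.
    by rewrite mul0r add0r mulr1 addr0.
  by apply: is_derive_ext (@is_derive1_comp _ h (fun s => c * s + b) t _ _ hu g) _ _ =>
     // ; rewrite mulrC.
by move=> [f1 f2]; split; rewrite !cpxE /= mul0r ?subr0 ?addr0; apply: H.
Qed.

Lemma cderive_real (f : R -> R) t a : is_derive t 1 f a ->
  cderive (fun s => (f s)%:C) t a%:C.
Proof. by move=> h; split => //=; apply: is_derive_cst. Qed.

Lemma cderive_id t : cderive (fun s : R => s%:C) t 1.
Proof. exact: cderive_real (is_derive_id t 1). Qed.

Definition expi (x : R) : R[i] := cos x +i* sin x.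

Lemma expi0 : expi 0 = 1. Proof. by rewrite /expi cos0 sin0. Qed.

Lemma expiD x y : expi (x + y) = expi x * expi y.
Proof. by apply: cplxP; rewrite !cpxE /= ?cosD ?sinD //; ring. Qed.

Lemma expiN x : expi (- x) = (expi x)^*.
Proof. by rewrite /expi cosN sinN. Qed.

Lemma sqn_expi x : sqn (expi x) = 1.
Proof. by rewrite /sqn /= cos2Dsin2. Qed.

Lemma expiNM x : expi (- x) * expi x = 1.
Proof. by rewrite -expiD addNr expi0. Qed.

Lemma expiMN x : expi x * expi (- x) = 1.
Proof. by rewrite -expiD subrr expi0. Qed.

Lemma cderive_expi (c b t : R) :
  cderive (fun s => expi (c * s + b)) t ('i%C * c%:C * expi (c * t + b)).
Proof.
have h u : cderive expi u ('i%C * expi u).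
  split; rewrite !cpxE /= ?mul0r ?mul1r ?sub0r ?add0r; first exact: is_derive_cos.
  exact: is_derive_sin.
by apply: cderive_eq (cderive_affine (h _)) _; ring.
Qed.

Lemma cderive_sqn f t a : cderive f t a ->
  is_derive t 1 (fun s => sqn (f s)) (2 * complex.Re ((f t)^* * a)).
Proof.
move=> [f1 f2].
apply: is_derive_ext (is_derive_add (is_derive_mul f1 f1) (is_derive_mul f2 f2)) _ _.
  by move=> s; rewrite /sqn; ring.
by rewrite !cpxE; ring.
Qed.

Lemma is_derive_sum n (f : nat -> R -> R) t (a : nat -> R) :
  (forall k, (k < n)%N -> is_derive t 1 (f k) (a k)) ->
  is_derive t 1 (fun s => \sum_(k < n) f k s) (\sum_(k < n) a k).
Proof.
elim: n => [|n IH] h.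
  by rewrite big_ord0; apply: is_derive_ext (is_derive_cst 0 t 1) _ _ => // s; rewrite big_ord0.
rewrite big_ord_recr /=; apply: is_derive_ext (is_derive_add (a := \sum_(i < n) a i) (b := a n) _ _) _ _; last first.
- reflexivity.
- by move=> s; rewrite [RHS]big_ord_recr.
- exact: h.
- by apply: IH => k kn; apply: h; apply: ltnW.
Qed.

Lemma derive_le_le (f df : R -> R) (a b : R) : a <= b ->
  (forall s, a <= s <= b -> is_derive s 1 f (df s)) ->
  (forall s, a <= s <= b -> df s <= 0) -> f b <= f a.
Proof.
move=> ab fd d0.
have cf : {within `[a, b], continuous f}.
  apply: derivable_within_continuous => s; rewrite in_itv /= => /fd h.
  exact: ex_derive.
have dle s : s \in `]a, b[ -> derive1 f s <= 0.
  rewrite in_itv /= => /andP[/ltW h1 /ltW h2].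
  have sab : a <= s <= b by rewrite h1.
  by rewrite derive1E (@derive_val _ _ _ _ _ _ _ (fd _ sab)) d0.
have df' : {in `]a, b[, forall x, derivable f x 1}.
  move=> s; rewrite in_itv /= => /andP[/ltW h1 /ltW h2].
  by apply: (@ex_derive _ _ _ _ _ _ _ (fd s _)); rewrite h1.
by apply: (ler0_derive1_le_cc df' dle cf); rewrite // in_itv /= lexx ab.
Qed.

(** Half the derivative of the squared norm is the real part of the product of [y] with its
    derivative, at most [e] times the norm; hence the norm itself grows at rate at most [e]. *)
Let energy_pos K (y dy : nat -> R -> R[i]) (e t : R) : 0 <= e -> 0 <= t ->
  (forall k s, (k < K)%N -> 0 <= s <= t -> cderive (y k) s (dy k s)) ->
  (forall s, 0 <= s <= t ->
     complex.Re (\sum_(k < K) (y k s)^* * dy k s) <= e * nrm K (y^~ s)) ->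
  nrm K (y^~ t) <= nrm K (y^~ 0) + e * t.
Proof.
move=> e0 t0 yd hE; apply/ler_addgt0Pr => d d0.
pose E s := \sum_(k < K) sqn (y k s).
have E0 s : 0 <= E s by exact: (sum_sqn_ge0 K (y^~ s)).
have Ed s : 0 < E s + d ^+ 2 by rewrite ltr_wpDl // exprn_gt0.
(* The square root is smoothed to avoid dividing by zero. *)
pose f s := Num.sqrt (E s + d ^+ 2) - e * s.
pose dE s := \sum_(k < K) 2 * complex.Re ((y k s)^* * dy k s).
pose df s := (2 * Num.sqrt (E s + d ^+ 2))^-1 * dE s - e.
have fd s : 0 <= s <= t -> is_derive s 1 f (df s).
  move=> st; apply: is_derive_sub; last first.
    apply: is_derive_ext (is_derive_mul (is_derive_cst e s 1) (is_derive_id s 1)) _ _ => //.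
    by rewrite mul0r add0r mulr1.
  have hE1 : is_derive s 1 (fun s => E s + d ^+ 2) (dE s).
    have h1 : is_derive s 1 E (dE s).
      apply: (@is_derive_sum K (fun k s => sqn (y k s)) s
        (fun k => 2 * complex.Re ((y k s)^* * dy k s))) => k kK.
      by apply: cderive_sqn; apply: yd.
    by apply: is_derive_ext (is_derive_add h1 (is_derive_cst (d ^+ 2) s 1)) _ _;
      rewrite ?addr0.
  exact: (@is_derive1_comp _ Num.sqrt (fun s => E s + d ^+ 2) s _ _ (is_derive1_sqrt (Ed s)) hE1).
have df0 s : 0 <= s <= t -> df s <= 0.
  move=> st; rewrite /df subr_le0.
  have -> : dE s = 2 * complex.Re (\sum_(k < K) (y k s)^* * dy k s).
    by rewrite /dE -mulr_sumr Re_sum.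
  have S0 : 0 < Num.sqrt (E s + d ^+ 2) by rewrite sqrtr_gt0.
  rewrite mulrC ler_pdivrMr ?mulr_gt0 // [e * _]mulrCA ler_pM2l //.
  apply: le_trans (hE s st) _; apply: ler_wpM2l => //.
  by apply: ler_wsqrtr; rewrite -/(E s) lerDl sqr_ge0.
have := derive_le_le t0 fd df0; rewrite /f mulr0 subr0 lerBlDr => H.
have h1 : nrm K (y^~ t) <= Num.sqrt (E t + d ^+ 2).
  by apply: ler_wsqrtr; rewrite -/(E t) lerDl sqr_ge0.
have h2 : Num.sqrt (E 0 + d ^+ 2) <= nrm K (y^~ 0) + d.
  rewrite -[leRHS]ger0_norm ?addr_ge0 ?nrm_ge0 ?(ltW d0) // -sqrtr_sqr.
  apply: ler_wsqrtr; rewrite sqrrD nrm_sqr -/(E 0).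
  by rewrite -addrA lerD2l lerDr mulrn_wge0 // mulr_ge0 ?nrm_ge0 // ltW.
lra.
Qed.

(** Only the real part of the product of [y] with its derivative enters, so the skew-adjoint part of
    an equation costs nothing, however large. Negative times are included because the group is used
    in both directions. *)
Lemma energy K (y dy : nat -> R -> R[i]) (e t : R) : 0 <= e ->
  (forall k s, (k < K)%N -> `|s| <= `|t| -> cderive (y k) s (dy k s)) ->
  (forall s, `|s| <= `|t| ->
     `|complex.Re (\sum_(k < K) (y k s)^* * dy k s)| <= e * nrm K (y^~ s)) ->
  nrm K (y^~ t) <= nrm K (y^~ 0) + e * `|t|.
Proof.
move=> e0 yd hE; have [t0|t0] := leP 0 t.
  rewrite [`|t|]ger0_norm //; apply: (@energy_pos K y dy) => //.
    move=> k s kK /andP[s0 st]; apply: yd => //.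
    by rewrite !ger0_norm.
  move=> s /andP[s0 st]; apply: le_trans (ler_norm _) _.
  by apply: hE; rewrite !ger0_norm.
(* Negative times reduce to positive ones by reversing the curve. *)
pose y' k s := y k (- s); pose dy' k s := - dy k (- s).
have := @energy_pos K y' dy' e (- t) e0.
rewrite /y' opprK oppr0 [`|t|]ltr0_norm //; apply.
- by rewrite oppr_ge0 ltW.
- move=> k s kK /andP[s0 st].
  have := @cderive_affine (y k) (-1) 0 s (dy k (- s)).
  rewrite !mulN1r addr0 => h; apply: eq_cderive (cderive_eq (h _) _) _.
  - by apply: yd => //; rewrite normrN ger0_norm // ltr0_norm.
  - by rewrite /dy' -[RHS]mulN1r; congr (_ * _); apply: cplxP; rewrite /= ?oppr0.
  - by move=> u; rewrite mulN1r addr0.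
- move=> s /andP[s0 st]; apply: le_trans (ler_norm _) _.
  under eq_bigr do rewrite /dy' mulrN.
  rewrite sumrN !cpxE normrN; apply: hE.
  by rewrite normrN ger0_norm // ltr0_norm.
Qed.

Lemma nrm_mvt K (y dy : nat -> R -> R[i]) (e t : R) : 0 <= e ->
  (forall k s, (k < K)%N -> `|s| <= `|t| -> cderive (y k) s (dy k s)) ->
  (forall s, `|s| <= `|t| -> nrm K (dy^~ s) <= e) ->
  nrm K (y^~ t) <= nrm K (y^~ 0) + e * `|t|.
Proof.
move=> e0 yd hE; apply: energy yd _ => // s st.
apply: le_trans (Re_dot_le K (y^~ s) (dy^~ s)) _; rewrite mulrC; apply: ler_wpM2r; first exact: nrm_ge0.
exact: hE.
Qed.

End ComplexDerivative.

(** * Tridiagonal skew-adjoint operators *)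

Section Tridiagonal.
Context {R : realType}.
Implicit Types (f x y : nat -> R[i]).

(** The number -i/2: multiplication by [cos] sends a sine mode to half the sum of its two
    neighbours. *)
Definition mhi : R[i] := 0 -i* 2^-1.

(* Entries [mhi * f (j + 1)] at [(j + 1, j + 2)] and [mhi * conj (f j)] at [(j + 1, j)]; with
   [f 0 = 0] this is the skew-adjoint operator of multiplication by [- i cos] when [f = 1]. *)
Definition tri f x (j : nat) : R[i] :=
  if j is j'.+1 then mhi * (f j'.+1 * x j'.+2 + (f j')^* * x j') else 0.

Lemma mhiE : mhi = - 'i%C * (2^-1)%:C.
Proof. by apply: cplxP; rewrite !cpxE /=; ring. Qed.

Lemma sqn_mhi : sqn mhi = 4^-1 :> R.
Proof. by rewrite /sqn /=; field. Qed.

Lemma triD f x y k : tri f (fun k => x k + y k) k = tri f x k + tri f y k.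
Proof. by case: k => [|k] /=; rewrite ?addr0 //; ring. Qed.

Lemma triZ f (a : R[i]) x k : tri f (fun k => a * x k) k = a * tri f x k.
Proof. by case: k => [|k] /=; rewrite ?mulr0 //; ring. Qed.

Lemma triB f x y k : tri f (fun k => x k - y k) k = tri f x k - tri f y k.
Proof. by case: k => [|k] /=; rewrite ?subr0 //; ring. Qed.

Lemma tri_coefD f g x k : tri (fun k => f k + g k) x k = tri f x k + tri g x k.
Proof. by case: k => [|k] /=; rewrite ?addr0 // rmorphD /=; ring. Qed.

Lemma tri_coefZ (a : R) f x k : tri (fun k => a%:C * f k) x k = a%:C * tri f x k.
Proof.
case: k => [|k]; rewrite /tri ?mulr0 //.
have -> : (a%:C * f k)^* = a%:C * (f k)^* by apply: cplxP; rewrite !cpxE /=; ring.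
by ring.
Qed.

Lemma eq_tri f x y k : (forall j, (j <= k.+1)%N -> x j = y j) -> tri f x k = tri f y k.
Proof. by case: k => [|k] //= h; rewrite !h // ltnW // ltnW. Qed.

Lemma tri_supp f x K : (forall k, (K <= k)%N -> x k = 0) ->
  forall k, (K < k)%N -> tri f x k = 0.
Proof.
move=> h [|k] //= Kk; rewrite !h ?mulr0 ?addr0 ?mulr0 //.
by rewrite (leq_trans (n := k)) // -ltnS ltnW.
Qed.

Lemma sum_neighbours (a : nat -> R) K : (forall k, 0 <= a k) ->
  \sum_(k < K) (if (k : nat) is j.+1 then a j.+2 + a j else 0) <=
  2 * \sum_(k < K.+1) a k.
Proof.
move=> a0; pose b (k : nat) := if k is j.+1 then a j.+2 + a j else 0.
(* The boundary terms make the bound inductive: the two sides differ exactly by [a 0 + a 1] for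
   every [m]. *)
have Q m : \sum_(k < m.+1) b k + a m <= 2 * \sum_(k < m.+1) a k + a m.+1.
  elim: m => [|m IH]; first by rewrite !big_ord1 /=; have := a0 0%N; have := a0 1%N; lra.
  by rewrite big_ord_recr [X in _ <= 2 * X + _]big_ord_recr /=; lra.
case: K => [|m]; first by rewrite big_ord0 big_ord1 mulr_ge0.
have := Q m; rewrite [X in _ -> _ <= 2 * X]big_ord_recr /=.
by have := a0 m; have := a0 m.+1; rewrite /b; lra.
Qed.

(** Every entry of [x] occurs in at most two rows, and this factor 2 cancels the 1/2 of the
    hypothesis. It serves the operators [tri f] and also the commutator with the weight [k]. *)
Lemma nrm_neighbours (s : R) K x (y : nat -> R[i]) : 0 <= s -> y 0%N = 0 ->
  (forall k, sqn (y k.+1) <= s ^+ 2 / 2 * (sqn (x k.+2) + sqn (x k))) ->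
  nrm K y <= s * nrm K.+1 x.
Proof.
move=> s0 y0 h; rewrite nrm_leP ?mulr_ge0 ?nrm_ge0 // exprMn nrm_sqr.
have := sum_neighbours K (fun k => sqn_ge0 (x k)).
rewrite -(ler_pM2l (x := s ^+ 2 / 2 + 1)); last by have := sqr_ge0 s; lra.
have s20 : 0 <= s ^+ 2 / 2 by rewrite mulr_ge0 // ?sqr_ge0 // invr_ge0.
move=> _; have := ler_wpM2l s20 (sum_neighbours K (fun k => sqn_ge0 (x k))).
rewrite mulrA divfK ?pnatr_eq0 //; apply: le_trans; rewrite mulr_sumr.
apply: ler_sum => -[[|k] kK] _ /=; first by rewrite y0 sqn0 mulr0.
exact: h.
Qed.

Lemma nrm_tri (s : R) K f x : 0 <= s -> (forall k, sqn (f k) <= s ^+ 2) ->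
  nrm K (tri f x) <= s * nrm K.+1 x.
Proof.
move=> s0 fs; apply: nrm_neighbours => // k /=.
rewrite sqnM sqn_mhi.
have h := sqnD_le (f k.+1 * x k.+2) ((f k)^* * x k).
rewrite !sqnM sqnJ in h.
have h1 := ler_wpM2r (sqn_ge0 (x k.+2)) (fs k.+1).
have h2 := ler_wpM2r (sqn_ge0 (x k)) (fs k).
have : sqn (f k.+1 * x k.+2 + (f k)^* * x k) <= 2 * s ^+ 2 * (sqn (x k.+2) + sqn (x k)).
  by lra.
lra.
Qed.

(** The partial sums telescope to the flux [p K / 2] through the last link, which vanishes with
    [x K]; [f 0 = 0] closes the link at the bottom. *)
Lemma tri_skew f x K : f 0%N = 0 -> x K = 0 ->
  complex.Re (\sum_(k < K) (x k)^* * tri f x k) = 0.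
Proof.
move=> f0 xK; pose p k := complex.Im ((x k)^* * f k * x k.+1).
rewrite Re_sum; case: K xK => [|K] xK; first by rewrite big_ord0.
suff -> : \sum_(k < K.+1) complex.Re ((x k)^* * tri f x k) = p K / 2.
  by rewrite /p xK mulr0 mul0r.
elim: K {xK} => [|K IH].
  by rewrite big_ord1 /= mulr0 /p f0 mulr0 mul0r mul0r.
by rewrite big_ord_recr /= IH /p !cpxE /=; ring.
Qed.

(** The link between the modes 0 and 1 is cut because [phi 0] is the zero function. *)
Definition bco (j : nat) : R[i] := if j is _.+1 then 1 else 0.

Lemma sqn_bco k : sqn (bco k) <= 1 ^+ 2 :> R.
Proof. by case: k => [|k] /=; rewrite expr1n ?sqn0 // /sqn /= expr1n expr0n addr0. Qed.

Lemma nrm_B K x : nrm K (tri bco x) <= nrm K.+1 x.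
Proof. by rewrite -[leRHS]mul1r; apply: nrm_tri => //; apply: sqn_bco. Qed.

Lemma cderive_tri f (y dy : nat -> R -> R[i]) k t :
  (forall j, (j <= k.+1)%N -> cderive (y j) t (dy j t)) ->
  cderive (fun s => tri f (y^~ s) k) t (tri f (dy^~ t) k).
Proof.
case: k => [|k] h /=; first exact: cderive_cst.
by apply: cderiveZ; apply: cderiveD; apply: cderiveZ; apply: h; rewrite // ltnW // ltnW.
Qed.

End Tridiagonal.

(** * Finite-dimensional truncations of the controlled system *)

Section Galerkin.
Context {R : realType}.
Variables (lam : nat -> R) (c : R).
Implicit Types (x y z : nat -> R[i]) (N : nat) (t s : R).

Definition seq_gen x k : R[i] := 'i%C * (lam k)%:C * x k + c%:C * tri bco x k.

Lemma genD x y k : seq_gen (fun k => x k + y k) k = seq_gen x k + seq_gen y k.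
Proof. by rewrite /seq_gen triD; ring. Qed.

Lemma genB x y k : seq_gen (fun k => x k - y k) k = seq_gen x k - seq_gen y k.
Proof. by rewrite /seq_gen triB; ring. Qed.

Lemma genZ (a : R[i]) x k : seq_gen (fun k => a * x k) k = a * seq_gen x k.
Proof. by rewrite /seq_gen triZ; ring. Qed.

Lemma eq_gen x y k : (forall j, (j <= k.+1)%N -> x j = y j) -> seq_gen x k = seq_gen y k.
Proof. by move=> h; rewrite /seq_gen h // (eq_tri _ h). Qed.

Definition trunc N x k : R[i] := if (k < N)%N then x k else 0.

Lemma trunc_supp N x k : (N <= k)%N -> trunc N x k = 0.
Proof. by rewrite /trunc leqNgt => /negbTE ->. Qed.

Lemma nrm_trunc N x : nrm N (trunc N x) = nrm N x.
Proof. by apply: eq_nrm => k kN; rewrite /trunc kN. Qed.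

Lemma nrm_trunc_le K N x : nrm K (trunc N x) <= nrm K x.
Proof.
rewrite -[leRHS]mul1r; apply: nrm_scale => // k _; rewrite expr1n mul1r /trunc.
by case: ifP => // _; rewrite sqn0 sqn_ge0.
Qed.

Lemma cderive_gen (y dy : nat -> R -> R[i]) k t :
  (forall j, (j <= k.+1)%N -> cderive (y j) t (dy j t)) ->
  cderive (fun s => seq_gen (y^~ s) k) t (seq_gen (dy^~ t) k).
Proof.
move=> h; apply: cderiveD; first by apply: cderiveZ; apply: h.
by apply: cderiveZ; apply: cderive_tri.
Qed.

(** The equation is imposed on the rows below [N] only; together with the support condition, this
    compresses the generator to the first [N] modes. *)
Definition solves N (y : R -> nat -> R[i]) : Prop :=
  (forall s k, (N <= k)%N -> y s k = 0) /\
  (forall s k, (k < N)%N -> cderive (y^~ k) s (seq_gen (y s) k)).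

(** The real symmetric matrix whose product with [i] is the generator. The conditions [0 < k] and
    [0 < j] cut the link to mode 0, as [bco] does. *)
Definition ham_entry (k j : nat) : R :=
  lam k *+ (k == j) - c / 2 *+ ((0 < k) && (j == k.+1) || (0 < j) && (k == j.+1))%N.

Lemma ham_row N x k : (k < N)%N ->
  'i%C * (\sum_(j < N) (ham_entry k j)%:C * x j) = seq_gen (trunc N x) k.
Proof.
move=> kN; have e : forall j : nat, (ham_entry k j)%:C * x j =
    (if j == k then (lam k)%:C * x j else 0) - (c / 2)%:C * (
    (if (0 < k)%N && (j == k.+1)%N then x j else 0) + (if (0 < j)%N && (k == j.+1) then x j else 0)).
  move=> j; rewrite /ham_entry eq_sym.
  have -> : (if j == k then (lam k)%:C * x j else 0) = (lam k *+ (j == k))%:C * x j.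
    by case: eqP => _; rewrite ?mulr1n // mulr0n mul0r.
  have -> (P Q : bool) : (if P then x j else 0) + (if Q then x j else 0) =
      (P%:R + Q%:R : R)%:C * x j.
    by case: P; case: Q; apply: cplxP; rewrite !cpxE /=; ring.
  have -> : (((0 < k) && (j == k.+1) || (0 < j) && (k == j.+1))%N : nat) =
      (((0 < k) && (j == k.+1)) + ((0 < j) && (k == j.+1)))%N.
    case: (eqVneq j k.+1) => [->|_]; rewrite ?andbF //= andbT.
    by rewrite (_ : (k == k.+2) = false) ?addn0 ?orbF //; lia.
  by rewrite mulrnDr -(mulr_natr (lam k)) -!(mulr_natr (c / 2)); apply: cplxP; rewrite !cpxE /=; ring.
under eq_bigr do rewrite e.
rewrite big_split /= sumrN -mulr_sumr big_split /=.
have sel (P : bool) (m : nat) : \sum_(j < N) (if P && (j == m :> nat) then x j else 0) =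
    (if P && (m < N)%N then x m else 0).
  case: P => /=; last by rewrite big1.
  case: ifP => mN; last first.
    by rewrite big1 // => j _; case: eqP => // jm; rewrite -jm ltn_ord in mN.
  rewrite (bigD1 (Ordinal mN)) //= eqxx big1 ?addr0 // => j.
  by rewrite -val_eqE /= => /negbTE ->.
have -> : \sum_(i < N) (if (i == k :> nat) then (lam k)%:C * x i else 0) = (lam k)%:C * x k.
  rewrite (bigD1 (Ordinal kN)) //= eqxx big1 ?addr0 // => j.
  by rewrite -val_eqE /= => /negbTE ->.
rewrite sel /seq_gen /trunc kN; case: k kN {e} => [|k] kN /=.
  rewrite add0r big1 ?mulr0 ?subr0 ?addr0; first by ring.
  by move=> j _; rewrite andbF.
have -> : \sum_(i < N) (if (0 < i)%N && (k.+1 == i.+1) then x i else 0) =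
    (bco k)^* * x k.
  under eq_bigr => i _ do rewrite eqSS eq_sym.
  have -> : (bco k)^* = (if (0 < k)%N then 1 else 0) :> R[i].
    by case: k kN => [|k] _; rewrite /= ?rmorph0 ?rmorph1.
  rewrite (bigD1 (Ordinal (ltnW kN))) //= eqxx andbT big1 ?addr0.
    by case: ifP; rewrite ?mul1r ?mul0r.
  by move=> j; rewrite -val_eqE /= => /negbTE ->; rewrite andbF.
rewrite (ltnW kN) mul1r; set a := if _ then _ else _.
by rewrite mhiE rmorphM; ring.
Qed.

(* The Hermitian matrix [ham_entry] is diagonalised to solve the linear system explicitly. *)
Lemma solution_exists N : exists G : R -> (nat -> R[i]) -> nat -> R[i],
  forall x, solves N (fun s => G s x) /\ G 0 x = trunc N x.
Proof.
pose H : 'M[R[i]]_N := \matrix_(k, j) (ham_entry k j)%:C.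
have Hherm : H \is hermsymmx.
  apply: realsym_hermsym.
    apply/is_hermitianmxP; rewrite expr0 scale1r; apply/matrixP => k j; rewrite !mxE /=.
    congr (_ %:C); rewrite /ham_entry eq_sym orbC; congr (_ - _).
    by case: eqVneq => [->|].
  apply/mxOverP => k j; rewrite mxE; by apply/complex_realP; exists (ham_entry k j).
have /hermitian_normalmx /orthomx_spectralP := Hherm.
have := hermitian_spectral_diag_real Hherm.
have := spectral_unit H.
set P := spectralmx H; set D := spectral_diag H => Pu Dreal HE.
pose d (j : 'I_N) : R := complex.Re (D 0 j).
have dE j : (d j)%:C = D 0 j by apply: RRe_real; move/mxOverP: Dreal; apply.
(* The exponential in the eigenbasis; the summand 0 in the phase matches the affine form of
   [cderive_expi]. *)
pose G (s : R) (x : nat -> R[i]) (k : nat) : R[i] :=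
  if insub k is Some i then
    \sum_(j < N) invmx P i j * expi (d j * s + 0) * (\sum_(l < N) P j l * x l) else 0.
have GE s x (i : 'I_N) : G s x i = \sum_(j < N) invmx P i j * expi (d j * s + 0) *
    (\sum_(l < N) P j l * x l).
  by rewrite /G valK.
have Gs s x k : (N <= k)%N -> G s x k = 0.
  by move=> Nk; rewrite /G insubF // ltnNge Nk.
exists G => x; split; last first.
  apply/funext => k; rewrite /trunc; case: ifP => [kN|/negbT]; last first.
    by rewrite -leqNgt; apply: Gs.
  rewrite (GE 0 x (Ordinal kN)).
  under eq_bigr do rewrite mulr0 addr0 expi0 mulr1 mulr_sumr.
  rewrite exchange_big /=.
  under eq_bigr => l _ do (under eq_bigr do rewrite mulrA; rewrite -mulr_suml).
  have E l : \sum_(i < N) invmx P (Ordinal kN) i * P i l = (Ordinal kN == l)%:R.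
    by have := mulVmx Pu => /matrixP /(_ (Ordinal kN) l); rewrite !mxE.
  under eq_bigr do rewrite E.
  rewrite (bigD1 (Ordinal kN)) //= eqxx mul1r big1 ?addr0 // => j.
  by rewrite eq_sym => /negbTE ->; rewrite mul0r.
split; first by move=> s k; apply: Gs.
move=> s k kN; pose i := Ordinal kN.
rewrite (@eq_gen _ (trunc N (G s x))); last first.
  by move=> j _; rewrite /trunc; case: ifP => // /negbT; rewrite -leqNgt => /Gs ->.
rewrite -(ham_row _ kN).
have -> : \sum_(j < N) (ham_entry k j)%:C * G s x j =
  \sum_(j < N) invmx P i j * D 0 j * expi (d j * s + 0) * (\sum_(l < N) P j l * x l).
  pose v : 'cV[R[i]]_N := \col_j (expi (d j * s + 0) * (\sum_(l < N) P j l * x l)).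
  have e1 : \sum_(j < N) (ham_entry k j)%:C * G s x j = (H *m (invmx P *m v)) i 0.
    rewrite mxE; apply: eq_bigr => j _; rewrite [H _ _]mxE GE; congr (_ * _).
    by rewrite mxE; apply: eq_bigr => l _; rewrite [v _ _]mxE mulrA.
  have e2 : H *m (invmx P *m v) = invmx P *m (diag_mx D *m v).
    by rewrite {1}HE -(mulmxA (invmx P *m diag_mx D)) (mulKVmx Pu) mulmxA.
  rewrite e1 e2 mxE; apply: eq_bigr => j _.
  rewrite [(_ *m v) _ _]mxE (bigD1 j) //= big1 ?addr0; last first.
    by move=> l lj; rewrite !mxE eq_sym (negbTE lj) mulr0n mul0r.
  by rewrite !mxE eqxx mulr1n ?addr0; ring.
rewrite mulr_sumr.
apply: (@eq_cderive R (fun s => \sum_(j < N) invmx P i j * expi (d j * s + 0) *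
    (\sum_(l < N) P j l * x l))); last by move=> u; rewrite -(GE u x i).
have C n (f : 'I_n -> R -> R[i]) (a : 'I_n -> R[i]) : (forall j, cderive (f j) s (a j)) ->
    cderive (fun s => \sum_(j < n) f j s) s (\sum_(j < n) a j).
  elim: n f a => [|n IH] f a h.
    by rewrite big_ord0; apply: eq_cderive (cderive_cst 0 s) _ => u; rewrite big_ord0.
  rewrite big_ord_recr /=; apply: eq_cderive (cderiveD (IH _ _ _) (h _)) _.
    by move=> j; apply: h.
  by move=> u; rewrite [RHS]big_ord_recr.
apply: C => j; rewrite -dE.
apply: eq_cderive (cderive_eq (cderiveZ
  (invmx P i j * (\sum_(l < N) P j l * x l)) (cderive_expi (d j) 0 s)) _) _.
- by ring.
- by move=> u; ring.
Qed.

Definition gal N : R -> (nat -> R[i]) -> nat -> R[i] := projT1 (cid (solution_exists N)).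

Lemma gal_solves N x : solves N (fun s => gal N s x).
Proof. by rewrite /gal; case: cid => G /= /(_ x) []. Qed.

Lemma gal0 N x : gal N 0 x = trunc N x.
Proof. by rewrite /gal; case: cid => G /= /(_ x) []. Qed.

Lemma gal_supp N t x k : (N <= k)%N -> gal N t x k = 0.
Proof. by have [h _] := gal_solves N x; apply: h. Qed.

Lemma gen_skew N x : (forall k, (N <= k)%N -> x k = 0) ->
  complex.Re (\sum_(k < N) (x k)^* * seq_gen x k) = 0.
Proof.
move=> h; rewrite /seq_gen; under eq_bigr do rewrite mulrDr.
rewrite big_split /= cpxE [X in X + _]Re_sum big1 ?add0r; last first.
  by move=> k _; rewrite !cpxE /=; ring.
under eq_bigr do rewrite mulrCA.
by rewrite -mulr_sumr cpxE tri_skew ?h // mulr0 mul0r subr0.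
Qed.

Lemma solves_energy N (y : R -> nat -> R[i]) (r : R -> nat -> R[i]) e t : 0 <= e ->
  (forall s k, (N <= k)%N -> y s k = 0) ->
  (forall s k, (k < N)%N -> cderive (y^~ k) s (seq_gen (y s) k + r s k)) ->
  (forall s, `|s| <= `|t| -> nrm N (r s) <= e) ->
  nrm N (y t) <= nrm N (y 0) + e * `|t|.
Proof.
move=> e0 ys yd hr.
apply: (@energy R N (fun k s => y s k) (fun k s => seq_gen (y s) k + r s k)) => //.
  by move=> k s kN _; apply: yd.
move=> s st; under eq_bigr do rewrite mulrDr.
rewrite big_split /= cpxE gen_skew ?add0r; last exact: ys.
apply: le_trans (Re_dot_le N (y s) (r s)) _; rewrite mulrC; apply: ler_wpM2r.
  exact: nrm_ge0.
exact: hr.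
Qed.

(** The basic comparison: the difference between an approximate solution and the exact one solves
    the same equation with source [r], and by skew-adjointness only the source makes its norm
    grow. *)
Lemma gal_duhamel N (z : R -> nat -> R[i]) (r : R -> nat -> R[i]) e t : 0 <= e ->
  (forall s k, (N <= k)%N -> z s k = 0) ->
  (forall s k, (k < N)%N -> cderive (z^~ k) s (seq_gen (z s) k + r s k)) ->
  (forall s, `|s| <= `|t| -> nrm N (r s) <= e) ->
  nrm N (fun k => z t k - gal N t (z 0) k) <= e * `|t|.
Proof.
move=> e0 zs zd hr.
have := @solves_energy N (fun s k => z s k - gal N s (z 0) k) r e t e0.
rewrite gal0 [nrm N (fun k => z 0 k - trunc _ _ k)](_ : _ = 0); last first.
  by rewrite -(nrm0 N); apply: eq_nrm => k kN; rewrite /trunc kN subrr.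
rewrite add0r; apply => //.
  by move=> s k Nk; rewrite zs // gal_supp // subrr.
move=> s k kN; rewrite genB; apply: cderive_eq (cderiveB (zd _ _ kN) _) _.
  by have [_] := gal_solves N (z 0); apply.
by ring.
Qed.

Lemma gal_unique N (z : R -> nat -> R[i]) t : solves N z -> z t = gal N t (z 0).
Proof.
move=> [zs zd]; have := @gal_duhamel N z (fun _ _ => 0) 0 t (lexx _) zs.
rewrite mul0r => h; have h0 : nrm N (fun k => z t k - gal N t (z 0) k) <= 0.
  apply: h => [s k kN|s _]; last by rewrite nrm0.
  by rewrite addr0; apply: zd.
apply/funext => k; case: (ltnP k N) => kN; last by rewrite zs // gal_supp.
apply/eqP; rewrite -subr_eq0; apply/eqP; apply: sqn_eq0; apply/eqP.
rewrite eq_le sqn_ge0 andbT.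
apply: le_trans (sqn_le_nrm (fun k => z t k - gal N t (z 0) k) kN) _.
have -> : nrm N (fun k => z t k - gal N t (z 0) k) = 0.
  by apply/eqP; rewrite eq_le h0 nrm_ge0.
by rewrite expr0n.
Qed.

Lemma eq_gal N t x y : (forall k, (k < N)%N -> x k = y k) -> gal N t x = gal N t y.
Proof.
move=> h; have e : trunc N x = trunc N y.
  by apply/funext => k; rewrite /trunc; case: ifP => // /h.
rewrite (gal_unique t (gal_solves N x)) (gal_unique t (gal_solves N y)).
by rewrite !gal0 e.
Qed.

Lemma gal_trunc N t x : gal N t (trunc N x) = gal N t x.
Proof. by apply: eq_gal => k kN; rewrite /trunc kN. Qed.

Lemma galZD N t (a : R[i]) x y :
  gal N t (fun k => a * x k + y k) = (fun k => a * gal N t x k + gal N t y k).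
Proof.
have [xs xd] := gal_solves N x; have [ys yd] := gal_solves N y.
rewrite (@gal_unique N (fun t k => a * gal N t x k + gal N t y k)).
  rewrite !gal0; apply: eq_gal => k kN; by rewrite /trunc kN.
split; first by move=> s k Nk; rewrite xs // ys // mulr0 addr0.
move=> s k kN; rewrite genD genZ; apply: cderiveD; last exact: yd.
by apply: cderiveZ; apply: xd.
Qed.

Lemma galB N t x y : gal N t (fun k => x k - y k) = (fun k => gal N t x k - gal N t y k).
Proof.
have := galZD N t (-1) y x.
rewrite (_ : (fun k => -1 * y k + x k) = (fun k => x k - y k)) => [->|].
  by apply/funext => k; rewrite mulN1r addrC.
by apply/funext => k; rewrite mulN1r addrC.
Qed.

Lemma gal_add N s t x : gal N (s + t) x = gal N s (gal N t x).
Proof.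
have [xs xd] := gal_solves N x.
rewrite (@gal_unique N (fun s => gal N (s + t) x)) ?add0r //.
split; first by move=> u k; apply: xs.
move=> u k kN; have := @cderive_affine _ (fun s => gal N s x k) 1 t u (seq_gen (gal N (u + t) x) k).
rewrite mul1r => /(_ (xd _ _ kN)) h.
apply: (eq_cderive (cderive_eq h _)); first by rewrite mul1r.
by move=> v; rewrite mul1r.
Qed.

Lemma nrm_gal_le N t x : nrm N (gal N t x) <= nrm N x.
Proof.
have [xs xd] := gal_solves N x.
have := @solves_energy N (fun s => gal N s x) (fun _ _ => 0) 0 t (lexx _) xs.
rewrite mul0r addr0 gal0 nrm_trunc; apply => [s k kN|s _]; last by rewrite nrm0.
by rewrite addr0; apply: xd.
Qed.

Lemma nrm_galK N K t x : nrm K (gal N t x) <= nrm N x.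
Proof.
apply: le_trans (nrm_gal_le N t x); have [KN|NK] := leqP K N; first exact: nrm_mono.
by rewrite (nrm_supp (ltnW NK)) // => k; apply: gal_supp.
Qed.

(** The flow commutes with its generator, since both sides solve the same truncated equation with
    the same initial value. *)
Lemma gal_gen N t x : gal N t (trunc N (seq_gen (trunc N x))) = trunc N (seq_gen (gal N t x)).
Proof.
have [xs xd] := gal_solves N x.
rewrite (@gal_unique N (fun t => trunc N (seq_gen (gal N t x)))) ?gal0 //.
split; first by move=> s k; apply: trunc_supp.
move=> s k kN.
have H : cderive (fun s => seq_gen (gal N s x) k) s (seq_gen (trunc N (seq_gen (gal N s x))) k).
  apply: (@cderive_gen (fun k s => gal N s x k) (fun k s => trunc N (seq_gen (gal N s x)) k)).
  move=> j _; rewrite /trunc; case: ifP => jN; first exact: xd.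
  apply: eq_cderive (cderive_cst 0 s) _ => u; rewrite xs //.
  by rewrite leqNgt jN.
apply: eq_cderive H _ => u; by rewrite /trunc kN.
Qed.

Lemma nrm_gen m N x (L : R) : 0 <= L -> (m <= N)%N -> (forall k, (k < m)%N -> `|lam k| <= L) ->
  (forall k, (m <= k)%N -> x k = 0) -> nrm N (seq_gen x) <= (L + `|c|) * nrm N x.
Proof.
move=> L0 mN hL xs; rewrite mulrDl; apply: le_trans (nrmD _ _ _) _; apply: lerD.
  apply: nrm_scale => // k _; case: (ltnP k m) => km; last first.
    by rewrite xs // mulr0 sqn0 mulr0.
  rewrite !sqnM sqn_i mul1r sqn_real; apply: ler_wpM2r; first exact: sqn_ge0.
  by rewrite -[lam k ^+ 2]real_normK ?num_real // ler_pXn2r ?nnegrE // hL.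
rewrite nrmZr; apply: ler_wpM2l => //; apply: le_trans (nrm_B _ _) _.
rewrite (@nrm_supp _ m N) // (@nrm_supp _ m N.+1) //.
exact: leqW.
Qed.

(** The weight [k] commutes with the diagonal part and changes by one across each link, so its
    commutator with the generator has norm at most [|c|]. The resulting moment bound does not depend
    on [N] or on the frequencies. *)
Lemma gal_weight N t x :
  nrm N (fun k => k%:R * gal N t x k) <= nrm N (fun k => k%:R * x k) + `|c| * nrm N x * `|t|.
Proof.
have [xs xd] := gal_solves N x.
pose r s k := k%:R * seq_gen (gal N s x) k - seq_gen (fun k => k%:R * gal N s x k) k.
have H : nrm N (fun k => k%:R * gal N t x k) <= nrm N (fun k => k%:R * gal N 0 x k) +
   (`|c| * nrm N x) * `|t|.
  apply: (@solves_energy N (fun s k => k%:R * gal N s x k) r).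
  - by rewrite mulr_ge0 ?nrm_ge0.
  - by move=> s k Nk; rewrite xs // mulr0.
  - move=> s k kN; apply: cderive_eq (cderiveZ k%:R (xd _ _ kN)) _.
    by rewrite /r addrCA subrr addr0.
  - move=> s _; apply: le_trans (_ : `|c| * nrm N.+1 (gal N s x) <= _); last first.
      by apply: ler_wpM2l => //; apply: nrm_galK.
    have rE k : r s k = c%:C * (k%:R * tri bco (gal N s x) k -
        tri bco (fun k => k%:R * gal N s x k) k).
      by rewrite /r /seq_gen; ring.
    rewrite (@eq_nrm _ _ _ (fun k => c%:C * (k%:R * tri bco (gal N s x) k -
        tri bco (fun k => k%:R * gal N s x k) k))); last by move=> k _; apply: rE.
    rewrite nrmZr; apply: ler_wpM2l => //; rewrite -[leRHS]mul1r.
    apply: nrm_neighbours => //= [|k]; first by rewrite mulr0 subrr.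
    have -> : k.+1%:R * (mhi * (1 * gal N s x k.+2 + (bco k)^* * gal N s x k)) -
       mhi * (1 * (k.+2%:R * gal N s x k.+2) + (bco k)^* * (k%:R * gal N s x k)) =
       mhi * (- gal N s x k.+2 + (bco k)^* * gal N s x k).
      by rewrite -[k.+2]addn2 -[k.+1]addn1 !natrD; ring.
    rewrite sqnM sqn_mhi.
    have := sqnD_le (- gal N s x k.+2) ((bco k)^* * gal N s x k).
    rewrite sqnN sqnM sqnJ.
    have := ler_wpM2r (sqn_ge0 (gal N s x k)) (@sqn_bco R k).
    by rewrite expr1n; lra.
rewrite gal0 in H.
rewrite (@eq_nrm _ N (fun k => k%:R * x k) (fun k => k%:R * trunc N x k)) //.
by move=> k kN; rewrite /trunc kN.
Qed.

(** Seen in the larger truncation [M], the solution of the truncation [N] violates only the row [N],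
    by what leaks from the mode [N - 1]. The moment bound makes this leak of order 1/N. *)
Lemma gal_cauchy_fin J t x : (forall k, (J <= k)%N -> x k = 0) -> exists C : R, 0 <= C /\
  forall N M, (J <= N)%N -> (1 < N)%N -> (N <= M)%N ->
    nrm M (fun k => gal N t x k - gal M t x k) <= C / N.-1%:R.
Proof.
move=> xs.
pose W s := nrm J (fun k => k%:R * x k) + `|c| * nrm J x * `|s|.
have W0 s : 0 <= W s by rewrite addr_ge0 ?nrm_ge0 // !mulr_ge0 ?nrm_ge0.
exists (`|c| * W t * `|t|); split; first by rewrite !mulr_ge0.
move=> N M JN N1 NM.
have n0 : 0 < (N.-1%:R : R) by rewrite ltr0n; case: N N1 {JN NM} => [|[]].
rewrite [leRHS](_ : _ = `|c| * W t / N.-1%:R * `|t|); last by rewrite mulrAC.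
have [gs gd] := gal_solves N x.
pose r s k := if (k < N)%N then 0 else - seq_gen (gal N s x) k.
have xN : trunc N x = x.
  apply/funext => k; rewrite /trunc; case: ifP => // /negbT; rewrite -leqNgt => h.
  by rewrite xs // (leq_trans JN).
rewrite -[X in gal M t X]xN -(gal0 N x).
apply: (@gal_duhamel M (fun s => gal N s x) r).
- by rewrite divr_ge0 ?mulr_ge0 // ltW.
- by move=> s k Mk; rewrite gs // (leq_trans NM).
- move=> s k kM; rewrite /r; case: ltnP => kN; first by rewrite addr0; apply: gd.
  rewrite subrr; apply: eq_cderive (cderive_cst 0 s) _ => u.
  by rewrite gs.
move=> s st.
have rN k : (N < k)%N -> r s k = 0.
  move=> Nk; rewrite /r ltnNge (ltnW Nk) /= /seq_gen (tri_supp _ (gs s)) // gs; last exact: ltnW.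
  by rewrite !mulr0 addr0 oppr0.
apply: le_trans (_ : nrm N.+1 (r s) <= _).
  have [h|h] := leqP M N.+1; first exact: nrm_mono.
  by rewrite (@nrm_supp _ N.+1 M) // ltnW.
have -> : nrm N.+1 (r s) = `|c| * Num.sqrt (sqn (mhi * gal N s x N.-1)).
  rewrite /nrm big_ord_recr /= big1 ?add0r; last by move=> k _; rewrite /r ltn_ord sqn0.
  rewrite /r ltnn sqnN /seq_gen gs // mulr0 add0r sqnM sqn_real sqrtrM ?sqr_ge0 // sqrtr_sqr.
  case: N N1 {JN NM n0 gs gd r xN rN} => [|[|N]] // _ /=.
  by rewrite gal_supp // mulr0 add0r rmorph1 mul1r.
rewrite -mulrA; apply: ler_wpM2l => //.
rewrite ler_pdivlMr // sqnM sqn_mhi.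
have h1 : N.-1%:R * Num.sqrt (sqn (gal N s x N.-1)) <= W s.
  apply: le_trans (_ : nrm N (fun k => k%:R * gal N s x k) <= _); last first.
    apply: le_trans (gal_weight _ _ _) _; rewrite /W !(@nrm_supp _ J N) //.
    by move=> k Jk; rewrite xs // mulr0.
  have NN : (N.-1 < N)%N by case: (N) N1.
  have := coord_le_nrm (fun k => k%:R * gal N s x k) NN.
  by rewrite sqnM sqn_nat sqrtrM ?sqr_ge0 // sqrtr_sqr ger0_norm // ltW.
have h2 : W s <= W t.
  by rewrite lerD2l; apply: ler_wpM2l => //; rewrite mulr_ge0 ?nrm_ge0.
apply: le_trans h2; apply: le_trans h1; rewrite mulrC; apply: ler_wpM2l; first exact: ltW.
apply: ler_wsqrtr; have := sqn_ge0 (gal N s x N.-1); lra.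
Qed.

End Galerkin.

(** * Square-summable sequences: tails and completeness *)

Section SquareSummable.
Context {R : realType}.
Implicit Types (x y z : nat -> R[i]) (e : R).

(* [l2le x e] says that the l^2 norm of [x] is at most [e], without forming an infinite sum. *)
Definition l2le x e := forall K, nrm K x <= e.
Definition l2 x := exists e, l2le x e.
Definition cvg2 (u : nat -> nat -> R[i]) x := forall e, 0 < e ->
  exists N0, forall N, (N0 <= N)%N -> l2le (fun k => u N k - x k) e.

Lemma l2leD x y a b : l2le x a -> l2le y b -> l2le (fun k => x k + y k) (a + b).
Proof. by move=> ha hb K; apply: le_trans (nrmD _ _ _) _; apply: lerD. Qed.

Lemma l2leB x y a b : l2le x a -> l2le y b -> l2le (fun k => x k - y k) (a + b).
Proof. by move=> ha hb K; apply: le_trans (nrmB _ _ _) _; apply: lerD. Qed.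

Lemma l2leZ (c : R[i]) x a : l2le x a -> l2le (fun k => c * x k) (Num.sqrt (sqn c) * a).
Proof. by move=> h K; rewrite nrmZ; apply: ler_wpM2l; rewrite ?sqrtr_ge0. Qed.

Lemma l2le_triangle y x z a b : l2le (fun k => x k - y k) a -> l2le (fun k => y k - z k) b ->
  l2le (fun k => x k - z k) (a + b).
Proof. by move=> ha hb K; apply: le_trans (nrm_triangle _ _ _ _) _; apply: lerD. Qed.

Lemma l2le_distC x y a : l2le (fun k => x k - y k) a -> l2le (fun k => y k - x k) a.
Proof. by move=> h K; rewrite nrm_distC. Qed.

Lemma l2le_weak x a b : a <= b -> l2le x a -> l2le x b.
Proof. by move=> ab h K; apply: le_trans ab. Qed.

Lemma l2le_ge0 x e : l2le x e -> 0 <= e.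
Proof. by move=> /(_ 0%N); apply: le_trans; apply: nrm_ge0. Qed.

Lemma l2le_from K0 x e : (forall K, (K0 <= K)%N -> nrm K x <= e) -> l2le x e.
Proof.
move=> h K; apply: le_trans (h (maxn K0 K) (leq_maxl _ _)).
by apply: nrm_mono; apply: leq_maxr.
Qed.

Lemma l2ZD (c : R[i]) x y : l2 x -> l2 y -> l2 (fun k => c * x k + y k).
Proof.
move=> [a ha] [b hb]; exists (Num.sqrt (sqn c) * a + b).
by apply: l2leD => //; apply: l2leZ.
Qed.

Lemma coord_le x e k : l2le x e -> Num.sqrt (sqn (x k)) <= e.
Proof. by move=> h; apply: le_trans (h k.+1); apply: coord_le_nrm. Qed.

Lemma l2le0_eq x y : (forall e, 0 < e -> l2le (fun k => x k - y k) e) -> x = y.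
Proof.
move=> h; apply/funext => k; apply/eqP; rewrite -subr_eq0; apply/eqP; apply: sqn_eq0.
have h0 : Num.sqrt (sqn (x k - y k)) <= 0.
  by apply/ler_addgt0Pr => e e0; rewrite add0r; apply: (coord_le k (h e e0)).
have : Num.sqrt (sqn (x k - y k)) = 0 by apply/eqP; rewrite eq_le h0 sqrtr_ge0.
by move/eqP; rewrite sqrtr_eq0 => h2; apply/eqP; rewrite eq_le h2 sqn_ge0.
Qed.

Lemma cvg2_unique u x y : cvg2 u x -> cvg2 u y -> x = y.
Proof.
move=> hx hy; apply: l2le0_eq => e e0.
have e2 : 0 < e / 2 by rewrite divr_gt0.
have [N1 h1] := hx _ e2; have [N2 h2] := hy _ e2.
have := l2le_triangle (l2le_distC (h1 (maxn N1 N2) (leq_maxl _ _)))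
  (h2 (maxn N1 N2) (leq_maxr _ _)).
by rewrite -splitr.
Qed.

Lemma l2_tail x e : l2 x -> 0 < e -> exists m0, forall m, (m0 <= m)%N ->
  l2le (fun k => x k - trunc m x k) e.
Proof.
move=> [a ha] e0.
pose S := [set r | exists K, r = nrm K x ^+ 2].
have a0 := l2le_ge0 ha.
have hS : has_sup S.
  split; first by exists (nrm 0%N x ^+ 2); exists 0%N.
  exists (a ^+ 2) => _ [K ->]; rewrite ler_pXn2r ?nnegrE ?nrm_ge0 //; exact: ha.
(* The squared norm of a tail is a difference of partial sums, hence small once a partial sum is
   within [e ^+ 2] of their supremum. *)
have [_ [m0 ->] hm] := sup_adherent (exprn_gt0 2 e0) hS.
exists m0 => m m0m; apply: (@l2le_from m) => K mK.
rewrite nrm_leP ?ltW //.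
have -> : \sum_(k < K) sqn (x k - trunc m x k) = nrm K x ^+ 2 - nrm m x ^+ 2.
  rewrite !nrm_sqr -!(big_mkord xpredT (fun k => sqn (x k))).
  rewrite -(big_mkord xpredT (fun k => sqn (x k - trunc m x k))).
  rewrite !(big_cat_nat (n := m) (m := 0%N) (p := K)) //= [X in X + _]big_nat_cond big1 ?add0r.
    rewrite addrAC subrr add0r !big_nat; apply: eq_bigr => k /andP[mk _].
    by rewrite trunc_supp // subr0.
  by move=> k /andP[/andP[_ km] _]; rewrite /trunc km subrr sqn0.
have : nrm K x ^+ 2 <= sup S by apply: ub_le_sup; [case: hS|exists K].
have : nrm m0 x ^+ 2 <= nrm m x ^+ 2.
  by rewrite ler_pXn2r ?nnegrE ?nrm_ge0 //; apply: nrm_mono.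
by move: hm; lra.
Qed.

Lemma real_cauchy_lim (a : nat -> R) : (forall e, 0 < e -> exists N0, forall N M,
    (N0 <= N)%N -> (N0 <= M)%N -> `|a N - a M| <= e) ->
  exists l, forall e, 0 < e -> exists N0, forall N, (N0 <= N)%N -> `|a N - l| <= e.
Proof.
move=> h; have : cvg (a @ \oo).
  apply/cauchy_cvgP/cauchy_exP => _ /posnumP[e].
  have e2 : 0 < e%:num / 2 by rewrite divr_gt0.
  have [N0 hN] := h _ e2; exists (a N0); exists N0 => // n /= N0n.
  rewrite /ball /= (le_lt_trans (hN _ _ (leqnn _) N0n)) //.
  by rewrite ltr_pdivrMr // mulr2n mulrDr mulr1 ltrDl.
move=> ca; exists (lim (a @ \oo)) => e e0.
have /cvgrPdist_le /(_ e e0) [N0 _ hN] := ca.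
by exists N0 => N N0N; rewrite distrC; apply: hN.
Qed.

Lemma l2_complete (u : nat -> nat -> R[i]) :
  (forall e, 0 < e -> exists N0, forall N M, (N0 <= N)%N -> (N0 <= M)%N ->
     l2le (fun k => u N k - u M k) e) -> exists x, cvg2 u x.
Proof.
move=> h.
have sq (z : R[i]) : `|complex.Re z| <= Num.sqrt (sqn z) /\ `|complex.Im z| <= Num.sqrt (sqn z).
  by rewrite -!sqrtr_sqr /sqn; split; apply: ler_wsqrtr; rewrite ?lerDl ?lerDr sqr_ge0.
have hl k : exists l : R[i], forall e, 0 < e -> exists N0, forall N, (N0 <= N)%N ->
    sqn (u N k - l) <= e ^+ 2.
  have [|a ha] := @real_cauchy_lim (fun N => complex.Re (u N k)).
    move=> e /h[N0 hN]; exists N0 => N M h1 h2.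
    have := coord_le k (hN _ _ h1 h2); apply: le_trans.
    by have [] := sq (u N k - u M k); rewrite !cpxE.
  have [|b hb] := @real_cauchy_lim (fun N => complex.Im (u N k)).
    move=> e /h[N0 hN]; exists N0 => N M h1 h2.
    have := coord_le k (hN _ _ h1 h2); apply: le_trans.
    by have [] := sq (u N k - u M k); rewrite !cpxE.
  exists (a +i* b) => e e0; have e2 : 0 < e / 2 by rewrite divr_gt0.
  have [N1 h1] := ha _ e2; have [N2 h2] := hb _ e2; exists (maxn N1 N2) => N.
  rewrite geq_max => /andP[/h1 g1 /h2 g2]; rewrite /sqn !cpxE /=.
  rewrite -[X in X + _]real_normK ?num_real // -[X in _ + X]real_normK ?num_real //.
  have : `|complex.Re (u N k) - a| ^+ 2 <= (e / 2) ^+ 2 by rewrite ler_pXn2r ?nnegrE // ltW.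
  have : `|complex.Im (u N k) - b| ^+ 2 <= (e / 2) ^+ 2 by rewrite ler_pXn2r ?nnegrE // ltW.
  by have := sqr_ge0 e; rewrite expr_div_n; lra.
have [x hx] := choice hl.
exists x => e e0; have e2 : 0 < e / 2 by rewrite divr_gt0.
have [N0 hN] := h _ e2; exists N0 => N N0N K.
(* For a fixed section [K], some late [M] has all [K] coordinates close to the limit; [M] depends on
   [K], but the final rank [N0] does not. *)
have [M [N0M hM]] : exists M, (N0 <= M)%N /\ nrm K (fun k => u M k - x k) <= e / 2.
  have [d d0 dE] : exists2 d, 0 < d & e / 2 = d * K.+1%:R.
    by exists (e / 2 / K.+1%:R); rewrite ?divr_gt0 // divfK // pnatr_eq0.
  have : exists M0, forall M, (M0 <= M)%N -> forall k, (k < K)%N ->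
      sqn (u M k - x k) <= d ^+ 2.
    elim: K {dE} d d0 => [|K IH] d d0; first by exists 0%N.
    have [M1 h1] := IH d d0; have [M2 h2] := hx K d d0; exists (maxn M1 M2) => M.
    rewrite geq_max => /andP[g1 g2] k; rewrite ltnS leq_eqVlt => /orP[/eqP ->|kK].
      exact: h2.
    exact: h1.
  move=> [M0 hM0]; exists (maxn M0 N0); split; first exact: leq_maxr.
  rewrite nrm_leP; last exact: ltW.
  apply: le_trans (_ : \sum_(k < K) d ^+ 2 <= _).
    by apply: ler_sum => k _; apply: hM0; rewrite ?leq_maxl.
  rewrite sumr_const card_ord -[_ *+ K]mulr_natr.
  rewrite dE exprMn; apply: ler_wpM2l; first exact: sqr_ge0.
  by rewrite -natrX ler_nat; nia.
rewrite [e]splitr; apply: le_trans (nrm_triangle K (u M) _ _) _; apply: lerD => //.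
exact: hN.
Qed.

Lemma cvg2_le u x e : cvg2 u x -> (exists N0, forall N, (N0 <= N)%N -> l2le (u N) e) -> l2le x e.
Proof.
move=> hx [N0 hN] K; apply/ler_addgt0Pr => d d0.
have [N1 h1] := hx _ d0.
have := nrm_dist_ge K x (u (maxn N0 N1)); rewrite nrm_distC.
have := h1 _ (leq_maxr N0 N1) K; have := hN _ (leq_maxl N0 N1) K; lra.
Qed.

Lemma cvg2ZD (c : R[i]) u v x y : cvg2 u x -> cvg2 v y ->
  cvg2 (fun N k => c * u N k + v N k) (fun k => c * x k + y k).
Proof.
move=> hx hy e e0.
pose s := Num.sqrt (sqn c) + 1; have s0 : 0 < s by rewrite ltr_wpDl ?sqrtr_ge0.
have e2 : 0 < e / 2 by rewrite divr_gt0.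
have [N1 h1] := hx _ (divr_gt0 e2 s0); have [N2 h2] := hy _ e2; exists (maxn N1 N2) => N.
rewrite geq_max => /andP[/h1 g1 /h2 g2] K; rewrite [e]splitr.
have -> : (fun k => c * u N k + v N k - (c * x k + y k)) =
  (fun k => c * (u N k - x k) + (v N k - y k)) by apply/funext => k; ring.
apply: le_trans (nrmD _ _ _) _; apply: lerD => //.
rewrite nrmZ; apply: le_trans (_ : Num.sqrt (sqn c) * (e / 2 / s) <= _).
  by apply: ler_wpM2l; rewrite ?sqrtr_ge0.
rewrite mulrCA -[leRHS]mulr1; apply: ler_wpM2l; first exact: ltW.
by rewrite ler_pdivrMr // mul1r /s lerDl.
Qed.

End SquareSummable.

(** * The limit group on sequences and its generator *)

Section GalerkinLimit.
Context {R : realType}.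
Variables (lam : nat -> R) (c : R).
Implicit Types (x y z : nat -> R[i]) (N : nat) (t s : R).
Local Notation gal := (gal lam c).
Local Notation gen := (seq_gen lam c).

(** Finitely supported data converge by the moment bound, and the truncated flows are contractions,
    so that cutting the tail of [x] costs the same for all of them. *)
Lemma gal_cauchy t x : l2 x -> forall e, 0 < e -> exists N0, forall N M,
  (N0 <= N)%N -> (N0 <= M)%N -> l2le (fun k => gal N t x k - gal M t x k) e.
Proof.
move=> lx e e0; have e4 : 0 < e / 4 by rewrite divr_gt0.
have [m hm] := l2_tail lx e4.
have [C [C0 hC]] := gal_cauchy_fin lam c t (fun k => @trunc_supp _ m x k).
have [n hn] : exists n : nat, C / (e / 4) < n%:R.
  by exists (Num.bound (C / (e / 4))); apply: archi_boundP; rewrite divr_ge0 // ltW.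
suff H N M : (maxn (maxn m 2) n.+1 <= N)%N -> (N <= M)%N ->
    l2le (fun k => gal N t x k - gal M t x k) e.
  exists (maxn (maxn m 2) n.+1) => N M hN hM.
  have [NM|MN] := leqP N M; first exact: H.
  by apply: l2le_distC; apply: H => //; apply: ltnW.
rewrite !geq_max => /andP[/andP[mN N2] nN] NM.
have tail L : (m <= L)%N -> l2le (fun k => gal L t x k - gal L t (trunc m x) k) (e / 4).
  move=> mL K; have := nrm_galK lam c L K t (fun k => x k - trunc m x k).
  rewrite galB => h; apply: le_trans h _; exact: hm.
have mid : l2le (fun k => gal N t (trunc m x) k - gal M t (trunc m x) k) (e / 4).
  apply: (@l2le_from _ M) => K MK; rewrite (@nrm_supp _ M) //; last first.
    by move=> k Mk; rewrite !gal_supp ?subrr // (leq_trans NM).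
  apply: le_trans (hC N M mN N2 NM) _.
  have N10 : 0 < (N.-1%:R : R) by rewrite ltr0n; case: (N) N2 => [|[]].
  rewrite ler_pdivrMr // mulrC -ler_pdivrMr //; apply: ltW; apply: lt_le_trans hn _.
  by rewrite ler_nat; case: (N) nN.
have := l2le_triangle (l2le_triangle (tail N mN) mid) (l2le_distC (tail M (leq_trans mN NM))).
by apply: l2le_weak; lra.
Qed.

Definition grp t x : nat -> R[i] := xget (fun=> 0) [set v | cvg2 (fun N => gal N t x) v].

Lemma grp_cvg t x : l2 x -> cvg2 (fun N => gal N t x) (grp t x).
Proof.
move=> lx; have [v hv] := l2_complete (gal_cauchy t lx).
by rewrite /grp; case: xgetP => [w _ //|/(_ v)].
Qed.

Lemma grp_eq t x v : l2 x -> cvg2 (fun N => gal N t x) v -> grp t x = v.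
Proof. by move=> lx hv; apply: cvg2_unique (grp_cvg t lx) hv. Qed.

Lemma grp_le t x e : l2le x e -> l2le (grp t x) e.
Proof.
move=> h; have lx : l2 x by exists e.
apply: cvg2_le (grp_cvg t lx) _; exists 0%N => N _ K.
by apply: le_trans (nrm_galK _ _ _ _ _ _) _; apply: h.
Qed.

Lemma grp_l2 t x : l2 x -> l2 (grp t x).
Proof. by move=> [e h]; exists e; apply: grp_le. Qed.

Lemma grpZD t (a : R[i]) x y : l2 x -> l2 y ->
  grp t (fun k => a * x k + y k) = (fun k => a * grp t x k + grp t y k).
Proof.
move=> lx ly; apply: grp_eq; first exact: l2ZD.
under [X in cvg2 X]funext do rewrite galZD.
by apply: cvg2ZD; apply: grp_cvg.
Qed.

Lemma grpB t x y : l2 x -> l2 y ->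
  grp t (fun k => x k - y k) = (fun k => grp t x k - grp t y k).
Proof.
move=> lx ly; have := grpZD t (-1) ly lx.
rewrite (_ : (fun k => -1 * y k + x k) = (fun k => x k - y k)) => [->|].
  by apply/funext => k; rewrite mulN1r addrC.
by apply/funext => k; rewrite mulN1r addrC.
Qed.

Lemma grp0 x : l2 x -> grp 0 x = x.
Proof.
move=> lx; apply: grp_eq => // e e0; have [m hm] := l2_tail lx e0.
by exists m => N mN; rewrite gal0; apply: l2le_distC; apply: hm.
Qed.

Lemma grp_add s t x : l2 x -> grp (s + t) x = grp s (grp t x).
Proof.
move=> lx; apply: grp_eq => // e e0; have e2 : 0 < e / 2 by rewrite divr_gt0.
have [N1 h1] := grp_cvg t lx e2; have [N2 h2] := grp_cvg s (grp_l2 t lx) e2.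
exists (maxn N1 N2) => N; rewrite geq_max => /andP[/h1 g1 /h2 g2]; rewrite [e]splitr.
apply: l2le_triangle g2 => K; rewrite gal_add.
have := nrm_galK lam c N K s (fun k => gal N t x k - grp t x k).
by rewrite galB => h; apply: le_trans h _; apply: g1.
Qed.

Lemma lam_bound m : exists L, 0 <= L /\ forall k, (k < m)%N -> `|lam k| <= L.
Proof.
elim: m => [|m [L [L0 hL]]]; first by exists 0.
exists (L + `|lam m|); split; first by rewrite addr_ge0.
move=> k; rewrite ltnS leq_eqVlt => /orP[/eqP ->|/hL h]; first by rewrite lerDr.
by apply: le_trans h _; rewrite lerDl.
Qed.

(** On a fixed finite set of modes the generator is bounded independently of [N], and the tail is
    handled by contraction. Uniformity in [N] is what lets continuity and the generator pass to the
    limit. *)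
Lemma gal_equicontinuous x e : l2 x -> 0 < e -> exists d, 0 < d /\ forall N s, `|s| <= d ->
  nrm N (fun k => gal N s x k - x k) <= e.
Proof.
move=> lx e0; have e4 : 0 < e / 4 by rewrite divr_gt0.
have [m /(_ m (leqnn _)) hm] := l2_tail lx e4; have [L [L0 hL]] := lam_bound m.
pose C := (L + `|c|) * nrm m x + 1.
have C0 : 0 < C by rewrite ltr_wpDl // mulr_ge0 ?addr_ge0 ?nrm_ge0.
exists (e / 4 / C); split; first by rewrite divr_gt0.
move=> N s hs; pose z := trunc N (trunc m x).
have zs k : (m <= k)%N -> z k = 0 by move=> mk; rewrite /z {1}/trunc; case: ifP => // _; apply: trunc_supp.
have H : nrm N (fun k => z k - gal N s z k) <= e / 4.
  apply: le_trans (_ : (L + `|c|) * nrm m x * `|s| <= _); last first.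
    apply: le_trans (_ : C * (e / 4 / C) <= _); last by rewrite mulrC divfK ?gt_eqF.
    by apply: ler_pM => //; [rewrite mulr_ge0 ?addr_ge0 ?nrm_ge0|rewrite lerDl].
  (* The constant curve [z] is an approximate solution with residual minus the generator at [z]. *)
  apply: (@gal_duhamel _ lam c N (fun=> z) (fun _ k => - gen z k)).
  - by rewrite mulr_ge0 ?addr_ge0 ?nrm_ge0.
  - by move=> _ k Nk; rewrite /z trunc_supp.
  - by move=> u k _; rewrite subrr; apply: cderive_cst.
  move=> u _; rewrite nrmN; have zle K : nrm K z <= nrm m x.
    apply: le_trans (nrm_trunc_le _ _ _) _; have [h|h] := leqP K m.
      by apply: le_trans (nrm_trunc_le _ _ _) _; apply: nrm_mono.
    rewrite (nrm_supp (ltnW h)) => [|k mk]; last by rewrite trunc_supp.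
    by rewrite nrm_trunc.
  apply: le_trans (_ : nrm (maxn m N) (gen z) <= _); first exact: nrm_mono (leq_maxr _ _).
  apply: le_trans (nrm_gen _ L0 (leq_maxl m N) hL zs) _.
  by apply: ler_wpM2l => //; rewrite addr_ge0.
have -> : nrm N (fun k => gal N s x k - x k) =
    nrm N (fun k => (gal N s (fun k => x k - trunc m x k) k + (trunc m x k - x k)) +
       (gal N s z k - z k)).
  apply: eq_nrm => k kN; rewrite galB [gal N s z]gal_trunc.
  have -> : z k = trunc m x k by rewrite /z {1}/trunc kN.
  ring.
apply: le_trans (nrmD _ _ _) _; rewrite [X in _ + X]nrm_distC.
apply: le_trans (_ : (e / 4 + e / 4) + e / 4 <= _); last by lra.
apply: lerD => //; apply: le_trans (nrmD _ _ _) _; apply: lerD; last by rewrite nrm_distC.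
by apply: le_trans (nrm_gal_le _ _ _ _ _) _; apply: hm.
Qed.

Lemma grp_continuous x e : l2 x -> 0 < e -> exists d, 0 < d /\ forall s, `|s| <= d ->
  l2le (fun k => grp s x k - x k) e.
Proof.
move=> lx e0; have e2 : 0 < e / 2 by rewrite divr_gt0.
have [d [d0 hd]] := gal_equicontinuous lx e2; exists d; split => // s /hd h K.
have [N1 h1] := grp_cvg s lx e2; pose N := maxn N1 K.
rewrite [e]splitr; apply: le_trans (nrm_triangle K (gal N s x) _ _) _; apply: lerD.
  by rewrite nrm_distC; apply: h1; apply: leq_maxl.
by apply: le_trans (h N); apply: nrm_mono; apply: leq_maxr.
Qed.

(** Truncating the argument changes only the last row, which loses its link to the entry [x N]. *)
Lemma nrm_gen_trunc N x :
  nrm N (fun k => trunc N (gen (trunc N x)) k - gen x k) <= `|c| * Num.sqrt (sqn (x N)).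
Proof.
have wz k : (k.+1 < N)%N -> trunc N (gen (trunc N x)) k - gen x k = 0.
  move=> kN; rewrite {1}/trunc (ltnW kN); apply/eqP; rewrite subr_eq0; apply/eqP.
  apply: eq_gen => j jk; rewrite /trunc; case: ifP => // /negbT.
  by rewrite -leqNgt => h; move: (leq_trans h jk); rewrite leqNgt kN.
case: N wz => [|n] wz.
  by rewrite /nrm big_ord0 sqrtr0 mulr_ge0 ?sqrtr_ge0.
rewrite /nrm big_ord_recr /= big1 ?add0r; last by move=> k _; rewrite wz ?sqn0 // ltnS.
rewrite -sqrtr_sqr -sqrtrM ?sqr_ge0 //; apply: ler_wsqrtr.
rewrite /trunc ltnSn /seq_gen /= ltnSn.
case: n {wz} => [|n] /=.
  by rewrite subrr sqn0 mulr_ge0 ?sqr_ge0 ?sqn_ge0.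
rewrite ltnn (ltnW (ltnSn _)).
set a := _ * x n.+1; set b := _ * x n.
have -> : a + c%:C * (mhi * (1 * 0 + b)) - (a + c%:C * (mhi * (1 * x n.+2 + b))) =
   - (c%:C * (mhi * x n.+2)) by ring.
rewrite sqnN !sqnM sqn_real sqn_mhi.
have := mulr_ge0 (sqr_ge0 c) (sqn_ge0 (x n.+2)); lra.
Qed.

(** The derivative of the truncated flow minus [z] splits into the flow applied to a truncation
    defect, which tends to 0 with [x N], and the displacement of [z], small by equicontinuity. The
    mean value inequality then gives the factor [|t|]. *)
Lemma grp_generator x z e : l2 x -> l2 z -> (forall k, z k = gen x k) -> 0 < e ->
  exists d, 0 < d /\ forall t, `|t| <= d ->
    l2le (fun k => grp t x k - x k - t%:C * z k) (e * `|t|).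
Proof.
move=> lx lz hz e0; have e2 : 0 < e / 2 by rewrite divr_gt0.
have [d [d0 hd]] := gal_equicontinuous lz e2; exists d; split => // t td.
have [M hM] : exists M : nat, forall N, (M <= N)%N -> `|c| * Num.sqrt (sqn (x N)) <= e / 2.
  have c1 : 0 < `|c| + 1 by rewrite ltr_wpDl.
  have [m hm] := l2_tail lx (divr_gt0 e2 c1); exists m => N mN.
  have := coord_le N (hm N mN); rewrite trunc_supp // subr0 ler_pdivlMr // => h.
  apply: le_trans h; rewrite mulrC; apply: ler_wpM2l; first exact: sqrtr_ge0.
  by rewrite lerDl.
have lxz : cvg2 (fun N k => gal N t x k - x k - t%:C * z k)
   (fun k => grp t x k - x k - t%:C * z k).
  move=> d' /(grp_cvg t lx)[N0 hN]; exists N0 => N /hN h K.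
  rewrite (_ : (fun k => _) = (fun k => gal N t x k - grp t x k)) //.
  by apply/funext => k; ring.
move=> K; apply/ler_addgt0Pr => d' d'0.
have [N1 hN1] := lxz _ d'0.
pose N := maxn N1 (maxn M K).
have := nrm_dist_ge K (fun k => grp t x k - x k - t%:C * z k)
  (fun k => gal N t x k - x k - t%:C * z k).
rewrite nrm_distC; have := hN1 N (leq_maxl _ _) K.
suff : nrm K (fun k => gal N t x k - x k - t%:C * z k) <= e * `|t| by lra.
apply: le_trans (_ : nrm N (fun k => gal N t x k - x k - t%:C * z k) <= _).
  by apply: nrm_mono; rewrite /N !leq_max leqnn !orbT.
have MN : (M <= N)%N by rewrite /N !leq_max leqnn orbT.
pose Y k s := gal N s x k - x k - s%:C * z k.
have : nrm N (Y^~ t) <= nrm N (Y^~ 0) + e * `|t|.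
  apply: (@nrm_mvt _ N Y (fun k s => gen (gal N s x) k - 0 - 1 * z k)) => //; first exact: ltW.
    move=> k s kN _; have [_ gd] := gal_solves lam c N x.
    apply: cderiveB; first by apply: cderiveB; [exact: gd|exact: cderive_cst].
    by apply: cderive_eq (cderiveM (cderive_id s) (cderive_cst (z k) s)) _; ring.
  move=> s st; pose w := trunc N (gen (trunc N x)).
  have -> : nrm N (fun k => gen (gal N s x) k - 0 - 1 * z k) =
     nrm N (fun k => gal N s (fun k => w k - z k) k + (gal N s z k - z k)).
    apply: eq_nrm => k kN; rewrite galB gal_gen /trunc kN; ring.
  apply: le_trans (nrmD _ _ _) _; rewrite [e]splitr; apply: lerD; last first.
    by apply: hd; apply: le_trans td.
  apply: le_trans (nrm_gal_le _ _ _ _ _) _.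
  apply: le_trans (hM N MN); rewrite /w.
  rewrite (@eq_nrm _ N (fun k => _ - _) (fun k => trunc N (gen (trunc N x)) k - gen x k)).
    exact: nrm_gen_trunc.
  by move=> k _; rewrite hz.
rewrite [X in _ <= X + _ -> _](_ : _ = 0) ?add0r //.
rewrite -[RHS](nrm0 N); apply: eq_nrm => k kN; rewrite /Y gal0 /trunc kN.
by rewrite subrr mul0r subrr.
Qed.

(** A row of the generator involves only three entries, so each coordinate is differentiable at 0
    for every [x] in l^2, in the domain or not. This identifies the generator when only convergence
    of difference quotients is known. *)
Lemma grp_coord_derivative x k e : l2 x -> 0 < e -> exists d, 0 < d /\ forall t, `|t| <= d ->
  Num.sqrt (sqn (grp t x k - x k - t%:C * gen x k)) <= e * `|t|.
Proof.
move=> lx e0; pose L := `|lam k| + `|c| + 1.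
have L0 : 0 < L by rewrite ltr_wpDl // addr_ge0.
have [d [d0 hd]] := gal_equicontinuous lx (divr_gt0 e0 L0); exists d; split => // t td.
apply/ler_addgt0Pr => d' d'0.
have [N1 hN1] := grp_cvg t lx d'0.
pose N := maxn N1 k.+3.
have kN : (k.+2 < N)%N by rewrite leq_max leqnn orbT.
have one (w : R[i]) : Num.sqrt (sqn w) = nrm 1 (fun _ => w) by rewrite /nrm big_ord1.
have h1 := coord_le k (hN1 N (leq_maxl _ _)).
have h2 : Num.sqrt (sqn (gal N t x k - x k - t%:C * gen x k)) <= e * `|t|.
  pose Y (_ : nat) s := gal N s x k - x k - s%:C * gen x k.
  rewrite one; have : nrm 1 (Y^~ t) <= nrm 1 (Y^~ 0) + e * `|t|.
    apply: (@nrm_mvt _ 1 Y (fun _ s => gen (gal N s x) k - 0 - 1 * gen x k)) => //.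
    - exact: ltW.
    - move=> j s _ _; have [_ gd] := gal_solves lam c N x.
      apply: cderiveB; first by apply: cderiveB; [apply: gd; apply: ltnW; apply: ltnW|exact: cderive_cst].
      by apply: cderive_eq (cderiveM (cderive_id s) (cderive_cst (gen x k) s)) _; ring.
    - move=> s st; rewrite subr0 mul1r -one -genB.
      pose w j := gal N s x j - x j.
      have w1 : nrm k.+3 w <= e / L.
        by apply: le_trans (hd N s (le_trans st td)); apply: nrm_mono.
      have w2 j : (j < k.+3)%N -> Num.sqrt (sqn (w j)) <= e / L.
        by move=> jk; apply: le_trans w1; apply: coord_le_nrm.
      rewrite -/w one /seq_gen; apply: le_trans (nrmD 1 (fun=> _) (fun=> _)) _.
      have A (a : R) (u : R[i]) : Num.sqrt (sqn ('i%C * a%:C * u)) = `|a| * Num.sqrt (sqn u).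
        by rewrite !sqnM sqn_i mul1r sqn_real sqrtrM ?sqr_ge0 // sqrtr_sqr.
      have B (a : R) (u : R[i]) : Num.sqrt (sqn (a%:C * u)) = `|a| * Num.sqrt (sqn u).
        by rewrite !sqnM sqn_real sqrtrM ?sqr_ge0 // sqrtr_sqr.
      rewrite -!one A B.
      have h3 : Num.sqrt (sqn (tri bco w k)) <= e / L.
        apply: le_trans w1; apply: le_trans (_ : nrm k.+2 (tri bco w) <= _); last exact: nrm_B.
        exact: coord_le_nrm.
      apply: le_trans (_ : `|lam k| * (e / L) + `|c| * (e / L) <= _).
        by apply: lerD; apply: ler_wpM2l => //; apply: w2; rewrite ltnW // ltnW.
      rewrite -mulrDl mulrA ler_pdivrMr // mulrC; apply: ler_wpM2l; first exact: ltW.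
      by rewrite /L lerDl.
  rewrite [X in _ <= X + _ -> _](_ : _ = 0) ?add0r //.
  by rewrite /Y gal0 /trunc (ltnW (ltnW kN)) subrr mul0r subrr nrm0.
have -> : grp t x k - x k - t%:C * gen x k =
  (gal N t x k - x k - t%:C * gen x k) + (grp t x k - gal N t x k) by ring.
apply: le_trans (cmodD _ _) _; apply: lerD => //.
by rewrite -sqnN opprB.
Qed.

End GalerkinLimit.

(** * The Hilbert space structure of [L2] on representatives *)

Section SquareIntegrable.
Context {R : realType}.
Local Notation mu := (torus R).
Local Notation L2r := (Lfun mu 2%:E).
Implicit Types (f g h : measurableTypeR R -> R) (psi chi xi : wave R).

Lemma torus_finite : (mu setT < +oo)%E.
Proof.
rewrite /torus /= /mrestr setTI lebesgue_measure_itv /=.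
by case: ifP => // _; rewrite -EFinD ltry.
Qed.

Lemma integrable_bounded h (M : R) : measurable_fun setT h -> (forall x, `|h x| <= M) ->
  mu.-integrable setT (EFin \o h).
Proof.
move=> mh hM; apply: measurable_bounded_integrable => //; first exact: torus_finite.
by exists M; split; [exact: num_real|move=> y My x _ /=; apply: le_trans (ltW My)].
Qed.

Lemma L2rP f : f \in L2r <->
  measurable_fun setT f /\ mu.-integrable setT (EFin \o (fun x => f x ^+ 2)).
Proof.
split=> [hf|[mf If]].
  split; last exact: Lfun2_integrable_sqr.
  by move: hf; rewrite inE => /andP[]; rewrite inE.
rewrite inE; apply/andP; split; rewrite inE //=.
rewrite /finite_norm unlock poweR_lty //.
have /integrableP[_ h] := If; apply: le_lt_trans h.
rewrite le_eqVlt; apply/orP; left; apply/eqP; apply: eq_integral => x _ /=.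
by rewrite ?poweR_EFin; congr (_%:E); rewrite powR_mulrn // normrX.
Qed.

Lemma L2r_meas f : f \in L2r -> measurable_fun setT f.
Proof. by case/L2rP. Qed.

Lemma L2r_mul f g : f \in L2r -> g \in L2r -> mu.-integrable setT (EFin \o (fun x => f x * g x)).
Proof. by move=> hf hg; apply/Lfun1_integrable; apply: Lfun2_mul_Lfun1. Qed.

Lemma L2rD f g : f \in L2r -> g \in L2r -> (fun x => f x + g x) \in L2r.
Proof.
move=> /L2rP[mf If] /L2rP[mg Ig]; apply/L2rP; split; first exact: measurable_funD.
have := integrableD measurableT (integrableZl measurableT 2 If) (integrableZl measurableT 2 Ig).
apply: le_integrable => //.
  by apply/measurable_EFinP; apply: measurable_funX; apply: measurable_funD.
move=> x _ /=; rewrite lee_fin ger0_norm ?sqr_ge0 //.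
apply: le_trans (ler_norm _).
by rewrite -subr_ge0 (_ : _ - _ = (f x - g x) ^+ 2) ?sqr_ge0 //; ring.
Qed.

Lemma L2r_bmul h f (M : R) : measurable_fun setT h -> (forall x, `|h x| <= M) ->
  f \in L2r -> (fun x => h x * f x) \in L2r.
Proof.
move=> mh hM /L2rP[mf If]; apply/L2rP; split; first exact: measurable_funM.
have M0 : 0 <= M by apply: le_trans (hM (0 : R)).
have := integrableZl measurableT (M ^+ 2) If.
apply: le_integrable => //.
  by apply/measurable_EFinP; apply: measurable_funX; apply: measurable_funM.
move=> x _ /=; rewrite lee_fin (ger0_norm (mulr_ge0 (sqr_ge0 M) (sqr_ge0 (f x)))).
rewrite normrX normrM exprMn (real_normK (num_real (f x))).
apply: ler_wpM2r; first exact: sqr_ge0.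
by rewrite ler_pXn2r ?nnegrE.
Qed.

Lemma L2r_bounded h (M : R) : measurable_fun setT h -> (forall x, `|h x| <= M) -> h \in L2r.
Proof.
move=> mh hM; apply/L2rP; split => //.
apply: (@integrable_bounded _ (M ^+ 2)); first exact: measurable_funX.
move=> x; have M0 : 0 <= M by apply: le_trans (hM x).
by rewrite normrX ler_pXn2r ?nnegrE.
Qed.

Lemma L2rZ (a : R) f : f \in L2r -> (fun x => a * f x) \in L2r.
Proof. by apply: L2r_bmul => //; move=> x; apply: lexx. Qed.

Lemma L2rN f : f \in L2r -> (fun x => - f x) \in L2r.
Proof.
by move=> /(L2rZ (-1)); rewrite (_ : (fun x => -1 * f x) = (fun x => - f x)) //;
  apply/funext => x; rewrite mulN1r.
Qed.

Lemma L2rB f g : f \in L2r -> g \in L2r -> (fun x => f x - g x) \in L2r.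
Proof. by move=> hf hg; apply: L2rD => //; apply: L2rN. Qed.

Lemma L2D psi chi : L2 psi -> L2 chi -> L2 (fun x => psi x + chi x).
Proof.
move=> [a b] [c d]; split.
  by under eq_fun do rewrite ReD; apply: L2rD.
by under eq_fun do rewrite ImD; apply: L2rD.
Qed.

Lemma L2Z (a : R[i]) psi : L2 psi -> L2 (fun x => a * psi x).
Proof.
move=> [c d]; split.
  by under eq_fun do rewrite ReM; apply: L2rB; apply: L2rZ.
by under eq_fun do rewrite ImM; apply: L2rD; apply: L2rZ.
Qed.

Lemma L2ZD (a : R[i]) psi chi : L2 psi -> L2 chi -> L2 (fun x => a * psi x + chi x).
Proof. by move=> ? ?; apply: L2D => //; apply: L2Z. Qed.

Lemma L2B psi chi : L2 psi -> L2 chi -> L2 (fun x => psi x - chi x).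
Proof.
move=> h1 h2; have := L2ZD (-1) h2 h1.
by under eq_fun do rewrite mulN1r addrC.
Qed.

Lemma L2_bmul h psi (M : R) : measurable_fun setT h -> (forall x, `|h x| <= M) ->
  L2 psi -> L2 (fun x => (h x)%:C * psi x).
Proof.
move=> mh hM [c d]; split.
  under eq_fun do rewrite ReM /= mul0r subr0; exact: L2r_bmul hM c.
by under eq_fun do rewrite ImM /= mul0r addr0; exact: L2r_bmul hM d.
Qed.

Lemma L2_0 : L2 (fun=> 0 : R[i]).
Proof. by split; apply: (@L2r_bounded _ 0) => // x /=; rewrite normr0. Qed.

Lemma innerE psi chi : inner psi chi =
  (\int[mu]_x (complex.Re (psi x) * complex.Re (chi x) + complex.Im (psi x) * complex.Im (chi x)))
  +i* (\int[mu]_x (complex.Re (psi x) * complex.Im (chi x) - complex.Im (psi x) * complex.Re (chi x))).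
Proof.
apply: cplxP => /=; apply: eq_Rintegral => x _; rewrite !cpxE; ring.
Qed.

Lemma integrable_add f g : mu.-integrable setT (EFin \o f) -> mu.-integrable setT (EFin \o g) ->
  mu.-integrable setT (EFin \o (fun x => f x + g x)).
Proof. by move=> hf hg; apply: (integrableD measurableT hf hg). Qed.

Lemma integrable_mull (a : R) f : mu.-integrable setT (EFin \o f) ->
  mu.-integrable setT (EFin \o (fun x => a * f x)).
Proof. by move=> hf; apply: (integrableZl measurableT a hf). Qed.

Lemma integrable_sub f g : mu.-integrable setT (EFin \o f) -> mu.-integrable setT (EFin \o g) ->
  mu.-integrable setT (EFin \o (fun x => f x - g x)).
Proof. by move=> hf hg; apply: (integrableB measurableT hf hg). Qed.

Lemma inner_integrable psi chi : L2 psi -> L2 chi ->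
  mu.-integrable setT (EFin \o (fun x => complex.Re ((psi x)^* * chi x))) /\
  mu.-integrable setT (EFin \o (fun x => complex.Im ((psi x)^* * chi x))).
Proof.
move=> [a b] [c d]; split.
  rewrite (_ : (fun x => complex.Re _) = (fun x => complex.Re (psi x) * complex.Re (chi x) +
    complex.Im (psi x) * complex.Im (chi x))); last by apply/funext => x; rewrite !cpxE; ring.
  by apply: integrable_add; apply: L2r_mul.
rewrite (_ : (fun x => complex.Im _) = (fun x => complex.Re (psi x) * complex.Im (chi x) -
  complex.Im (psi x) * complex.Re (chi x))); last by apply/funext => x; rewrite !cpxE; ring.
by apply: integrable_sub; apply: L2r_mul.
Qed.

Lemma innerZD psi (a : R[i]) chi xi : L2 psi -> L2 chi -> L2 xi ->
  inner psi (fun x => a * chi x + xi x) = a * inner psi chi + inner psi xi.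
Proof.
move=> hp hc hx; have [c1 c2] := inner_integrable hp hc; have [x1 x2] := inner_integrable hp hx.
case: a => a b; apply: cplxP; rewrite [RHS]cpxE !cpxE /=.
  rewrite -!RintegralZl // -RintegralB //; try exact: integrable_mull.
  rewrite -RintegralD //; last by apply: integrable_sub; apply: integrable_mull.
  by apply: eq_Rintegral => x _; rewrite !cpxE /=; ring.
rewrite -!RintegralZl // -RintegralD //; try exact: integrable_mull.
rewrite -RintegralD //; last by apply: integrable_add; apply: integrable_mull.
by apply: eq_Rintegral => x _; rewrite !cpxE /=; ring.
Qed.

Lemma innerC psi chi : L2 psi -> L2 chi -> inner chi psi = (inner psi chi)^*.
Proof.
move=> hp hc; have [c1 c2] := inner_integrable hp hc.
apply: cplxP; rewrite [RHS]cpxE /=.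
  by apply: eq_Rintegral => x _; rewrite !cpxE; ring.
rewrite -mulN1r -RintegralZl //.
by apply: eq_Rintegral => x _; rewrite !cpxE; ring.
Qed.

Lemma innerZr psi (a : R[i]) chi : L2 psi -> L2 chi ->
  inner psi (fun x => a * chi x) = a * inner psi chi.
Proof.
move=> hp hc; have := innerZD a hp hc L2_0.
have := innerZD 1 hp L2_0 L2_0.
under [in X in X -> _]eq_fun do rewrite mul1r addr0.
rewrite mul1r => /(congr1 (fun z => z - inner psi (fun=> 0))); rewrite subrr addrK => h0.
by rewrite -h0 addr0; under eq_fun do rewrite addr0.
Qed.

Lemma innerDr psi chi xi : L2 psi -> L2 chi -> L2 xi ->
  inner psi (fun x => chi x + xi x) = inner psi chi + inner psi xi.
Proof.
by move=> hp hc hx; have := innerZD 1 hp hc hx; under eq_fun do rewrite mul1r; rewrite mul1r.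
Qed.

Lemma innerBr psi chi xi : L2 psi -> L2 chi -> L2 xi ->
  inner psi (fun x => chi x - xi x) = inner psi chi - inner psi xi.
Proof.
move=> hp hc hx; have := innerZD (-1) hp hx hc; under eq_fun do rewrite mulN1r addrC.
by rewrite mulN1r addrC.
Qed.

Lemma innerDl psi chi xi : L2 psi -> L2 chi -> L2 xi ->
  inner (fun x => chi x + xi x) psi = inner chi psi + inner xi psi.
Proof.
move=> hp hc hx; rewrite (innerC hp (L2D hc hx)) innerDr // rmorphD /=.
by rewrite -!innerC.
Qed.

Lemma innerZl psi (a : R[i]) chi : L2 psi -> L2 chi ->
  inner (fun x => a * chi x) psi = a^* * inner chi psi.
Proof. by move=> hp hc; rewrite (innerC hp (L2Z a hc)) innerZr // rmorphM /= -innerC. Qed.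

Lemma Re_inner_self_ge0 psi : 0 <= complex.Re (inner psi psi).
Proof.
rewrite /inner /=; apply: Rintegral_ge0 => x _; rewrite !cpxE.
have := sqr_ge0 (complex.Re (psi x)); have := sqr_ge0 (complex.Im (psi x)); lra.
Qed.

Lemma L2norm_sqr psi : L2norm psi ^+ 2 = complex.Re (inner psi psi).
Proof. by rewrite sqr_sqrtr // Re_inner_self_ge0. Qed.

Lemma L2norm_ge0 psi : 0 <= L2norm psi. Proof. exact: sqrtr_ge0. Qed.

Lemma L2normE psi e : 0 <= e -> complex.Re (inner psi psi) = e ^+ 2 -> L2norm psi = e.
Proof. by move=> e0 h; rewrite /L2norm h sqrtr_sqr ger0_norm. Qed.

Lemma Re_innerC psi chi : L2 psi -> L2 chi ->
  complex.Re (inner chi psi) = complex.Re (inner psi chi).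
Proof. by move=> hp hc; rewrite (innerC hp hc) cpxE. Qed.

Lemma Re_inner_le psi chi : L2 psi -> L2 chi ->
  `|complex.Re (inner psi chi)| <= L2norm psi * L2norm chi.
Proof.
move=> hp hc; set b := complex.Re _.
have h t : 0 <= complex.Re (inner psi psi) + 2 * b * t + complex.Re (inner chi chi) * t ^+ 2.
  have hs := L2ZD t%:C hc hp.
  have := Re_inner_self_ge0 (fun x => t%:C * chi x + psi x).
  rewrite (innerDl hs (L2Z _ hc) hp) innerZl // !innerZD //.
  rewrite !cpxE (Re_innerC hp hc) (ReC t) (ImC t) oppr0 !mul0r !subr0 -/b.
  by move=> ?; lra.
have := quad_disc h (Re_inner_self_ge0 chi).
rewrite -!L2norm_sqr -exprMn -[b ^+ 2]real_normK ?num_real //.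
by rewrite ler_pXn2r // nnegrE ?mulr_ge0 ?L2norm_ge0.
Qed.

Lemma L2normZ (a : R[i]) psi : L2 psi ->
  L2norm (fun x => a * psi x) = Num.sqrt (sqn a) * L2norm psi.
Proof.
move=> hp; rewrite /L2norm -sqrtrM ?sqn_ge0 //; congr Num.sqrt.
rewrite innerZr ?innerZl //; last exact: L2Z.
have -> : a * (a^* * inner psi psi) = (sqn a)%:C * inner psi psi.
  by rewrite mulrA; congr (_ * _); apply: cplxP; rewrite /sqn !cpxE /=; ring.
by rewrite cpxE /= mul0r subr0.
Qed.

Lemma L2normZr (a : R) psi : L2 psi -> L2norm (fun x => a%:C * psi x) = `|a| * L2norm psi.
Proof. by move=> hp; rewrite L2normZ // cmod_real. Qed.

Lemma L2normD psi chi : L2 psi -> L2 chi ->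
  L2norm (fun x => psi x + chi x) <= L2norm psi + L2norm chi.
Proof.
move=> hp hc; rewrite -ler_sqr ?nnegrE ?addr_ge0 ?L2norm_ge0 // L2norm_sqr.
have hs := L2D hp hc.
rewrite (innerDl hs hp hc) (innerDr hp hp hc) (innerDr hc hp hc) !ReD (Re_innerC hp hc).
rewrite -(L2norm_sqr psi) -(L2norm_sqr chi).
by have := Re_inner_le hp hc; rewrite ler_norml => /andP[_]; rewrite sqrrD; lra.
Qed.

Lemma L2norm_distC psi chi : L2 psi -> L2 chi ->
  L2norm (fun x => psi x - chi x) = L2norm (fun x => chi x - psi x).
Proof.
move=> hp hc; have := L2normZr (-1) (L2B hp hc).
rewrite normrN normr1 mul1r => <-; congr L2norm; apply/funext => x.
by apply: cplxP; rewrite !cpxE /=; ring.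
Qed.

Lemma L2norm_triangle chi psi xi : L2 psi -> L2 chi -> L2 xi ->
  L2norm (fun x => psi x - xi x) <=
  L2norm (fun x => psi x - chi x) + L2norm (fun x => chi x - xi x).
Proof.
move=> hp hc hx; apply: le_trans (L2normD (L2B hp hc) (L2B hc hx)).
by under [X in _ <= L2norm X]eq_fun do rewrite addrA subrK.
Qed.

Lemma L2norm_dist_ge psi chi : L2 psi -> L2 chi ->
  L2norm psi - L2norm chi <= L2norm (fun x => psi x - chi x).
Proof.
move=> hp hc; rewrite lerBlDr; apply: le_trans (L2normD (L2B hp hc) hc).
by under [X in _ <= L2norm X]eq_fun do rewrite subrK.
Qed.

Lemma ae_Rintegral f g : measurable_fun setT f -> measurable_fun setT g ->
  (\forall x \ae mu, f x = g x) -> \int[mu]_x f x = \int[mu]_x g x.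
Proof.
move=> mf mg fg; rewrite /Rintegral; congr fine; apply: ae_eq_integral => //.
- exact/measurable_EFinP.
- exact/measurable_EFinP.
- by apply: filterS fg => x /= -> .
Qed.

Lemma L2norm_ae psi : L2 psi -> L2norm psi = 0 -> \forall x \ae mu, psi x = 0.
Proof.
move=> hp /(congr1 (fun r => r ^+ 2)); rewrite L2norm_sqr expr0n /=.
have [hi _] := inner_integrable hp hp.
rewrite /inner /= /Rintegral => h0.
have /integrableP[m _] := hi.
have : (\int[mu]_x `|(EFin \o (fun x => complex.Re (Num.conj (psi x) * psi x)%R)) x| = 0)%E.
  have pos x : 0 <= complex.Re ((psi x)^* * psi x).
    rewrite !cpxE; have := sqr_ge0 (complex.Re (psi x)); have := sqr_ge0 (complex.Im (psi x)); lra.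
  under eq_integral do rewrite /= ger0_norm //.
  have := integrable_fin_num measurableT hi => /fineK <-.
  by rewrite h0.
move/(ae_eq_integral_abs mu measurableT m); apply: filterS => x /(_ Logic.I) /= [h].
apply: sqn_eq0; move: h; rewrite !cpxE /sqn => h; rewrite -[RHS]h; ring.
Qed.

Lemma ae_inner psi psi' chi chi' : L2 psi -> L2 psi' -> L2 chi -> L2 chi' ->
  (\forall x \ae mu, psi x = psi' x) -> (\forall x \ae mu, chi x = chi' x) ->
  inner psi chi = inner psi' chi'.
Proof.
move=> p p' c c' hp hc; have [/integrableP[m1 _] /integrableP[m2 _]] := inner_integrable p c.
have [/integrableP[m3 _] /integrableP[m4 _]] := inner_integrable p' c'.
apply: cplxP => /=; (apply: ae_Rintegral; [exact/measurable_EFinP|exact/measurable_EFinP|]);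
  by apply: filterS2 hp hc => x -> ->.
Qed.

Lemma ae_L2norm_eq psi chi : L2 psi -> L2 chi -> (\forall x \ae mu, psi x = chi x) ->
  L2norm psi = L2norm chi.
Proof. by move=> hp hc h; rewrite /L2norm (ae_inner hp hc hp hc). Qed.

End SquareIntegrable.

(** * Integration on the torus: restriction, primitives, reflection *)

Section TorusIntegrals.
Context {R : realType}.
Local Notation mu := (torus R).
Local Notation leb := (@lebesgue_measure R).
Local Notation T := (measurableTypeR R).
Local Notation D := (`](- pi : R), pi]%classic : set T).
Implicit Types (f g h : T -> R).

Lemma mD : measurable D. Proof. exact: (@measurable_itv R). Qed.

Lemma mDc : measurable (~` D). Proof. by apply: measurableC; apply: mD. Qed.

Lemma torus_offD : mu (~` D) = 0%E.
Proof. by rewrite /torus /= /mrestr setICl measure0. Qed.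

(** The complement of the fundamental domain is null for [torus] and can be added to the exceptional
    set. *)
Lemma ae_torus (P : R -> Prop) : (\forall x \ae leb, D x -> P x) -> \forall x \ae mu, P x.
Proof.
move=> [N [mN N0 hN]]; exists (N `|` ~` D); split.
- by apply: measurableU => //; apply: mDc.
- rewrite /torus /= /mrestr setIUl setICl setU0 -N0.
  apply/eqP; rewrite eq_le; apply/andP; split.
    by apply: le_measure; rewrite ?inE //; apply: measurableI => //; apply: mD.
  by rewrite N0 measure_ge0.
- move=> x hx; have [Dx|Dx] := pselect (D x); last by right.
  by left; apply: hN => /= h; apply: hx; apply: h.
Qed.

Lemma torus_integralE f : mu.-integrable setT (EFin \o f) ->
  (\int[mu]_x (f x)%:E = \int[leb]_(x in D) (f x)%:E)%E.
Proof.
move=> fi.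
rewrite (negligible_integral mDc measurableT fi torus_offD) setTD setCK.
apply: eq_measure_integral => A mA AD.
by rewrite /torus /= /mrestr (setIidl AD).
Qed.

Lemma torus_integrableE f : measurable_fun setT f ->
  mu.-integrable setT (EFin \o f) <-> leb.-integrable D (EFin \o f).
Proof.
move=> mf.
have mT : measurable_fun setT (EFin \o f) by exact/measurable_EFinP.
have e : (\int[mu]_x `|(EFin \o f) x| = \int[leb]_(x in D) `|(EFin \o f) x|)%E.
  rewrite -(setvU D) (ge0_integral_setU mu mDc mD) //; last 2 first.
  - by rewrite setvU; apply: measurableT_comp.
  - by apply/disj_setPS => x [].
  rewrite (@integral_abs_eq0 _ _ _ _ (~` D)) ?add0e //; last 3 first.
  - exact: mDc.
  - by apply: (measurable_funS measurableT) mT.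
  - exact: torus_offD.
  apply: eq_measure_integral => A mA AD.
  by rewrite /torus /= /mrestr (setIidl AD).
have mDf : measurable_fun D (EFin \o f) by apply: (measurable_funS measurableT) mT.
split=> hi; have /integrableP[_ h] := hi.
  by apply/integrableP; split => //; rewrite -e.
by apply/integrableP; split => //; rewrite e.
Qed.

Lemma torus_FTC (F f : R -> R) (M : R) : (forall x : R, is_derive x 1 F (f x)) ->
  continuous f -> (forall x, `|f x| <= M) -> \int[mu]_x f x = F pi - F (- pi).
Proof.
move=> Fd cf fM.
have mf : measurable_fun setT f by exact: continuous_measurable_fun.
have fi := integrable_bounded mf fM.
have cF x : F y @[y --> x] --> F x.
  by apply: differentiable_continuous; apply/derivable1_diffP; apply: ex_derive.
rewrite /Rintegral torus_integralE // integral_itv_obnd_cbnd; last first.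
  by apply/measurable_EFinP; apply: measurable_funTS.
rewrite (@continuous_FTC2 _ f F) //.
- by rewrite gtrN // pi_gt0.
- exact: continuous_subspaceT.
- split; first by move=> x _; apply: ex_derive.
  + by apply: cvg_at_right_filter; apply: cF.
  + by apply: cvg_at_left_filter; apply: cF.
- by move=> x _; rewrite derive1E; apply: derive_val.
Qed.

(** Reflection turns []-pi, pi]] into [[-pi, pi[], and the two intervals differ by their endpoints,
    which are null sets. *)
Lemma torus_pushN (A : set T) : measurable A -> pushforward mu (-%R : T -> T) A = mu A.
Proof.
move=> mA; rewrite /pushforward /torus /= /mrestr.
have -> : (-%R @^-1` A `&` D) = -%R @^-1` (A `&` `[- pi, pi[%classic) :> set R.
  apply/seteqP; split => x /=; rewrite !in_itv /= lerNl ltrNl opprK => -[h1 h2]; split => //.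
    by case/andP: h2 => -> ->.
  by case/andP: h2 => -> ->.
have mI (i : interval R) : measurable (A `&` [set` i]) by apply: measurableI.
rewrite -[LHS]/(pushforward leb (-%R : _ -> measurableTypeR R) _) lebesgue_measureN; last exact: mI.
have sandwich (X Y : set T) (c : R) : measurable X -> measurable Y -> X `<=` Y ->
    Y `<=` X `|` [set c] -> leb Y = leb X.
  move=> mX mY XY YX; apply/eqP; rewrite eq_le; apply/andP; split; last first.
    by apply: le_measure; rewrite ?inE.
  apply: le_trans (_ : (leb (X `|` [set c]) <= _)%E).
    by apply: le_measure; rewrite ?inE //; apply: measurableU.
  have e : (leb X + leb [set c] = leb X)%E by rewrite lebesgue_measure_set1 adde0.
  by rewrite -[leRHS]e; apply: (measureU2 leb mX (measurable_set1 c)).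
transitivity (leb (A `&` `](- pi), pi[%classic)).
  apply: (sandwich _ _ (- pi)); [exact: mI|exact: mI| |].
    by move=> x [Ax]; rewrite /= !in_itv /= => /andP[/ltW -> ->].
  move=> x [Ax]; rewrite /= !in_itv /= le_eqVlt => /andP[/orP[/eqP <-|h1] h2].
    by right.
  by left; split => //; rewrite h1.
apply/esym; apply: (sandwich _ _ pi); [exact: mI|exact: mI| |].
  by move=> x [Ax]; rewrite /= !in_itv /= => /andP[-> /ltW ->].
move=> x [Ax]; rewrite /= !in_itv /= [x <= _]le_eqVlt => /andP[h1 /orP[/eqP ->|h2]].
  by right.
by left; split => //; rewrite h1.
Qed.

Let mN : measurable_fun setT (-%R : T -> T).
Proof. by apply: measurable_funN; apply: measurable_id. Qed.

Lemma torus_reflect_integrable f : mu.-integrable setT (EFin \o f) ->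
  mu.-integrable setT (EFin \o (fun x => f (- x))).
Proof.
move=> fi; have /integrableP[mf hf] := fi.
have mfN : measurable_fun setT (EFin \o (fun x => f (- x))).
  exact: (measurableT_comp mf mN).
apply/integrableP; split => //; apply: le_lt_trans hf.
rewrite -(@eq_measure_integral _ _ _ setT mu (pushforward mu (-%R : T -> T))); last first.
  by move=> A mA _; first [exact: torus_pushN|exact/esym/torus_pushN].
rewrite ge0_integral_pushforward //; last exact: measurableT_comp.
rewrite preimage_setT le_eqVlt; apply/orP; left; apply/eqP.
by apply: eq_integral => x _ /=; rewrite opprK.
Qed.

Lemma torus_reflect f : mu.-integrable setT (EFin \o f) ->
  \int[mu]_x f (- x) = \int[mu]_x f x.
Proof.
move=> fi; have /integrableP[/measurable_EFinP mf _] := fi.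
rewrite /Rintegral; congr fine.
rewrite -(@eq_measure_integral _ _ _ setT mu (pushforward mu (-%R : T -> T))); last first.
  by move=> A mA _; first [exact: torus_pushN|exact/esym/torus_pushN].
have ff : ((fun x : T => (f (- x))%:E) \o (-%R : T -> T)) = EFin \o f.
  by apply/funext => x /=; rewrite opprK.
rewrite (integral_pushforward mN) //.
- by rewrite ff preimage_setT.
- by apply/measurable_EFinP; apply: measurableT_comp.
- by rewrite ff preimage_setT.
Qed.

End TorusIntegrals.

(** * Bounded measurable multipliers *)

Section BoundedMeasurable.
Context {R : realType}.
Local Notation T := (measurableTypeR R).
Local Notation mu := (torus R).
Implicit Types (f g h : T -> R).

Definition bm h := measurable_fun setT h /\ exists M, forall x, `|h x| <= M.

Lemma bm_cst (a : R) : bm (fun=> a).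
Proof. by split; [exact: measurable_cst|exists `|a|]. Qed.

Lemma bmD h g : bm h -> bm g -> bm (fun x => h x + g x).
Proof.
move=> [mh [M hM]] [mg [N gN]]; split; first exact: measurable_funD.
by exists (M + N) => x; apply: le_trans (ler_normD _ _) _; apply: lerD.
Qed.

Lemma bmM h g : bm h -> bm g -> bm (fun x => h x * g x).
Proof.
move=> [mh [M hM]] [mg [N gN]]; split; first exact: measurable_funM.
by exists (M * N) => x; rewrite normrM ler_pM.
Qed.

Lemma bmX h n : bm h -> bm (fun x => h x ^+ n).
Proof.
move=> bh; elim: n => [|n IH]; first exact: bm_cst.
by under eq_fun do rewrite exprS; apply: bmM.
Qed.

Lemma bm_cos (a b : R) : bm (fun x => cos (a * x + b)).
Proof.
split; last by exists 1 => x; apply: cos_max.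
apply: continuous_measurable_fun => x.
apply: (@continuous_comp _ _ _ (fun x => a * x + b) cos); last exact: continuous_cos.
by apply: cvgD; [apply: cvgMr; exact: cvg_id|exact: cvg_cst].
Qed.

Lemma bm_sin (a b : R) : bm (fun x => sin (a * x + b)).
Proof.
split; last by exists 1 => x; apply: sin_max.
apply: continuous_measurable_fun => x.
apply: (@continuous_comp _ _ _ (fun x => a * x + b) sin); last exact: continuous_sin.
by apply: cvgD; [apply: cvgMr; exact: cvg_id|exact: cvg_cst].
Qed.

Lemma bm_cosM (a : R) : bm (fun x => cos (a * x)).
Proof. by have := bm_cos a 0; under eq_fun do rewrite addr0. Qed.

Lemma bm_sinM (a : R) : bm (fun x => sin (a * x)).
Proof. by have := bm_sin a 0; under eq_fun do rewrite addr0. Qed.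

Lemma bm_cos1 : bm cos.
Proof. by have := bm_cosM 1; under eq_fun do rewrite mul1r. Qed.

Lemma bm_horner h (p : {poly R}) : bm h -> bm (fun x => p.[h x]).
Proof.
move=> bh; elim/poly_ind: p => [|p c IH].
  by under eq_fun do rewrite horner0; apply: bm_cst.
under eq_fun do rewrite hornerD hornerMX hornerC.
by apply: bmD; [apply: bmM|apply: bm_cst].
Qed.

Lemma integrable_bm f h : mu.-integrable setT (EFin \o f) -> bm h ->
  mu.-integrable setT (EFin \o (fun x => f x * h x)).
Proof.
move=> fi [mh [M hM]]; have /integrableP[mf _] := fi; move/measurable_EFinP in mf.
have := integrableZl measurableT M fi; apply: le_integrable => //.
  by apply/measurable_EFinP; apply: measurable_funM.
move=> x _ /=; rewrite lee_fin !normrM mulrC; apply: ler_wpM2r => //.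
by apply: le_trans (hM x) _; apply: ler_norm.
Qed.

Lemma bm_integrable h : bm h -> mu.-integrable setT (EFin \o h).
Proof. by move=> [mh [M hM]]; apply: integrable_bounded hM. Qed.

Lemma bm_L2r h : bm h -> h \in Lfun mu 2%:E.
Proof. by move=> [mh [M hM]]; apply: L2r_bounded hM. Qed.

Lemma L2r_integrable f : f \in Lfun mu 2%:E -> mu.-integrable setT (EFin \o f).
Proof.
move=> hf; have := L2r_mul hf (bm_L2r (bm_cst 1)).
by under eq_fun do rewrite mulr1.
Qed.

End BoundedMeasurable.

(** * An odd function with vanishing sine coefficients is zero *)

Section FourierUniqueness.
Context {R : realType}.
Local Notation T := (measurableTypeR R).
Local Notation mu := (torus R).
Local Notation leb := (@lebesgue_measure R).
Variable f : T -> R.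
Hypothesis fi : mu.-integrable setT (EFin \o f).
Hypothesis fodd : \forall x \ae mu, f (- x) = - f x.
Hypothesis fsin : forall k : nat, \int[mu]_x (f x * sin (k%:R * x)) = 0.

Let mf : measurable_fun setT f.
Proof. by have /integrableP[/measurable_EFinP] := fi. Qed.

Let lin (a b : R) h g : bm h -> bm g ->
  \int[mu]_x (f x * (a * h x + b * g x)) =
  a * \int[mu]_x (f x * h x) + b * \int[mu]_x (f x * g x).
Proof.
move=> bh bg; have ih := integrable_bm fi bh; have ig := integrable_bm fi bg.
rewrite -!RintegralZl // -RintegralD //; try exact: integrable_mull.
by apply: eq_Rintegral => x _; ring.
Qed.

(** The integrand is odd almost everywhere, so reflection shows that the integral equals its
    opposite. *)
Let fcos (k : nat) : \int[mu]_x (f x * cos (k%:R * x)) = 0.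
Proof.
have bh := bm_cosM (k%:R : R).
have ih := integrable_bm fi bh.
have /integrableP[/measurable_EFinP mh _] := ih.
have := torus_reflect ih.
rewrite (@ae_Rintegral _ _ (fun x => -1 * (f x * cos (k%:R * x)))).
- by rewrite RintegralZl // mulN1r => /eqP; rewrite -subr_eq0 -opprD oppr_eq0 -mulr2n mulrn_eq0 => /eqP.
- have mN : measurable_fun setT (-%R : T -> T) by apply: measurable_funN; apply: measurable_id.
  exact: (measurableT_comp mh mN).
- by apply: measurable_funM.
- apply: (@filterS _ _ (ae_filter_ringOfSetsType mu)) fodd => x ->.
  by rewrite mulrN cosN; ring.
Qed.

(** Each factor [cos (x - x0)] shifts the frequency by one in both directions; integer frequencies
    let the induction pass below 0. *)
Let moments x0 n (z : int) :
  \int[mu]_x (f x * (cos (x - x0) ^+ n * sin (z%:~R * x))) = 0 /\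
  \int[mu]_x (f x * (cos (x - x0) ^+ n * cos (z%:~R * x))) = 0.
Proof.
elim: n z => [|n IH] z.
  have e (h : T -> R) : \int[mu]_x (f x * (cos (x - x0) ^+ 0 * h x)) = \int[mu]_x (f x * h x).
    by apply: eq_Rintegral => x _; rewrite expr0 mul1r.
  rewrite !e; case: z => k; first by split; [exact: fsin|exact: fcos].
  have := fsin k.+1; have := fcos k.+1.
  have -> : \int[mu]_x (f x * cos ((Negz k)%:~R * x)) = \int[mu]_x (f x * cos (k.+1%:R * x)).
    by apply: eq_Rintegral => x _; rewrite NegzE mulrNz mulNr cosN -pmulrn.
  have -> : \int[mu]_x (f x * sin ((Negz k)%:~R * x)) = \int[mu]_x ((-1) * (f x * sin (k.+1%:R * x))).
    apply: eq_Rintegral => x _.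
    have -> : sin ((Negz k)%:~R * x) = - sin (k.+1%:R * x).
      by rewrite NegzE mulrNz mulNr sinN -pmulrn.
    by ring.
  rewrite RintegralZl //; last by apply: integrable_bm fi (bm_sinM _).
  by move=> -> ->; rewrite mulr0.
have bc : bm (fun x : T => cos (x - x0)).
  by have := bm_cos 1 (- x0); under eq_fun do rewrite mul1r.
have bS (k : int) : bm (fun x : T => cos (x - x0) ^+ n * sin (k%:~R * x)).
  by apply: bmM; [apply: bmX|apply: bm_sinM].
have bC (k : int) : bm (fun x : T => cos (x - x0) ^+ n * cos (k%:~R * x)).
  by apply: bmM; [apply: bmX|apply: bm_cosM].
have [[s1 c1] [s2 c2]] := (IH (z + 1), IH (z - 1)).
have ex (x : R) (a b c d : R) : (z + 1)%:~R * x = z%:~R * x + x /\ (z - 1)%:~R * x = z%:~R * x - x.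
  by rewrite intrD intrB; split; ring.
split.
  have -> : \int[mu]_x (f x * (cos (x - x0) ^+ n.+1 * sin (z%:~R * x))) =
    \int[mu]_x (f x * (2^-1 * ((cos x0 * (cos (x - x0) ^+ n * sin ((z + 1)%:~R * x)) +
         - sin x0 * (cos (x - x0) ^+ n * cos ((z + 1)%:~R * x)))) +
       2^-1 * (cos x0 * (cos (x - x0) ^+ n * sin ((z - 1)%:~R * x)) +
         sin x0 * (cos (x - x0) ^+ n * cos ((z - 1)%:~R * x))))).
    apply: eq_Rintegral => x _; have [-> ->] := ex x 0 0 0 0.
    by rewrite exprS {1}cosB !sinD !cosD !sinN !cosN; field.
  rewrite lin; last 2 first.
  - by apply: bmD; apply: bmM; rewrite ?bm_cst //; apply: bm_cst.
  - by apply: bmD; apply: bmM; rewrite ?bm_cst //; apply: bm_cst.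
  by rewrite !lin // s1 c1 s2 c2; ring.
have -> : \int[mu]_x (f x * (cos (x - x0) ^+ n.+1 * cos (z%:~R * x))) =
  \int[mu]_x (f x * (2^-1 * ((cos x0 * (cos (x - x0) ^+ n * cos ((z + 1)%:~R * x)) +
       sin x0 * (cos (x - x0) ^+ n * sin ((z + 1)%:~R * x)))) +
     2^-1 * (cos x0 * (cos (x - x0) ^+ n * cos ((z - 1)%:~R * x)) +
       - sin x0 * (cos (x - x0) ^+ n * sin ((z - 1)%:~R * x))))).
  apply: eq_Rintegral => x _; have [-> ->] := ex x 0 0 0 0.
  by rewrite exprS {1}cosB !sinD !cosD !sinN !cosN; field.
rewrite lin; last 2 first.
- by apply: bmD; apply: bmM; rewrite ?bm_cst //; apply: bm_cst.
- by apply: bmD; apply: bmM; rewrite ?bm_cst //; apply: bm_cst.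
by rewrite !lin // s1 c1 s2 c2; ring.
Qed.

Let fpoly x0 (p : {poly R}) : \int[mu]_x (f x * p.[cos (x - x0)]) = 0.
Proof.
have bc : bm (fun x : T => cos (x - x0)).
  by have := bm_cos 1 (- x0); under eq_fun do rewrite mul1r.
(* Peeling off a factor ['X] produces one more cosine, so the induction carries an arbitrary power
   of it. *)
suff H : forall n, \int[mu]_x (f x * (p.[cos (x - x0)] * cos (x - x0) ^+ n)) = 0.
  by rewrite -[RHS](H 0%N); apply: eq_Rintegral => x _; rewrite expr0 mulr1.
elim/poly_ind: p => [|p c IH] n.
  under eq_Rintegral do rewrite horner0 mul0r mulr0.
  by rewrite Rintegral_cst // mul0r.
have -> : \int[mu]_x (f x * ((p * 'X + c%:P).[cos (x - x0)] * cos (x - x0) ^+ n)) =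
   \int[mu]_x (f x * (1 * (p.[cos (x - x0)] * cos (x - x0) ^+ n.+1) + c * cos (x - x0) ^+ n)).
  by apply: eq_Rintegral => x _; rewrite hornerD hornerMX hornerC exprS; ring.
rewrite lin; last 2 first.
- by apply: bmM; [apply: bm_horner|apply: bmX].
- exact: bmX.
rewrite IH; have [_] := moments x0 n 0.
have -> : \int[mu]_x (f x * (cos (x - x0) ^+ n * cos (0%:~R * x))) =
  \int[mu]_x (f x * (cos (x - x0) ^+ n)).
  by apply: eq_Rintegral => x _; rewrite mul0r cos0 mulr1.
by move=> ->; rewrite !mulr0 addr0.
Qed.

Let bernoulli_ge (z : R) m : 0 <= z -> 1 + m%:R * z <= (1 + z) ^+ m.
Proof.
move=> z0; elim: m => [|m IH]; first by rewrite mul0r addr0.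
rewrite exprS; apply: le_trans (_ : (1 + z) * (1 + m%:R * z) <= _).
  by rewrite -[m.+1]addn1 natrD; have := mulr_ge0 (ler0n R m) (mulr_ge0 z0 z0); nra.
by apply: ler_wpM2l => //; rewrite addr_ge0.
Qed.

Let bernoulli_le (z : R) m : 0 <= z <= 1 -> 1 - m%:R * z <= (1 - z) ^+ m.
Proof.
move=> /andP[z0 z1]; elim: m => [|m IH]; first by rewrite mul0r subr0.
rewrite exprS; apply: le_trans (_ : (1 - z) * (1 - m%:R * z) <= _).
  by rewrite -[m.+1]addn1 natrD; have := mulr_ge0 (ler0n R m) (mulr_ge0 z0 z0); nra.
by apply: ler_wpM2l => //; rewrite subr_ge0.
Qed.

(** The polynomials of the elementary proof of the Stone-Weierstrass theorem, with threshold 1/2. By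
    Bernoulli's inequality they are at least [1 - (2 * y) ^+ n]; and since
    [(1 - y ^+ n) * (1 + y ^+ n) <= 1], the same inequality bounds them by the inverse of
    [(2 * y) ^+ n]. *)
Let qn (y : R) n := (1 - y ^+ n) ^+ (2 ^ n).

Let qn_bound y n : 0 <= y <= 1 -> `|qn y n| <= 1.
Proof.
move=> /andP[y0 y1]; have h : 0 <= 1 - y ^+ n <= 1.
  by rewrite subr_ge0 exprn_ile1 // gerBl exprn_ge0.
case/andP: h => h0 h1.
by rewrite ger0_norm /qn ?exprn_ge0 // exprn_ile1.
Qed.

Let qn_cvg1 y : 0 <= y < 2^-1 -> qn y n @[n --> \oo] --> (1 : R).
Proof.
move=> /andP[y0 y2]; have y1 : y <= 1 by apply: le_trans (ltW y2) _; lra.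
have h (n : nat) : 1 - (2 * y) ^+ n <= qn y n <= 1.
  have yn : 0 <= y ^+ n <= 1 by rewrite exprn_ge0 // exprn_ile1.
  apply/andP; split; last first.
    by apply: le_trans (ler_norm _) (qn_bound _ _); rewrite y0.
  have := bernoulli_le (2 ^ n) yn.
  by rewrite natrX exprMn.
apply: (squeeze_cvgr (f := fun n => 1 - (2 * y) ^+ n) (h := fun=> 1)).
- by apply: nearW => n; apply: h.
- rewrite -[X in _ --> X]subr0; apply: cvgB; first exact: cvg_cst.
  by apply: cvg_expr; rewrite ger0_norm ?mulr_ge0 //; lra.
- exact: cvg_cst.
Qed.

Let qn_cvg0 y : 2^-1 < y <= 1 -> qn y n @[n --> \oo] --> (0 : R).
Proof.
move=> /andP[y2 y1]; have y0 : 0 < y by apply: lt_trans y2; lra.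
have h (n : nat) : 0 <= qn y n <= (2 * y)^-1 ^+ n.
  have yn : 0 <= y ^+ n <= 1 by rewrite exprn_ge0 ?(ltW y0) // exprn_ile1 // ltW.
  have [a0 a1] := andP yn; apply/andP; split; first by rewrite /qn exprn_ge0 // subr_ge0.
  have h1 := bernoulli_ge (2 ^ n) a0.
  rewrite exprVn -[leRHS]mul1r ler_pdivlMr ?exprn_gt0 ?mulr_gt0 //.
  apply: le_trans (_ : qn y n * (1 + y ^+ n) ^+ (2 ^ n) <= _).
    apply: ler_wpM2l; first by rewrite /qn exprn_ge0 // subr_ge0.
    by apply: le_trans h1; rewrite exprMn natrX lerDr.
  rewrite /qn -exprMn; apply: exprn_ile1; nra.
apply: (squeeze_cvgr (f := fun=> 0) (h := fun n => (2 * y)^-1 ^+ n)).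
- by apply: nearW => n; apply: h.
- exact: cvg_cst.
- by apply: cvg_expr; rewrite ger0_norm ?invr_ge0 ?mulr_ge0 ?(ltW y0) // invf_lt1 ?mulr_gt0 //; lra.
Qed.

(* Powers of [(1 - y ^ n) ^ (2 ^ n)], [y] affine in [cos (x - x0)], tend to the indicator of
   the complement of an arc centred at [x0]. *)
Let farc (a b : R) : - pi < a -> a < b -> b < pi -> b - a <= pi ->
  \int[mu]_x (f x * \1_(~` `]a, b[%classic) x) = 0.
Proof.
move=> pa ab bp bap; pose x0 := (a + b) / 2; pose r := (b - a) / 2.
have r0 : 0 < r by rewrite divr_gt0 // subr_gt0.
have r2 : r <= pi / 2 by rewrite /r; lra.
have ppos : 0 < pi :> R := pi_gt0 R.
have cr0 : 0 <= cos r by apply: cos_ge0_pihalf; rewrite r2 andbT; lra.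
have c1 : 0 < 1 + cos r by lra.
pose s := (1 + cos r)^-1; have s0 : 0 < s by rewrite invr_gt0.
pose y (x : R) := s / 2 * (1 + cos (x - x0)).
have y01 x : 0 <= y x <= 1.
  have h1 := cos_geN1 (x - x0); have h2 := cos_le1 (x - x0).
  have s1 : s <= 1 by rewrite invf_le1 //; lra.
  by apply/andP; split; rewrite /y; nra.
pose q n : {poly R} := (1 - ((s / 2)%:P * (1 + 'X)) ^+ n) ^+ (2 ^ n).
have qE n x : (q n).[cos (x - x0)] = qn (y x) n.
  by rewrite /q !hornerE.
have comp x : - pi < x <= pi -> x != a -> x != b ->
    if (a < x < b) then 2^-1 < y x else y x < 2^-1.
  move=> /andP[xp px] xa xb.
  have yE (t : R) : y x < t / 2 = (cos (x - x0) < t * (1 + cos r) - 1).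
    rewrite ltrBrDl /y mulrAC ltr_pM2r ?invr_gt0 // /s mulrC ltr_pdivrMr //.
  have yE' : y x < 2^-1 = (cos (x - x0) < cos r).
    by rewrite -[2^-1]mul1r yE; congr (_ < _); ring.
  have yE2 : 2^-1 < y x = (cos r < cos (x - x0)).
    rewrite /y -[X in X < _]mul1r mulrAC ltr_pM2r ?invr_gt0 // /s mulrC ltr_pdivlMr // mul1r.
    by rewrite ltrD2l.
  have cabs : cos (x - x0) = cos `|x - x0|.
    have [h|h] := leP 0 (x - x0); first by rewrite ger0_norm.
    by rewrite ltr0_norm // cosN.
  set u := `|x - x0| in cabs.
  have u0 : 0 <= u by apply: normr_ge0.
  case: ifP => hx.
    rewrite yE2 cabs; have ur : u < r.
      by rewrite /u ltr_norml /r /x0; case/andP: hx; lra.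
    by rewrite ltr_cos ?in_itv /= ?u0 //=; [lra|apply/andP; split; lra].
  have ru : r < u.
    rewrite /u /r /x0 ltNge ler_norml; apply/negP => /andP[h1 h2].
    move/negP: hx; apply; apply/andP; split; rewrite lt_def; apply/andP; split => //.
    - lra.
    - by rewrite eq_sym.
    - lra.
  rewrite yE' cabs; have [up|pu] := leP u pi.
    by rewrite ltr_cos ?in_itv /= ?u0 ?up //; apply/andP; split; lra.
  (* Beyond half a turn, the distance to the centre is measured the other way round the circle. *)
  have -> : cos u = cos (pi *+ 2 - u) by rewrite cosB cos2pi sin2pi mul0r addr0 mul1r.
  have u2 : u < pi *+ 2 - r.
    rewrite /u ltr_norml /r /x0 mulr2n; apply/andP; split; lra.
  rewrite mulr2n in u2 *.
  by rewrite ltr_cos ?in_itv /=; [lra|apply/andP; split; lra|apply/andP; split; lra].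
pose A : set T := ~` `]a, b[%classic.
have mA : measurable A by apply: measurableC; exact: (@measurable_itv R).
have mI : measurable_fun setT (\1_A : T -> R) by exact: measurable_indic.
pose F_ n (x : T) := (f x * (q n).[cos (x - x0)])%:E.
pose L (x : T) := (f x * \1_A x)%:E.
have bc : bm (fun x : T => cos (x - x0)).
  by have := bm_cos 1 (- x0); under eq_fun do rewrite mul1r.
have mF n : measurable_fun setT (F_ n).
  have [m _] := bm_horner (q n) bc.
  by apply/measurable_EFinP; apply: measurable_funM.
have mL : measurable_fun setT L by apply/measurable_EFinP; apply: measurable_funM.
have ig : mu.-integrable setT (fun x => `|f x|%:E).
  exact: (integrable_abse fi).
have cv : {ae mu, forall x, [set: T] x -> F_ ^~ x @ \oo --> L x}.
  suff : \forall x \ae mu, F_ ^~ x @ \oo --> L x by apply: filterS => x hx _.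
  apply: ae_torus; exists ([set a] `|` [set b]); split.
  - by apply: measurableU; apply: measurable_set1.
  - apply/eqP; rewrite eq_le measure_ge0 andbT.
    have -> : 0%E = (leb [set a] + leb [set b])%E by rewrite !lebesgue_measure_set1 adde0.
    by apply: measureU2; apply: measurable_set1.
  - move=> x hx; apply: contrapT => /not_orP[/eqP xa /eqP xb]; apply: hx => /=.
    rewrite in_itv /= => Dx; have := comp x Dx xa xb.
    rewrite /F_ /L; under eq_fun do rewrite qE.
    move=> hx; suff h : f x * qn (y x) n @[n --> \oo] --> f x * \1_A x.
      by apply: cvg_EFin; [exact: nearW|exact: h].
    apply: cvgM; first exact: cvg_cst.
    rewrite indicE; case: ifP hx => hx hy.
      have -> : (x \in A) = false.
        by apply/negbTE/negP; rewrite inE => /(_ _); apply; rewrite /= in_itv.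
      by apply: qn_cvg0; rewrite hy; case/andP: (y01 x).
    have -> : (x \in A) = true by apply: mem_set; rewrite /A /setC /= in_itv /= hx.
    by apply: qn_cvg1; rewrite hy andbT; case/andP: (y01 x).
have bd : {ae mu, forall x n, [set: T] x -> (`|F_ n x| <= `|f x|%:E)%E}.
  apply: aeW => x n _; rewrite /F_ qE lee_fin normrM ler_piMr //.
  exact: qn_bound.
have [_ _ lim0] := dominated_convergence measurableT mF mL cv ig bd.
have Fz n : (\int[mu]_x F_ n x = 0)%E.
  have := fpoly x0 (q n); rewrite /Rintegral.
  have := integrable_fin_num measurableT (integrable_bm fi (bm_horner (q n) bc)).
  by move=> /fineK <-  /= ->.
rewrite /Rintegral; have <- : (0%E = \int[mu]_x L x)%E by
  apply: (cvg_unique _ _ lim0) => //; rewrite /=; under eq_fun do rewrite Fz; exact: cvg_cst.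
by [].
Qed.

(** The integral over the arc is the integral over the torus, zero by [fpoly], minus that over the
    complement, zero by [farc]. *)
Let farc0 (a b : R) : - pi < a -> a < b -> b < pi -> b - a <= pi ->
  \int[leb]_(x in `]a, b]) f x = 0.
Proof.
move=> pa ab bp bap.
have sub : (`]a, b[%classic : set T) `<=` `](- pi : R), pi]%classic.
  move=> x; rewrite /= !in_itv /= => /andP[h1 h2].
  by rewrite (lt_trans pa h1) (ltW (lt_trans h2 bp)).
have fD : leb.-integrable `](- pi : R), pi]%classic (EFin \o f) by apply/torus_integrableE.
have fI : leb.-integrable `]a, b[%classic (EFin \o f).
  by apply: integrableS fD; rewrite //; exact: (@measurable_itv R).
rewrite -Rintegral_itv_bndo_bndc //.
have bI : bm (\1_(`]a, b[%classic) : T -> R).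
  split; first by apply: measurable_indic; exact: (@measurable_itv R).
  by exists 1 => x; rewrite indicE; case: (_ \in _); rewrite ?normr1 ?normr0.
have bA : bm (\1_(~` `]a, b[%classic) : T -> R).
  split; first by apply: measurable_indic; apply: measurableC; exact: (@measurable_itv R).
  by exists 1 => x; rewrite indicE; case: (_ \in _); rewrite ?normr1 ?normr0.
have h1 : \int[mu]_x (f x * \1_(`]a, b[%classic) x) = 0.
  have := fpoly 0 1; have -> : \int[mu]_x (f x * 1.[cos (x - 0)]) =
     \int[mu]_x (f x * (1 * \1_(`]a, b[%classic) x + 1 * \1_(~` `]a, b[%classic) x)).
    apply: eq_Rintegral => x _; rewrite hornerC !indicE in_setC.
    by case: (x \in _) => /=; ring.
  by rewrite lin // farc // mulr0 addr0 mul1r.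
rewrite -[RHS]h1 {2}/Rintegral torus_integralE; last exact: integrable_bm.
rewrite Rintegral_mkcond [in RHS]integral_mkcond /Rintegral; congr fine.
apply: eq_integral => x _; rewrite !patchE indicE.
case: ifPn => [xI|xI].
  by rewrite ifT ?mulr1 // inE; apply: sub; move: xI; rewrite inE.
by rewrite mulr0; case: ifP.
Qed.

(** The integrals over short arcs vanish, so the primitive of [f] is locally constant inside the
    domain; by Lebesgue's differentiation theorem its derivative is [f] almost everywhere. *)
Theorem odd_fourier_unique : \forall x \ae mu, f x = 0.
Proof.
apply: ae_torus.
have fD : leb.-integrable `](- pi : R), pi]%classic (EFin \o f) by apply/torus_integrableE.
pose ft := (f \_ `](- pi : R), pi]%classic : R -> R).
have fti : leb.-integrable setT (EFin \o ft).
  by rewrite /ft -restrict_EFin; apply: (iffLR (integrable_mkcond _ _)) fD; apply: mD.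
have floc : locally_integrable [set: R] ft by apply: integrable_locally.
have fty y : leb.-integrable [set` Interval (BRight (- pi)) (BRight y)] (EFin \o ft).
  by apply: integrableS fti.
pose F (x : R) := \int[leb]_(t in [set` Interval (BRight (- pi)) (BRight x)]) ft t.
have hF := FTC1 fty floc.
have npi : \forall x \ae leb, x <> (pi : R).
  exists [set (pi : R)]; split; rewrite ?lebesgue_measure_set1 //.
  by move=> x /= /contrapT.
apply: (@filterS2 _ _ (ae_filter_ringOfSetsType leb) _ _ _ _ npi hF).
move=> x /= xpi hx; rewrite in_itv /= => /andP[px xp].
have {}xp : x < pi.
  by rewrite lt_def xp andbT; apply/eqP => h; apply: xpi; rewrite h.
have [//|dF Fx'] := hx.
have Fx : 'D_1 F (x : R) = ft x by rewrite -derive1E; exact: Fx'.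
have -> : f x = ft x by rewrite /ft patchE ifT // inE /= in_itv /= px ltW.
rewrite -Fx; transitivity ('D_1 (fun=> F x) x); last exact: derive_cst.
apply: near_eq_derive.
have small y z : - pi < y -> y < z -> z < pi -> z - y <= pi -> F y = F z.
  move=> py yz zp zy; apply/eqP; rewrite eq_sym -subr_eq0; apply/eqP.
  rewrite /F Rintegral_itvB ?bnd_simp //; try exact: ltW.
  rewrite -(farc0 py yz zp zy); apply: eq_Rintegral => t; rewrite inE /= in_itv /= => /andP[h1 h2].
  rewrite /ft patchE ifT // inE /= in_itv /= (lt_trans py h1) (le_trans h2) // ltW //.
(* Within this radius the arcs stay inside the domain, and their length stays below [pi]. *)
pose d := Num.min (x + pi) (Num.min (pi - x) 1).
have d0 : 0 < d by rewrite !lt_min ltr01 andbT; apply/andP; split; lra.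
near=> z.
have : ball (x : R) d z by near: z; apply: nbhsx_ballx.
rewrite /ball /=.
rewrite !lt_min => /and3P[z1 z2 z3].
have pi1 : 2 <= pi :> R by apply: pi_ge2.
rewrite ltr_norml in z1; rewrite ltr_norml in z2; rewrite ltr_norml in z3.
have [xz|zx|->] := ltgtP x z => //.
  by apply/esym; apply: small; lra.
by apply: small; lra.
Unshelve. all: by end_near.
Qed.

End FourierUniqueness.

(** * Completeness of [L2] *)

Section RieszFischer.
Context {R : realType}.
Local Notation T := (measurableTypeR R).
Local Notation mu := (torus R).
Local Notation L2r := (Lfun mu 2%:E).

Lemma geometric_tail (x : nat -> R) (K : R) : 0 <= K ->
  (forall n, `|x n.+1 - x n| <= K * (2^-1) ^+ n) ->
  forall n m, (n <= m)%N -> `|x m - x n| <= 2 * K * (2^-1) ^+ n.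
Proof.
move=> K0 h n m /subnKC <-; elim: (m - n)%N => [|k IH].
  by rewrite addn0 subrr normr0 !mulr_ge0 // exprn_ge0 // invr_ge0.
(* Subtracting the geometric remainder turns the bound into one that is preserved by induction. *)
suff : `|x (n + k.+1)%N - x n| <= 2 * K * (2^-1) ^+ n - 2 * K * (2^-1) ^+ (n + k.+1).
  move/le_trans; apply; rewrite gerBl !mulr_ge0 // exprn_ge0 // invr_ge0 //.
elim: k {IH} => [|k IH].
  rewrite addn1; apply: le_trans (h n) _; rewrite exprS.
  have : 0 <= (2^-1) ^+ n :> R by rewrite exprn_ge0 // invr_ge0.
  nra.
rewrite addnS -(subrKA (x (n + k.+1)%N)) .
apply: le_trans (ler_normD _ _) _; have h2 := h (n + k.+1)%N.
have : 0 <= (2^-1) ^+ (n + k.+1) :> R by rewrite exprn_ge0 // invr_ge0.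
rewrite [X in _ - 2 * K * X]exprS; move: IH h2; lra.
Qed.

Lemma half_pow_small (K e : R) : 0 <= K -> 0 < e -> exists n, K * (2^-1) ^+ n <= e.
Proof.
move=> K0 e0; have K1 : 0 < K + 1 by rewrite ltr_wpDl.
have : (2^-1) ^+ n @[n --> \oo] --> (0 : R).
  by apply: cvg_expr; rewrite ger0_norm ?invr_ge0 // invf_lt1 // ltr1n.
move/cvgrPdist_le => /(_ (e / (K + 1))) [|N _ h]; first by rewrite divr_gt0.
exists N; have := h N (leqnn N); rewrite sub0r normrN ger0_norm; last first.
  by rewrite exprn_ge0 // invr_ge0.
rewrite ler_pdivlMr // mulrC => h2; apply: le_trans h2.
by apply: ler_wpM2r; rewrite ?exprn_ge0 ?invr_ge0 // lerDl.
Qed.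

(** The rate leaves room for a weight: the squared increments multiplied by 4^n still have integrals
    at most 2^-n, so their sum is finite almost everywhere. There the increments are at most a
    constant times 2^-n, and the sequence converges pointwise. *)
Lemma real_riesz_fischer (g : nat -> T -> R) : (forall n, g n \in L2r) ->
  (forall n m, (n <= m)%N -> \int[mu]_x (g m x - g n x) ^+ 2 <= 8^-1 ^+ n) ->
  exists2 h, h \in L2r & forall n, \int[mu]_x (h x - g n x) ^+ 2 <= 8^-1 ^+ n.
Proof.
move=> gL hc; have mg n : measurable_fun setT (g n) by apply: L2r_meas.
have sqi n m : mu.-integrable setT (EFin \o (fun x => (g m x - g n x) ^+ 2)).
  by have /L2rP[] := L2rB (gL m) (gL n).
pose d n x := 4 ^+ n * (g n.+1 x - g n x) ^+ 2.
have d0 n x : 0 <= d n x by apply: mulr_ge0; [apply: exprn_ge0|apply: sqr_ge0].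
have md n : measurable_fun setT (EFin \o d n).
  apply/measurable_EFinP; apply: measurable_funM => //.
  by apply: measurable_funX; apply: measurable_funB.
pose H x : \bar R := (\sum_(n <oo) (d n x)%:E)%E.
have mH : measurable_fun setT H by apply: ge0_emeasurable_sum => [k y _ _|k _]; [rewrite lee_fin|apply: md].
have iH : (\int[mu]_x H x <= 2%:E)%E.
  rewrite integral_nneseries //; last by move=> n x _; rewrite lee_fin.
  have hn n : (\int[mu]_x (d n x)%:E <= ((2^-1) ^+ n)%:E)%E.
    have di := integrable_mull (4 ^+ n) (sqi n n.+1).
    rewrite -[leLHS]fineK; last exact: integrable_fin_num di.
    rewrite lee_fin -/(Rintegral _ _ _) RintegralZl //.
    apply: le_trans (_ : 4 ^+ n * 8^-1 ^+ n <= _).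
      by apply: ler_wpM2l; rewrite ?exprn_ge0 // hc.
    have e8 : 4 * 8^-1 = 2^-1 :> R by field.
    by rewrite -exprMn e8.
  apply: lime_le.
    by apply: is_cvg_nneseries => n _ _; apply: integral_ge0 => x _; rewrite lee_fin.
  apply: nearW => n.
  apply: (@le_trans _ _ (\sum_(0 <= i < n) ((2^-1) ^+ i)%:E)%E).
    by apply: lee_sum => i _; apply: hn.
  rewrite sumEFin lee_fin.
  suff -> : \sum_(0 <= i < n) (2^-1) ^+ i = 2 - 2 * (2^-1) ^+ n :> R.
    by rewrite gerBl mulr_ge0 // exprn_ge0 // invr_ge0.
  elim: n => [|n IH]; first by rewrite big_geq // expr0; ring.
  by rewrite big_nat_recr //= IH exprS; field.
have Hi : mu.-integrable setT H.
  apply/integrableP; split => //; apply: le_lt_trans (ltry 2).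
  rewrite (_ : (\int[mu]_x `|H x| = \int[mu]_x H x)%E) //.
  apply: eq_integral => x _; rewrite gee0_abs //.
  by apply: nneseries_ge0 => k _ _; rewrite lee_fin.
have aeH := integrable_ae measurableT Hi.
(* The upper limit is measurable everywhere and equals the limit wherever that exists. *)
pose h x := fine (limn_esup (fun n => (g n x)%:E)).
have mh : measurable_fun setT h.
  apply: measurableT_comp => //; apply: measurable_fun_limn_esup => n.
  by apply/measurable_EFinP.
have aeh : \forall x \ae mu, g ^~ x @ \oo --> h x.
  apply: filterS aeH => x /(_ Logic.I) Hf.
  pose C := fine (H x); have HC : H x = C%:E by rewrite fineK.
  have C0 : 0 <= C by rewrite -lee_fin -HC nneseries_ge0 // => n _ _; rewrite lee_fin.
  have dC n : d n x <= C.
    rewrite -lee_fin -HC; apply: le_trans (nneseries_lim_ge n.+1 _); last first.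
      by move=> i _ _; rewrite lee_fin.
    rewrite sumEFin lee_fin big_nat_recr //= lerDr.
    by apply: sumr_ge0 => i _; apply: d0.
  have diff n : `|g n.+1 x - g n x| <= Num.sqrt C * (2^-1) ^+ n.
    rewrite -ler_sqr ?nnegrE ?mulr_ge0 ?sqrtr_ge0 ?exprn_ge0 ?invr_ge0 //.
    rewrite real_normK ?num_real // exprMn sqr_sqrtr //.
    have := dC n; rewrite /d mulrC -ler_pdivlMr ?exprn_gt0 // => /le_trans; apply.
    have e4 : 2^-1 ^+ 2 = 4^-1 :> R by field.
    by rewrite exprAC e4 exprVn.
  have [|l hl] := @real_cauchy_lim R (g ^~ x).
    move=> e e0; have C2 : 0 <= 2 * Num.sqrt C by rewrite mulr_ge0 ?sqrtr_ge0.
    have [N hN] := half_pow_small C2 e0.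
    have wl n m : (N <= n)%N -> (n <= m)%N -> `|g m x - g n x| <= e.
      move=> Nn nm; apply: le_trans (geometric_tail (sqrtr_ge0 C) diff nm) _.
      apply: le_trans hN; apply: ler_wpM2l; first by rewrite mulr_ge0 ?sqrtr_ge0.
      by apply: ler_wiXn2l; rewrite ?invr_ge0 // invf_le1 // ler1n.
    exists N => n m hn hm; have [nm|mn] := leqP n m.
      by rewrite distrC; apply: wl.
    by apply: wl => //; apply: ltnW.
  have gl : g ^~ x @ \oo --> l.
    apply/cvgrPdist_le => e e0; have [N hN] := hl e e0.
    by exists N => // n /= /hN; rewrite distrC.
  have gle : (fun n => (g n x)%:E) @ \oo --> l%:E by apply: cvg_EFin; [exact: nearW|exact: gl].
  by rewrite /h (cvg_limn_einf_sup gle).2.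
(* Fatou's lemma transfers the hypothesis to the limit; the infimum over later terms is bounded by
   the term [maxn n m], to which the hypothesis applies. *)
have key n : (\int[mu]_x ((h x - g n x) ^+ 2)%:E <= (8^-1 ^+ n)%:E)%E.
  pose F m x := ((g m x - g n x) ^+ 2)%:E.
  have mF m : measurable_fun setT (F m).
    by apply/measurable_EFinP; apply: measurable_funX; apply: measurable_funB.
  have F0 m x : [set: T] x -> (0 <= F m x)%E by move=> _; rewrite lee_fin sqr_ge0.
  rewrite (_ : (\int[mu]_x ((h x - g n x) ^+ 2)%:E = \int[mu]_x limn_einf (F ^~ x))%E); last first.
    apply: ge0_ae_eq_integral => //.
    - by apply/measurable_EFinP; apply: measurable_funX; apply: measurable_funB.
    - rewrite /limn_einf; apply: measurableT_comp => //.
      by apply: measurable_fun_limn_esup => m; apply: measurableT_comp.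
    - by move=> x _; rewrite lee_fin sqr_ge0.
    - move=> x _; rewrite limn_einf_lim; apply: lime_ge; first exact: is_cvg_einfs.
      by apply: nearW => m; apply: le_ereal_inf_tmp => _ [i _ <-]; apply: F0.
    - apply: filterS aeh => x gx _; apply/esym.
      apply: (cvg_limn_einf_sup _).1; apply: cvg_EFin; first exact: nearW.
      rewrite (_ : fine \o _ = (fun m => (g m x - g n x) * (g m x - g n x))); last first.
        by apply/funext => m /=; rewrite expr2.
      by rewrite expr2; apply: cvgM; apply: cvgB => //; apply: cvg_cst.
  apply: le_trans (fatou mu measurableT mF F0) _.
  rewrite limn_einf_lim; apply: lime_le; first exact: is_cvg_einfs.
  apply: nearW => m; apply: le_trans (_ : (\int[mu]_x F (maxn n m) x <= _)%E).
    by apply: ereal_inf_lbound; exists (maxn n m) => //=; apply: leq_maxr.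
  rewrite -[leLHS]fineK; last exact: integrable_fin_num (sqi n (maxn n m)).
  by rewrite lee_fin; apply: hc; apply: leq_maxl.
have hgL n : (fun x => h x - g n x) \in L2r.
  have mhg : measurable_fun setT (fun x => h x - g n x) by apply: measurable_funB.
  apply/L2rP; split => //; apply/integrableP; split.
    by apply/measurable_EFinP; apply: measurable_funX.
  apply: le_lt_trans (ltry (8^-1 ^+ n)).
  under eq_integral => x _ do rewrite /= ger0_norm ?sqr_ge0 //.
  exact: key.
exists h; last first.
  move=> n; have := key n; rewrite -[leLHS]fineK ?lee_fin //.
  by have /L2rP[_ hi] := hgL n; apply: integrable_fin_num hi.
have := L2rD (hgL 0%N) (gL 0%N).
by under eq_fun do rewrite subrK.
Qed.

Lemma riesz_fischer (F : nat -> wave R) : (forall n, L2 (F n)) ->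
  (forall n m, (n <= m)%N -> L2norm (fun x => F m x - F n x) ^+ 2 <= 8^-1 ^+ n) ->
  exists2 psi, L2 psi & forall n, L2norm (fun x => psi x - F n x) ^+ 2 <= 2 * 8^-1 ^+ n.
Proof.
move=> FL hc.
have part (psi : wave R) : L2 psi ->
    L2norm psi ^+ 2 = \int[mu]_x (complex.Re (psi x)) ^+ 2 + \int[mu]_x (complex.Im (psi x)) ^+ 2.
  move=> [/L2rP[_ a] /L2rP[_ b]]; rewrite L2norm_sqr /inner /= -RintegralD //.
  by apply: eq_Rintegral => x _; rewrite !cpxE; ring.
have pos (f : T -> R) : 0 <= \int[mu]_x (f x) ^+ 2.
  by apply: Rintegral_ge0 => x _; apply: sqr_ge0.
have [|n m nm|h hL hb] := @real_riesz_fischer (fun n x => complex.Re (F n x)).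
- by move=> n; have [] := FL n.
- apply: le_trans (hc n m nm); rewrite part; last exact: L2B.
  under [X in _ <= X + _]eq_Rintegral do rewrite ReD ReN.
  by rewrite lerDl pos.
have [|n m nm|k kL kb] := @real_riesz_fischer (fun n x => complex.Im (F n x)).
- by move=> n; have [] := FL n.
- apply: le_trans (hc n m nm); rewrite part; last exact: L2B.
  under [X in _ <= _ + X]eq_Rintegral do rewrite ImD ImN.
  by rewrite lerDr pos.
have pL : L2 (fun x => h x +i* k x) by split.
exists (fun x => h x +i* k x) => // n; rewrite part; last exact: L2B.
under eq_Rintegral do rewrite ReD ReN /=.
under [X in _ + X]eq_Rintegral do rewrite ImD ImN /=.
by have := hb n; have := kb n; lra.
Qed.

End RieszFischer.

(** * Sine coefficients: orthonormality, Bessel inequality, synthesis *)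

Section SineBasis.
Context {R : realType}.
Local Notation T := (measurableTypeR R).
Local Notation mu := (torus R).
Implicit Types (psi chi : wave R) (x y : nat -> R[i]).

Lemma sin_natpi (k : nat) : sin (k%:R * pi) = 0 :> R.
Proof.
elim: k => [|k IH]; first by rewrite mul0r sin0.
by rewrite -[k.+1]addn1 natrD mulrDl mul1r sinDpi IH oppr0.
Qed.

Lemma phi0E : @phi R 0 = (fun=> 0).
Proof. by apply/funext => t; rewrite /phi mul0r sin0 mul0r. Qed.

Lemma phi_odd k (t : T) : @phi R k (- t) = - phi k t.
Proof. by rewrite /phi mulrN sinN mulNr rmorphN. Qed.

Lemma L2_phi k : L2 (@phi R k).
Proof.
split; last by have := @L2_0 R => -[].
rewrite /phi /=; under eq_fun do rewrite mulrC.
by apply: bm_L2r; apply: bmM; [apply: bm_cst|apply: bm_sinM].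
Qed.

Lemma Ho_L2 psi : Ho psi -> L2 psi. Proof. by case. Qed.

Lemma Ho_ZD (a : R[i]) psi chi : Ho psi -> Ho chi -> Ho (fun t => a * psi t + chi t).
Proof.
move=> [pL po] [cL co]; split; first exact: L2ZD.
apply: (@filterS2 _ _ (ae_filter_ringOfSetsType mu) _ _ _ _ po co) => t -> ->.
by rewrite mulrN -opprD.
Qed.

Lemma Ho_0 : Ho (fun=> 0 : R[i]).
Proof. by split; [exact: L2_0|apply: aeW => t; rewrite oppr0]. Qed.

Lemma Ho_Z (a : R[i]) psi : Ho psi -> Ho (fun t => a * psi t).
Proof. by move=> h; have := Ho_ZD a h Ho_0; under eq_fun do rewrite addr0. Qed.

Lemma Ho_D psi chi : Ho psi -> Ho chi -> Ho (fun t => psi t + chi t).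
Proof. by move=> h1 h2; have := Ho_ZD 1 h1 h2; under eq_fun do rewrite mul1r. Qed.

Lemma Ho_B psi chi : Ho psi -> Ho chi -> Ho (fun t => psi t - chi t).
Proof. by move=> h1 h2; have := Ho_ZD (-1) h2 h1; under eq_fun do rewrite mulN1r addrC. Qed.

Lemma Ho_phi k : Ho (@phi R k).
Proof. by split; [exact: L2_phi|apply: aeW => t; rewrite phi_odd]. Qed.

Lemma Ho_opB psi : Ho psi -> Ho (opB psi).
Proof.
move=> [pL po]; have [mc [M hM]] := @bm_cos1 R.
split.
  have := L2Z (- 'i%C) (L2_bmul mc hM pL).
  by under eq_fun do rewrite mulrA.
apply: (@filterS _ _ (ae_filter_ringOfSetsType mu) _ _ _ po) => t pt.
by rewrite /opB cosN pt mulrN.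
Qed.

Lemma inner_phi j k : inner (@phi R j) (phi k) = ((j == k) && (0 < j))%N%:R.
Proof.
have sp0 : Num.sqrt pi != 0 :> R by rewrite sqrtr_eq0 -ltNge pi_gt0.
have spp : Num.sqrt pi ^+ 2 = pi :> R by rewrite sqr_sqrtr // ltW // pi_gt0.
have red : inner (@phi R j) (phi k) = (\int[mu]_t (sin (j%:R * t) * sin (k%:R * t)) / pi)%:C.
  rewrite innerE; apply: cplxP => /=; last first.
    rewrite (_ : (fun t => _) = (fun=> 0)); last by apply/funext => t; ring.
    by rewrite Rintegral_cst // mul0r.
  rewrite [RHS]mulrC -RintegralZl //; last by apply: bm_integrable; apply: bmM; apply: bm_sinM.
  by apply: eq_Rintegral => t _; rewrite -[in RHS]spp; field.
rewrite red; case: eqVneq => [<-|jk] /=; last first.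
  have jk2 : (j%:R ^+ 2 - k%:R ^+ 2 != 0 :> R).
    by rewrite subr_eq0 eqrXn2 ?ler0n // eqr_nat.
  suff -> : \int[mu]_t (sin (j%:R * t) * sin (k%:R * t)) = 0 by rewrite mul0r.
  have := @torus_FTC R (fun t => (j%:R ^+ 2 - k%:R ^+ 2)^-1 * (k%:R * (sin (j%:R * t) * cos (k%:R * t)) -
       j%:R * (cos (j%:R * t) * sin (k%:R * t)))) (fun t => sin (j%:R * t) * sin (k%:R * t)) 1.
  rewrite !mulrN !sinN !sin_natpi !oppr0 !mul0r !mulr0 subr0 mulr0 subrr; apply.
  - move=> t; apply: is_derive_eq.
    rewrite /GRing.scale /=; field; exact: jk2.
  - by move=> t; apply: cvgM; apply: continuous_comp; [apply: cvgMr; exact: cvg_id|exact: continuous_sin|apply: cvgMr; exact: cvg_id|exact: continuous_sin].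
  - by move=> t; rewrite normrM; apply: mulr_ile1; rewrite ?sin_max.
case: j {red} => [|j] /=.
  by under eq_Rintegral do rewrite mul0r sin0 mul0r; rewrite Rintegral_cst // !mul0r.
have := @torus_FTC R (fun t => 2^-1 * t - (2 * j.+1%:R)^-1 * (sin (j.+1%:R * t) * cos (j.+1%:R * t)))
  (fun t => sin (j.+1%:R * t) * sin (j.+1%:R * t)) 1.
rewrite !mulrN !sinN !sin_natpi !oppr0 !mul0r !mulr0 !subr0 opprK -mulrDr => E.
suff -> : \int[mu]_t (sin (j.+1%:R * t) * sin (j.+1%:R * t)) = 2^-1 * (pi + pi).
  have -> : 2^-1 * (pi + pi) / pi = 1 :> R.
    have p0 : pi != 0 :> R by rewrite gt_eqF // pi_gt0.
    have -> : pi + pi = 2 * pi :> R by ring.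
    by rewrite mulKf ?pnatr_eq0 // divff.
  by [].
apply: E.
- move=> t; apply: is_derive_eq.
  have := cos2Dsin2 (j.+1%:R * t); rewrite /GRing.scale /= !expr2 => h.
  have n0 : j.+1%:R != 0 :> R by rewrite pnatr_eq0.
  set s := sin _ in h *; set c := cos _ in h *.
  have -> : s * s = (1 - (c * c - s * s)) / 2 by lra.
  by field; rewrite ?natr1 ?nat1r ?n0 ?pnatr_eq0.
- by move=> t; apply: cvgM; apply: continuous_comp; [apply: cvgMr; exact: cvg_id|exact: continuous_sin|apply: cvgMr; exact: cvg_id|exact: continuous_sin].
- by move=> t; rewrite normrM; apply: mulr_ile1; rewrite ?sin_max.
Qed.

(* Indexed by the mode number: [phi 0 = 0], so that the entry at 0 is always 0. *)
Definition coef psi k := inner (phi k) psi.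

Lemma coef0 psi : coef psi 0 = 0.
Proof.
rewrite /coef phi0E innerE /=; apply: cplxP => /=.
  by under eq_Rintegral do rewrite !mul0r addr0; rewrite Rintegral_cst // mul0r.
by under eq_Rintegral do rewrite !mul0r subr0; rewrite Rintegral_cst // mul0r.
Qed.

Lemma coefZD (a : R[i]) psi chi k : L2 psi -> L2 chi ->
  coef (fun t => a * psi t + chi t) k = a * coef psi k + coef chi k.
Proof. by move=> h1 h2; apply: innerZD => //; apply: L2_phi. Qed.

Lemma coefB psi chi k : L2 psi -> L2 chi ->
  coef (fun t => psi t - chi t) k = coef psi k - coef chi k.
Proof. by move=> h1 h2; apply: innerBr => //; apply: L2_phi. Qed.

Lemma cos_phi k (t : T) : (cos t)%:C * phi k.+1 t = (2^-1)%:C * (phi k.+2 t + phi k t).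
Proof.
rewrite /phi -!rmorphD -!rmorphM /=; congr (_%:C).
have -> : k.+2%:R * t = k.+1%:R * t + t by rewrite -[k.+2]addn1 natrD; ring.
have -> : k%:R * t = k.+1%:R * t - t by rewrite -[k.+1]addn1 natrD; ring.
by rewrite sinD sinB; field; rewrite sqrtr_eq0 -ltNge pi_gt0.
Qed.

Lemma coef_opB psi k : L2 psi -> coef (opB psi) k = tri bco (coef psi) k.
Proof.
move=> pL; case: k => [|k]; first by rewrite coef0.
have [mc [M hM]] := @bm_cos1 R; have cL := L2_bmul mc hM pL.
rewrite /coef (_ : opB psi = (fun t => - 'i%C * ((cos t)%:C * psi t))); last first.
  by apply/funext => t; rewrite /opB mulrA.
rewrite innerZr //; last exact: L2_phi.
have -> : inner (phi k.+1) (fun t => (cos t)%:C * psi t) =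
    inner (fun t => (2^-1)%:C * (phi k.+2 t + phi k t)) psi.
  rewrite /inner; congr (_ +i* _); apply: eq_Rintegral => t _;
  by rewrite -cos_phi !cpxE /=; ring.
rewrite innerZl ?innerDl //; try exact: L2_phi; last by apply: L2D; apply: L2_phi.
have b0 : (bco k)^* * inner (phi k) psi = inner (phi k) psi.
  by case: k => [|k]; [rewrite -/(coef psi 0) coef0 mulr0|rewrite /= rmorph1 mul1r].
rewrite /tri b0 mul1r conj_real mulrA; congr (_ * _).
by apply: cplxP; rewrite /mhi !cpxE /=; ring.
Qed.

Definition fsyn K x : wave R := fun t => \sum_(k < K) x k * phi k t.

Lemma fsynS K x : fsyn K.+1 x = (fun t => x K * phi K t + fsyn K x t).
Proof. by apply/funext => t; rewrite /fsyn big_ord_recr addrC. Qed.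

Lemma Ho_fsyn K x : Ho (fsyn K x).
Proof.
elim: K => [|K IH]; last by rewrite fsynS; apply: Ho_ZD => //; apply: Ho_phi.
rewrite (_ : fsyn 0 x = fun=> 0); first exact: Ho_0.
by apply/funext => t; rewrite /fsyn big_ord0.
Qed.

Lemma fsyn_odd K x (t : T) : fsyn K x (- t) = - fsyn K x t.
Proof.
by rewrite /fsyn -sumrN; apply: eq_bigr => k _; rewrite phi_odd mulrN.
Qed.

Lemma coef_fsyn K x k : coef (fsyn K x) k = if (0 < k < K)%N then x k else 0.
Proof.
elim: K => [|K IH].
  rewrite (_ : fsyn 0 x = (fun t => 0 * phi 0 t)); last first.
    by apply/funext => t; rewrite /fsyn big_ord0 mul0r.
  by rewrite /coef innerZr ?mul0r ?andbF //; apply: L2_phi.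
rewrite fsynS coefZD ?IH; [|exact: L2_phi|exact: Ho_L2 (Ho_fsyn _ _)].
rewrite /coef inner_phi ltnS [(k <= K)%N]leq_eqVlt.
case: eqVneq => [->|_] /=; last by rewrite ?mulr0n mulr0 add0r.
by rewrite ltnn andbF addr0 andbT; case: (0 < K)%N; rewrite ?mulr1 ?mulr0.
Qed.

Lemma inner_fsyn K x psi : L2 psi ->
  inner (fsyn K x) psi = \sum_(k < K) (x k)^* * coef psi k.
Proof.
move=> pL; elim: K => [|K IH].
  rewrite big_ord0 (_ : fsyn 0 x = (fun t => 0 * phi 0 t)); last first.
    by apply/funext => t; rewrite /fsyn big_ord0 mul0r.
  by rewrite innerZl ?rmorph0 ?mul0r //; apply: L2_phi.
rewrite big_ord_recr /= fsynS innerDl // ?IH; last 2 first.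
- by apply: L2Z; apply: L2_phi.
- exact: Ho_L2 (Ho_fsyn _ _).
by rewrite innerZl // 1?addrC //; apply: L2_phi.
Qed.

Lemma L2norm_fsyn K x : x 0%N = 0 -> L2norm (fsyn K x) = nrm K x.
Proof.
move=> x0; apply: L2normE; first exact: nrm_ge0.
rewrite inner_fsyn; last exact: Ho_L2 (Ho_fsyn _ _).
rewrite nrm_sqr Re_sum; apply: eq_bigr => k _; rewrite coef_fsyn ltn_ord andbT.
have -> : (if (0 < k)%N then x k else 0) = x k by case: (k : nat) => //=.
by rewrite /sqn !cpxE; ring.
Qed.

(** Cauchy-Schwarz applied to [psi] and its own partial sum bounds the squared norm of the
    coefficients by that norm times [L2norm psi]. *)
Lemma bessel psi : L2 psi -> l2le (coef psi) (L2norm psi).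
Proof.
move=> pL K; have := Re_inner_le (Ho_L2 (Ho_fsyn K (coef psi))) pL.
rewrite inner_fsyn // L2norm_fsyn ?coef0 //.
have -> : complex.Re (\sum_(k < K) (coef psi k)^* * coef psi k) = nrm K (coef psi) ^+ 2.
  by rewrite nrm_sqr Re_sum; apply: eq_bigr => k _; rewrite /sqn !cpxE; ring.
rewrite ger0_norm ?sqr_ge0 // expr2.
have [->|h] := eqVneq (nrm K (coef psi)) 0; first by rewrite L2norm_ge0.
by rewrite ler_pM2l // lt_def h nrm_ge0.
Qed.

Lemma coef_unique psi : Ho psi -> (forall k, coef psi k = 0) -> \forall t \ae mu, psi t = 0.
Proof.
move=> [pL po] h; have [rL iL] := pL.
have sp0 : Num.sqrt pi != 0 :> R by rewrite sqrtr_eq0 -ltNge pi_gt0.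
have hr (k : nat) : \int[mu]_t (complex.Re (psi t) * sin (k%:R * t)) = 0.
  have := congr1 (@complex.Re R) (h k); rewrite /coef innerE /= => h1.
  have -> : \int[mu]_t (complex.Re (psi t) * sin (k%:R * t)) = \int[mu]_t (Num.sqrt pi *
     (sin (k%:R * t) / Num.sqrt pi * complex.Re (psi t) + 0 * complex.Im (psi t))).
    by apply: eq_Rintegral => t _; field.
  rewrite RintegralZl // ?h1 ?mulr0 //.
  rewrite [X in EFin \o X](_ : _ = (fun t => complex.Re (Num.conj (phi k t) * psi t))).
    exact: (inner_integrable (L2_phi k) pL).1.
  by apply/funext => t; rewrite !cpxE /=; ring.
have hi (k : nat) : \int[mu]_t (complex.Im (psi t) * sin (k%:R * t)) = 0.
  have := congr1 (@complex.Im R) (h k); rewrite /coef innerE /= => h1.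
  have -> : \int[mu]_t (complex.Im (psi t) * sin (k%:R * t)) = \int[mu]_t (Num.sqrt pi *
     (sin (k%:R * t) / Num.sqrt pi * complex.Im (psi t) - 0 * complex.Re (psi t))).
    by apply: eq_Rintegral => t _; field.
  rewrite RintegralZl // ?h1 ?mulr0 //.
  rewrite [X in EFin \o X](_ : _ = (fun t => complex.Im (Num.conj (phi k t) * psi t))).
    exact: (inner_integrable (L2_phi k) pL).2.
  by apply/funext => t; rewrite !cpxE /=; ring.
have ro : \forall t \ae mu, complex.Re (psi (- t)) = - complex.Re (psi t).
  by apply: (@filterS _ _ (ae_filter_ringOfSetsType mu) _ _ _ po) => t ->; rewrite ReN.
have io : \forall t \ae mu, complex.Im (psi (- t)) = - complex.Im (psi t).
  by apply: (@filterS _ _ (ae_filter_ringOfSetsType mu) _ _ _ po) => t ->; rewrite ImN.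
have r0 := odd_fourier_unique (L2r_integrable rL) ro hr.
have i0 := odd_fourier_unique (L2r_integrable iL) io hi.
by apply: (@filterS2 _ _ (ae_filter_ringOfSetsType mu) _ _ _ _ r0 i0) => t a b; apply: cplxP.
Qed.

Lemma fsynB K x y : fsyn K (fun k => x k - y k) = (fun t => fsyn K x t - fsyn K y t).
Proof.
by apply/funext => t; rewrite /fsyn -sumrB; apply: eq_bigr => k _; rewrite mulrBl.
Qed.

Lemma fsyn_supp K L x : (K <= L)%N -> (forall k, (K <= k)%N -> x k = 0) -> fsyn L x = fsyn K x.
Proof.
move=> KL h; apply/funext => t; rewrite /fsyn.
rewrite -!(big_mkord xpredT (fun k => x k * phi k t)) (big_cat_nat (n := K) (p := L)) //=.
rewrite [X in _ + X]big1_seq ?addr0 // => i /andP[_].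
by rewrite mem_index_iota => /andP[Ki _]; rewrite h // mul0r.
Qed.

(** The Riesz-Fischer theorem for the sine system. Its norm bound, combined with uniqueness of
    coefficients, plays the part of Parseval's identity. *)
Lemma synthesis x : l2 x -> x 0%N = 0 -> exists psi, [/\ Ho psi, forall k, coef psi k = x k &
  forall e, l2le x e -> L2norm psi <= e].
Proof.
move=> lx x0.
(* Partial sums are extracted with tails below 3^-j, whose squares 9^-j meet the rate 8^-j required
   by [riesz_fischer]. *)
have h3 j : 0 < 3^-1 ^+ j :> R by rewrite exprn_gt0 // invr_gt0.
have [N hN] := choice (fun j => l2_tail lx (h3 j)).
have tr0 m : trunc m x 0%N = 0 by rewrite /trunc x0; case: ifP.
pose F j := fsyn (N j) x.
have FE j K : (N j <= K)%N -> F j = fsyn K (trunc (N j) x).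
  move=> NK; rewrite (fsyn_supp NK) => [|k]; last exact: trunc_supp.
  by apply/funext => t; rewrite /F /fsyn; apply: eq_bigr => k _; rewrite /trunc ltn_ord.
have dF i j : (i <= j)%N -> L2norm (fun t => F j t - F i t) <= 3^-1 ^+ i.
  move=> ij; pose K := maxn (N i) (N j).
  rewrite (FE j K) ?leq_maxr // (FE i K) ?leq_maxl // -fsynB L2norm_fsyn ?tr0 ?subrr //.
  have [h|h] := leqP (N i) (N j).
    apply: le_trans (hN i (N i) (leqnn _) K).
    apply: le_nrm; apply: ler_sum => k _; rewrite /trunc.
    case: ifP => h1; case: ifP => h2; rewrite ?subrr ?sqn0 ?sqn_ge0 // ?subr0 //.
    by rewrite (leq_trans h2 h) in h1.
  apply: le_trans (_ : 3^-1 ^+ j <= _); last first.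
    by apply: ler_wiXn2l; rewrite ?invr_ge0 // invf_le1 // ler1n.
  apply: le_trans (hN j (N j) (leqnn _) K).
  apply: le_nrm; apply: ler_sum => k _; rewrite /trunc.
  case: ifP => h1; case: ifP => h2; rewrite ?subrr ?sqn0 ?sqn_ge0 // ?subr0 ?sub0r ?sqnN //.
  by rewrite (leq_trans h1 (ltnW h)) in h2.
have FH j : Ho (F j) by apply: Ho_fsyn.
have [j|i j ij|psi pL hp] := @riesz_fischer R F.
- exact: Ho_L2.
- apply: le_trans (_ : (3^-1 ^+ i) ^+ 2 <= _).
    by rewrite ler_pXn2r ?nnegrE ?L2norm_ge0 ?(ltW (h3 i)) // dF.
  rewrite exprAC; apply: lerXn2r; rewrite ?nnegrE ?exprn_ge0 ?invr_ge0 //.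
  by rewrite exprVn lef_pV2 ?posrE ?exprn_gt0 // -natrX ler_nat.
have cF e : 0 < e -> exists j0, forall j, (j0 <= j)%N -> L2norm (fun t => psi t - F j t) <= e.
  move=> e0; have [j0 hj] := @half_pow_small R 2 (e ^+ 2) (ler0n _ _) (exprn_gt0 2 e0).
  exists j0 => j jj; rewrite -ler_sqr ?nnegrE ?L2norm_ge0 ?(ltW e0) //.
  apply: le_trans (hp j) _; apply: le_trans hj; apply: ler_wpM2l => //.
  apply: le_trans (_ : (2^-1) ^+ j <= _).
    by apply: lerXn2r; rewrite ?nnegrE ?invr_ge0 // lef_pV2 ?posrE // ler_nat.
  by apply: ler_wiXn2l; rewrite ?invr_ge0 // invf_le1 // ler1n.
have FL j : L2 (F j) by apply: Ho_L2.
have mN : measurable_fun setT (-%R : T -> T) by apply: measurable_funN; apply: measurable_id.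
(* The limit is odd because its odd reflection is a limit of the same odd partial sums. *)
pose psi' : wave R := fun t => - psi (- t).
have reflL2 (f : T -> R) : f \in Lfun mu 2%:E -> (fun t => f (- t)) \in Lfun mu 2%:E.
  move=> /L2rP[mf fi]; apply/L2rP; split; first exact: (measurableT_comp mf mN).
  exact: (torus_reflect_integrable fi).
have pL' : L2 psi'.
  have [a b] := pL; split.
    by under eq_fun do rewrite ReN; apply: L2rN; apply: (reflL2 _ a).
  by under eq_fun do rewrite ImN; apply: L2rN; apply: (reflL2 _ b).
have nE j : L2norm (fun t => psi' t - F j t) = L2norm (fun t => psi t - F j t).
  rewrite /L2norm; congr Num.sqrt; rewrite /inner /=.
  rewrite -[RHS](torus_reflect (inner_integrable (L2B pL (FL j)) (L2B pL (FL j))).1).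
  by apply: eq_Rintegral => t _; rewrite /psi' /F fsyn_odd !cpxE; ring.
have Hpsi : Ho psi.
  split => //; have p0 : L2norm (fun t => psi t - psi' t) = 0.
    apply/eqP; rewrite eq_le L2norm_ge0 andbT; apply/ler_addgt0Pr => e e0; rewrite add0r.
    have [j0 hj] := cF _ (divr_gt0 e0 (ltr0n R 2)).
    apply: le_trans (L2norm_triangle pL (FL j0) pL') _.
    rewrite [X in _ + X]L2norm_distC // nE; have := hj _ (leqnn j0); lra.
  have := L2norm_ae (L2B pL pL') p0.
  apply: (@filterS _ _ (ae_filter_ringOfSetsType mu)) => t; rewrite /psi' => /eqP.
  by rewrite subr_eq0 => /eqP ->; rewrite opprK.
exists psi; split => // [k|e lxe].
  case: k => [|k]; first by rewrite coef0 x0.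
  apply/eqP; rewrite -subr_eq0; apply/eqP; apply: cmod_eq0.
  apply/eqP; rewrite eq_le sqrtr_ge0 andbT; apply/ler_addgt0Pr => e e0; rewrite add0r.
  have [j0 hj] := cF _ (divr_gt0 e0 (ltr0n R 2)).
  have [M hM] := l2_tail lx (divr_gt0 e0 (ltr0n R 2)).
  have [j1 [h1 h2]] : exists j, (j0 <= j)%N /\ Num.sqrt (sqn (coef (F j) k.+1 - x k.+1)) <= e / 2.
    have [j1 hj1] := @half_pow_small R 1 (e / 2) ler01 (divr_gt0 e0 (ltr0n R 2)).
    exists (maxn j0 j1); split; first exact: leq_maxl.
    rewrite coef_fsyn /=; case: ifP => h; first by rewrite subrr sqn0 sqrtr0 divr_ge0 // ltW.
    rewrite sub0r sqnN; have := coord_le k.+1 (hN (maxn j0 j1) _ (leqnn _)).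
    rewrite trunc_supp ?subr0; last by rewrite leqNgt h.
    move/le_trans; apply; apply: le_trans hj1; rewrite mul1r.
    apply: le_trans (_ : (2^-1) ^+ maxn j0 j1 <= _).
      by apply: lerXn2r; rewrite ?nnegrE ?invr_ge0 // lef_pV2 ?posrE // ler_nat.
    by apply: ler_wiXn2l; rewrite ?invr_ge0 ?leq_maxr // invf_le1 // ler1n.
  have -> : coef psi k.+1 - x k.+1 =
    (coef psi k.+1 - coef (F j1) k.+1) + (coef (F j1) k.+1 - x k.+1) by ring.
  rewrite [e]splitr; apply: le_trans (cmodD _ _) _; apply: lerD => //.
  rewrite -coefB //; apply: le_trans (hj _ h1).
  by apply: coord_le; apply: bessel; apply: L2B.
apply/ler_addgt0Pr => d d0; have [j0 hj] := cF _ d0.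
have := L2norm_dist_ge pL (FL j0); have := hj j0 (leqnn _).
have : L2norm (F j0) <= e by rewrite /F L2norm_fsyn.
lra.
Qed.

End SineBasis.

(** * Uniqueness and stability for the sequence dynamics *)

Section SequenceUniqueness.
Context {R : realType}.

Lemma small_increments_cst (g : R -> R) a b :
  (forall s e, 0 < e -> exists d, 0 < d /\ forall h, `|h| <= d ->
     `|g (s + h) - g s| <= e * `|h|) -> g a = g b.
Proof.
move=> H; apply: is_derive_0_is_cst => s.
have cv : h^-1 *: ((g \o shift s) (h *: 1) - g s) @[h --> (0 : R)^'] --> (0 : R).
  apply/cvgrPdist_le => e e0; have [d [d0 hd]] := H s e e0.
  apply: filterS2 (_ : \forall h \near (0 : R)^', `|h| <= d) (nbhs_dnbhs_neq (0 : R)) => [h hh h0|].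
    rewrite sub0r normrN /= normrM normfV /GRing.scale /= mulr1 [h + s]addrC.
    by rewrite mulrC ler_pdivrMr ?normr_gt0 // hd.
  by apply: dnbhs0_le.
apply: DeriveDef; first by apply/cvg_ex; exists 0.
exact: cvg_lim cv.
Qed.

Variables (lam : nat -> R) (c : R).
Implicit Types (x y z : nat -> R[i]) (N : nat) (t s : R).
Local Notation gal := (gal lam c).
Local Notation gen := (seq_gen lam c).
Local Notation grp := (grp lam c).

(** The curve [s -> grp (t - s) (z s)] joins [grp t (z 0)] to [z t]. Its increments are those of [z]
    minus those of the exact flow, transported by a contraction, so its derivative vanishes. *)
Lemma grp_unique (z dz : R -> nat -> R[i]) t :
  (forall s, l2 (z s)) -> (forall s, l2 (dz s)) -> (forall s k, dz s k = gen (z s) k) ->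
  (forall s e, 0 < e -> exists d, 0 < d /\ forall h, `|h| <= d ->
     l2le (fun k => z (s + h) k - z s k - h%:C * dz s k) (e * `|h|)) ->
  z t = grp t (z 0).
Proof.
move=> lz ldz dzE zd; pose f s := grp (t - s) (z s).
have fd s e : 0 < e -> exists d, 0 < d /\ forall h, `|h| <= d ->
    l2le (fun k => f (s + h) k - f s k) (e * `|h|).
  move=> e0; have e2 : 0 < e / 2 by rewrite divr_gt0.
  have [d1 [d10 h1]] := zd s _ e2.
  have [d2 [d20 h2]] := grp_generator (lz s) (ldz s) (dzE s) e2.
  exists (Num.min d1 d2); split; first by rewrite lt_min d10.
  move=> h; rewrite le_min => /andP[/h1 g1 /h2 g2].
  have -> : f s = grp (t - (s + h)) (grp h (z s)).
    apply: etrans _ (grp_add lam c (t - (s + h)) h (lz s)).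
    by congr (grp _ (z s)); rewrite opprD addrA subrK.
  rewrite /f -grpB //; last exact: grp_l2.
  apply: grp_le; have -> : e * `|h| = e / 2 * `|h| + e / 2 * `|h| by field.
  have := l2leB g1 g2; congr l2le; apply/funext => k; ring.
have hk k : f t k = f 0 k.
  apply: cplxP.
    apply: (@small_increments_cst (fun s => complex.Re (f s k))) => s e e0.
    have [d [d0 hd]] := fd s e e0; exists d; split => // h /hd /(coord_le k).
    apply: le_trans; rewrite -sqrtr_sqr; apply: ler_wsqrtr; rewrite /sqn !cpxE.
    by rewrite lerDl sqr_ge0.
  apply: (@small_increments_cst (fun s => complex.Im (f s k))) => s e e0.
  have [d [d0 hd]] := fd s e e0; exists d; split => // h /hd /(coord_le k).
  apply: le_trans; rewrite -sqrtr_sqr; apply: ler_wsqrtr; rewrite /sqn !cpxE.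
  by rewrite lerDr sqr_ge0.
by have := funext hk; rewrite /f subrr subr0 grp0.
Qed.

Lemma gal_grp_le N0 t x w e : l2 x ->
  (forall N, (N0 <= N)%N -> nrm N (fun k => w k - gal N t x k) <= e) ->
  l2le (fun k => w k - grp t x k) e.
Proof.
move=> lx h K; apply/ler_addgt0Pr => d d0; have [N1 h1] := grp_cvg lam c t lx d0.
pose N := maxn (maxn N0 N1) K.
have N0N : (N0 <= N)%N by rewrite /N !leq_max leqnn.
have N1N : (N1 <= N)%N by rewrite /N !leq_max leqnn !orbT.
apply: le_trans (nrm_triangle K (gal N t x) _ _) _; apply: lerD; last exact: h1.
by apply: le_trans (h N N0N); apply: nrm_mono; rewrite /N leq_maxr.
Qed.

(** The limit of [gal_duhamel]: the finitely supported curve [z] is an approximate solution of every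
    truncation beyond [J], with the same residual bound. *)
Lemma grp_duhamel J (z r : R -> nat -> R[i]) e t : 0 <= e ->
  (forall s k, (J <= k)%N -> z s k = 0) ->
  (forall s k, cderive (z^~ k) s (gen (z s) k + r s k)) ->
  (forall s, `|s| <= `|t| -> l2le (r s) e) ->
  l2le (fun k => z t k - grp t (z 0) k) (e * `|t|).
Proof.
move=> e0 zs zd re.
have lz : l2 (z 0).
  exists (nrm J (z 0)); apply: (@l2le_from _ J) => K JK; rewrite (@nrm_supp _ J K) // => k; exact: zs.
apply: (@gal_grp_le J) => // N JN; apply: (gal_duhamel (r := r)) => //.
- by move=> s k Nk; apply: zs; apply: leq_trans Nk.
- by move=> s /re; apply.
Qed.

(** Mode 0 is linked to no other mode, and its equation only turns its phase. *)
Lemma grp_coord0 t x : l2 x -> x 0%N = 0 -> grp t x 0%N = 0.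
Proof.
move=> lx x0; apply: cmod_eq0; apply/eqP; rewrite eq_le sqrtr_ge0 andbT.
apply/ler_addgt0Pr => e e0; have [N0 h0] := grp_cvg lam c t lx e0.
pose N := N0.+1; have /(coord_le 0) := h0 N (leqnSn _).
have [gs gd] := gal_solves lam c N x.
have := @energy _ 1 (fun k s => gal N s x k) (fun k s => gen (gal N s x) k) 0 t (lexx _).
rewrite mul0r addr0.
have -> : nrm 1 (fun k => gal N t x k) = Num.sqrt (sqn (gal N t x 0%N)).
  by rewrite /nrm big_ord1.
have -> : nrm 1 (fun k => gal N 0 x k) = 0.
  by rewrite /nrm big_ord1 gal0 /trunc /= x0 sqn0 sqrtr0.
move=> H; have {H} h : Num.sqrt (sqn (gal N t x 0%N)) <= 0.
  apply: H => [k s k1 _|s _]; first by apply: gd; rewrite (leq_trans k1).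
  rewrite big_ord1 mul0r /seq_gen /= !cpxE /= ?ReC ?ImC.
  rewrite [X in `|X|](_ : _ = 0) ?normr0 //; ring.
have /eqP : Num.sqrt (sqn (gal N t x 0%N)) = 0 by apply/eqP; rewrite eq_le h sqrtr_ge0.
move=> /eqP /cmod_eq0 ->; rewrite sub0r sqnN add0r; exact.
Qed.

End SequenceUniqueness.

Fixpoint flow {R : realType} (lam : nat -> R) (l : seq (R * R)) (x : nat -> R[i]) : nat -> R[i] :=
  if l is (s, c) :: l' then flow lam l' (grp lam c s x) else x.

(** * Existence and identification of the unitary group on waves *)

Section UnitaryGroup.
Context {R : realType}.
Local Notation mu := (torus R).
Implicit Types psi chi : wave R.

Lemma coef_ext psi chi : Ho psi -> Ho chi -> (forall k, coef psi k = coef chi k) ->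
  \forall t \ae mu, psi t = chi t.
Proof.
move=> hp hc h; have := coef_unique (Ho_B hp hc).
move=> /(_ _) H; have {}H : \forall t \ae mu, psi t - chi t = 0.
  by apply: H => k; rewrite coefB ?h ?subrr //; apply: Ho_L2.
apply: (@filterS _ _ (ae_filter_ringOfSetsType mu)) H => t /eqP.
by rewrite subr_eq0 => /eqP.
Qed.

Lemma ae_eqTI psi chi : (\forall t \ae mu, psi t = chi t) -> psi = chi %[ae mu].
Proof. by apply: (@filterS _ _ (ae_filter_ringOfSetsType mu)) => x -> _. Qed.

Lemma ae_eqTE psi chi : psi = chi %[ae mu] -> \forall t \ae mu, psi t = chi t.
Proof. by apply: (@filterS _ _ (ae_filter_ringOfSetsType mu)) => x; apply. Qed.

Lemma L2_opB psi : L2 psi -> L2 (opB psi).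
Proof.
move=> hp; have [mc [M hM]] := @bm_cos1 R.
have := L2Z (- 'i%C) (L2_bmul mc hM hp).
by under eq_fun do rewrite mulrA.
Qed.

Lemma coef_l2 psi : Ho psi -> l2 (coef psi).
Proof. by move=> h; exists (L2norm psi); apply: bessel; apply: Ho_L2. Qed.

(** The function synthesised from the coefficients of [psi] obeys the norm bound and equals [psi]
    almost everywhere by uniqueness. *)
Lemma parseval_le psi e : Ho psi -> l2le (coef psi) e -> L2norm psi <= e.
Proof.
move=> hp he; have [chi [hc cE /(_ e he)]] := synthesis (coef_l2 hp) (coef0 psi).
rewrite (ae_L2norm_eq (Ho_L2 hp) (Ho_L2 hc)) //; apply: coef_ext => // k.
Qed.

Lemma parsevalB_le psi chi e : Ho psi -> Ho chi ->
  l2le (fun k => coef psi k - coef chi k) e <-> L2norm (fun t => psi t - chi t) <= e.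
Proof.
move=> hp hc; split=> h.
  apply: parseval_le; first exact: Ho_B.
  by move=> K; rewrite -(@eq_nrm _ _ (fun k => coef psi k - coef chi k)) // => k _;
    rewrite coefB //; apply: Ho_L2.
move=> K; rewrite (@eq_nrm _ _ _ (coef (fun t => psi t - chi t))).
  by apply: le_trans h; apply: bessel; apply: Ho_L2; apply: Ho_B.
by move=> k _; rewrite coefB //; apply: Ho_L2.
Qed.

(** Polarisation: expanding the squared norm of [a * psi + chi] isolates the real part of the inner
    product for [a = 1] and the imaginary part for [a = i]. *)
Lemma inner_of_norm psi chi psi' chi' : L2 psi -> L2 chi -> L2 psi' -> L2 chi' ->
  (forall a : R[i], L2norm (fun t => a * psi t + chi t) = L2norm (fun t => a * psi' t + chi' t)) ->
  L2norm psi = L2norm psi' -> inner psi chi = inner psi' chi'.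
Proof.
move=> hp hc hp' hc' H Hp.
have E (a : R[i]) (f g : wave R) : L2 f -> L2 g -> L2norm (fun t => a * f t + g t) ^+ 2 =
    sqn a * L2norm f ^+ 2 + 2 * complex.Re (a^* * inner f g) + L2norm g ^+ 2.
  move=> hf hg; have hs := L2ZD a hf hg; have hz := L2Z a hf.
  pose z : wave R := fun t => a * f t; rewrite L2norm_sqr.
  have -> : inner (fun t => a * f t + g t) (fun t => a * f t + g t) =
      inner z z + inner z g + (inner g z + inner g g).
    exact: etrans (innerDl hs hz hg) (congr2 +%R (innerDr hz hz hg) (innerDr hg hz hg)).
  rewrite !ReD (Re_innerC hz hg) -(L2norm_sqr z) -(L2norm_sqr g) (innerZl a hg hf).
  rewrite (L2normZ a hf) exprMn.
  by rewrite sqr_sqrtr ?sqn_ge0 //; ring.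
have H0 : L2norm chi ^+ 2 = L2norm chi' ^+ 2.
  have := congr1 (fun r => r ^+ 2) (H 0).
  rewrite (E _ _ _ hp hc) (E _ _ _ hp' hc') sqn0 conjC0 !mul0r (ReC 0) mulr0 !add0r; exact.
have H1 (a : R[i]) : complex.Re (a^* * inner psi chi) = complex.Re (a^* * inner psi' chi').
  have := congr1 (fun r => r ^+ 2) (H a).
  rewrite (E _ _ _ hp hc) (E _ _ _ hp' hc') H0 Hp => /addIr /addrI /mulfI; apply.
  by rewrite pnatr_eq0.
apply: cplxP; first by have := H1 1; rewrite conjC1 (mul1r (inner psi chi)) (mul1r (inner psi' chi')).
by have := H1 'i%C; rewrite !cpxE /= !mul0r !sub0r !mulN1r !opprK.
Qed.

Variables (lam : nat -> R) (c : R).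
Local Notation gen := (seq_gen lam c).
Local Notation grp := (grp lam c).

Definition diag_graph psi chi := [/\ Ho psi, Ho chi & forall k, (0 < k)%N ->
  coef chi k = gen (coef psi) k].

Definition wgrp t psi : wave R :=
  xget (fun=> 0) [set chi | Ho chi /\ forall k, coef chi k = grp t (coef psi) k].

Lemma wgrpP t psi : Ho psi -> Ho (wgrp t psi) /\ coef (wgrp t psi) = grp t (coef psi).
Proof.
move=> hp; have lp := coef_l2 hp.
have [chi [hc cE _]] := synthesis (grp_l2 lam c t lp) (grp_coord0 lam c t lp (coef0 _)).
rewrite /wgrp; case: xgetP => [w _ [hw wE]|/(_ chi)]; last by case.
by split => //; apply/funext.
Qed.

Lemma coef_fun_ZD (a : R[i]) psi chi : L2 psi -> L2 chi ->
  coef (fun t => a * psi t + chi t) = (fun k => a * coef psi k + coef chi k).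
Proof. by move=> hp hc; apply/funext => k; apply: coefZD. Qed.

(** The flow and its inverse, the flow at time [- t], are both contractions. *)
Lemma L2norm_wgrp t psi : Ho psi -> L2norm (wgrp t psi) = L2norm psi.
Proof.
move=> hp; have [hw wE] := wgrpP t hp; apply/eqP; rewrite eq_le; apply/andP; split.
  by apply: parseval_le => //; rewrite wE; apply: grp_le; apply: bessel; apply: Ho_L2.
apply: parseval_le => //; rewrite -[coef psi](grp0 lam c); last exact: coef_l2.
rewrite -(addNr t) grp_add; last exact: coef_l2.
by apply: grp_le; rewrite -wE; apply: bessel; apply: Ho_L2.
Qed.

Lemma wgrpZD t (a : R[i]) psi chi : Ho psi -> Ho chi ->
  \forall s \ae mu, wgrp t (fun s => a * psi s + chi s) s = a * wgrp t psi s + wgrp t chi s.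
Proof.
move=> hp hc; have [hw wE] := wgrpP t hp; have [hw' wE'] := wgrpP t hc.
have [hw2 wE2] := wgrpP t (Ho_ZD a hp hc).
apply: coef_ext => // [|k]; first exact: Ho_ZD.
rewrite wE2 coef_fun_ZD ?coefZD; try exact: Ho_L2.
by rewrite (grpZD lam c t a (coef_l2 hp) (coef_l2 hc)) -wE -wE'.
Qed.

(** On the domain, [grp_generator] gives the limit. Conversely, convergence in norm forces
    convergence of each coefficient, whose limit is known from [grp_coord_derivative]; so the
    generator is the maximal operator. *)
Lemma wgrp_generator psi chi : diag_graph psi chi <->
  Ho psi /\ Ho chi /\ L2norm (fun x => (t^-1)%:C * (wgrp t psi x - psi x) - chi x)
           @[t --> (0 : R)^'] --> (0 : R).
Proof.
have key psi' chi' t : t != 0 -> Ho psi' -> Ho chi' ->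
    let f := (fun x => (t^-1)%:C * (wgrp t psi' x - psi' x) - chi' x) in
    Ho f /\ forall k, t%:C * coef f k = grp t (coef psi') k - coef psi' k - t%:C * coef chi' k.
  move=> t0 hp hc f; have [hw wE] := wgrpP t hp.
  have hd := Ho_B hw hp; split; first by apply: Ho_B => //; apply: Ho_Z.
  move=> k; rewrite /f coefB ?wE; try by apply: Ho_L2 => //; apply: Ho_Z.
  have -> : coef (fun t0 => (t^-1)%:C * (wgrp t psi' t0 - psi' t0)) k =
      (t^-1)%:C * coef (fun t0 => wgrp t psi' t0 - psi' t0) k.
    by apply: innerZr; [apply: L2_phi|apply: Ho_L2].
  rewrite coefB ?wE; try exact: Ho_L2.
  rewrite mulrBr mulrA -rmorphM mulfV // rmorph1 mul1r //.
split=> [[hp hc hg]|[hp [hc hl]]]; last first.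
  split => // k k0; have lp := coef_l2 hp.
  apply/eqP; rewrite -subr_eq0; apply/eqP; apply: cmod_eq0.
  apply/eqP; rewrite eq_le sqrtr_ge0 andbT; apply/ler_addgt0Pr => e e0; rewrite add0r.
  have e2 : 0 < e / 2 by rewrite divr_gt0.
  have [d [d0 hd]] := grp_coord_derivative lam c k lp e2.
  move: hl => /cvgrPdist_le /(_ _ e2) hn.
  have hdn : \forall h \near (0 : R)^', `|h| <= d by apply: dnbhs0_le.
  have [t [[t1 t0] t2]] := filter_ex (filterI (filterI hdn (nbhs_dnbhs_neq (0 : R))) hn).
  have [hf fE] := key _ _ _ t0 hp hc.
  move: t2; rewrite sub0r normrN ger0_norm ?L2norm_ge0 // => t2.
  have := hd t t1; have := coord_le k (bessel (Ho_L2 hf)) => h1 h2.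
  have tp : 0 < `|t| by rewrite normr_gt0.
  rewrite -(ler_pM2l tp) -cmod_real -cmodM.
  have -> : t%:C * (coef chi k - gen (coef psi) k) =
     (grp t (coef psi) k - coef psi k - t%:C * gen (coef psi) k) +
     - (t%:C * coef (fun x => (t^-1)%:C * (wgrp t psi x - psi x) - chi x) k).
    by rewrite fE; ring.
  apply: le_trans (cmodD _ _) _; rewrite sqnN cmodM cmod_real.
  apply: le_trans (lerD h2 (ler_wpM2l (ltW tp) (le_trans h1 t2))) _.
  by rewrite (_ : _ + _ = `|t| * e) //; field.
split => //; split => //; apply/cvgrPdist_le => e e0.
have lp := coef_l2 hp; have lc := coef_l2 hc.
have hg' k : coef chi k = gen (coef psi) k.
  case: k => [|k]; last exact: hg.
  by rewrite /seq_gen !coef0 /= !mulr0 addr0.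
have [d [d0 hd]] := grp_generator lp lc hg' e0.
apply: filterS2 (_ : \forall h \near (0 : R)^', `|h| <= d) (nbhs_dnbhs_neq (0 : R)) => [t td t0|].
  have [hf fE] := key _ _ _ t0 hp hc.
  rewrite sub0r normrN ger0_norm ?L2norm_ge0 //; apply: parseval_le => // K.
  have tp : 0 < `|t| by rewrite normr_gt0.
  rewrite -(ler_pM2l tp) -nrmZr [leRHS]mulrC; apply: le_trans (hd _ td K).
  by rewrite (@eq_nrm _ _ _ _ (fun k _ => fE k)).
by apply: dnbhs0_le.
Qed.

(** This existence result ensures that [exp_op] picks a genuine group instead of the default value
    of [xget]. *)
Lemma unitary_wgrp (G : wave R -> wave R -> Prop) : (forall psi chi, G psi chi <-> diag_graph psi chi) ->
  unitary_group G wgrp.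
Proof.
move=> GE; split.
- by move=> t psi /(wgrpP t) [].
- split; first by move=> t a psi chi hp hc; by apply: ae_eqTI; apply: wgrpZD.
  move=> t psi chi hp hc; have [hw wE] := wgrpP t hp; have [hw' wE'] := wgrpP t hc.
  apply: inner_of_norm; try exact: Ho_L2; last exact: L2norm_wgrp.
  move=> a; rewrite -(L2norm_wgrp t (Ho_ZD a hp hc)); symmetry; apply: ae_L2norm_eq.
  + by apply: Ho_L2; have [] := wgrpP t (Ho_ZD a hp hc).
  + by apply: Ho_L2; apply: Ho_ZD.
  + exact: wgrpZD.
- split=> [psi hp|s t psi hp].
    have [hw wE] := wgrpP 0 hp; apply: ae_eqTI; apply: coef_ext => // k.
    by have := congr1 (@^~ k) wE; rewrite (grp0 lam c (coef_l2 hp)).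
  have [hw wE] := wgrpP t hp; have [hw1 wE1] := wgrpP s hw; have [hw2 wE2] := wgrpP (s + t) hp.
  have E : coef (wgrp (s + t) psi) = coef (wgrp s (wgrp t psi)).
    apply: etrans wE2 (etrans (grp_add lam c s t (coef_l2 hp)) _).
    by apply: etrans (congr1 (grp s) (esym wE)) (esym wE1).
  exact: (ae_eqTI (coef_ext hw2 hw1 (fun k => congr1 (@^~ k) E))).
- move=> psi hp; apply/cvgrPdist_le => e e0.
  have [d [d0 hd]] := grp_continuous lam c (coef_l2 hp) e0.
  apply: filterS (_ : \forall h \near (0 : R), `|h| <= d) => [t /hd h|].
    have [hw wE] := wgrpP t hp.
    rewrite sub0r normrN ger0_norm ?L2norm_ge0 //; apply/(parsevalB_le _ hw hp).
    by rewrite wE.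
  by apply: nbhs0_le.
- move=> psi chi hp hc; split=> [/GE/wgrp_generator[_ []] //|h].
  by apply/GE; apply/wgrp_generator.
Qed.

(** On the domain of the generator the coefficients solve the sequence equation, and [grp_unique]
    identifies them; density of the domain and isometry extend this to every state. *)
Lemma unitary_group_coef (G : wave R -> wave R -> Prop) U : (forall psi chi, G psi chi <-> diag_graph psi chi) ->
  unitary_group G U -> forall t psi, Ho psi -> coef (U t psi) = grp t (coef psi).
Proof.
move=> GE [UHo [UZD Uin] [U0 Uadd] Ucont Ugen].
have nU t psi : Ho psi -> L2norm (U t psi) = L2norm psi.
  by move=> hp; rewrite /L2norm Uin.
have UB t psi chi : Ho psi -> Ho chi ->
    L2norm (fun x => U t psi x - U t chi x) = L2norm (fun x => psi x - chi x).
  move=> hp hc; rewrite -(nU t (fun x => psi x - chi x)); last exact: Ho_B.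
  apply: ae_L2norm_eq; try (by apply: Ho_L2; [apply: Ho_B => //; apply: UHo]).
    by apply: Ho_L2; apply: UHo; apply: Ho_B.
  have := UZD t (-1) chi psi hc hp.
  have -> : (fun x => -1 * chi x + psi x) = (fun x => psi x - chi x).
    by apply/funext => x; rewrite mulN1r addrC.
  apply: (@filterS _ _ (ae_filter_ringOfSetsType mu)) => x /(_ Logic.I) ->; by rewrite mulN1r addrC.
have cU t (a : R[i]) psi chi k : Ho psi -> Ho chi ->
    coef (U t (fun x => a * psi x + chi x)) k = a * coef (U t psi) k + coef (U t chi) k.
  move=> hp hc; rewrite -coefZD; try by apply: Ho_L2; apply: UHo.
  have h1 : L2 (U t (fun x => a * psi x + chi x)).
    by apply: Ho_L2; apply: UHo; apply: Ho_ZD.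
  have h2 : L2 (fun x => a * U t psi x + U t chi x).
    by apply: Ho_L2; apply: Ho_ZD; apply: UHo.
  by apply: (ae_inner (L2_phi k) (L2_phi k) h1 h2); [exact: aeW|apply: ae_eqTE; exact: UZD].
have cadd s t psi k : Ho psi -> coef (U (s + t) psi) k = coef (U s (U t psi)) k.
  move=> hp; have h1 : L2 (U (s + t) psi) by apply: Ho_L2; apply: UHo.
  have h2 : L2 (U s (U t psi)) by apply: Ho_L2 (UHo s _ (UHo t _ hp)).
  by apply: (ae_inner (L2_phi k) (L2_phi k) h1 h2); [exact: aeW|apply: ae_eqTE; exact: Uadd].
(* The difference quotient at time [t] is the image under the isometry [U t] of the one at time
   0. *)
have dom t psi chi : G psi chi -> forall e, 0 < e -> exists d, 0 < d /\ forall h, `|h| <= d ->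
    l2le (fun k => coef (U (t + h) psi) k - coef (U t psi) k - h%:C * coef (U t chi) k) (e * `|h|).
  move=> gp; have /GE[hp hc _] := gp.
  move/(Ugen _ _ hp hc)/cvgrPdist_le : gp => hl e e0.
  have := hl e e0; rewrite near_withinE => /nbhs_ballP[d /= d0 hd].
  exists (d / 2); split; first by rewrite divr_gt0.
  move=> h hh; have [->|h0] := eqVneq h 0.
    rewrite normr0 mulr0 => K; rewrite (@eq_nrm _ _ _ (fun=> 0)) ?nrm0 // => k _.
    by rewrite addr0 subrr rmorph0 mul0r subr0.
  have hd2 : ball 0 d h.
    rewrite /ball /= sub0r normrN; apply: le_lt_trans hh _; rewrite gtr_pMr //.
    by rewrite invf_lt1 // ltr1n.
  have := hd h hd2 h0; rewrite sub0r normrN ger0_norm ?L2norm_ge0 //.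
  set F := (fun x => _); move=> hF; have hU := UHo h psi hp.
  have HF : Ho F by apply: Ho_B => //; apply: Ho_Z; apply: Ho_B.
  pose D := (fun x => (- h%:C) * chi x + ((-1) * psi x + U h psi x)).
  have HD : Ho D by apply: Ho_ZD => //; apply: Ho_ZD.
  have : L2norm (U t D) <= e * `|h|.
    rewrite nU // (_ : D = (fun x => h%:C * F x)); last first.
      apply/funext => x; rewrite /D /F mulrBr mulrA -rmorphM mulfV // rmorph1.
      by rewrite mul1r; ring.
    by rewrite (L2normZr h (Ho_L2 HF)) [leRHS]mulrC; apply: (ler_wpM2l (normr_ge0 h) hF).
  have HUD := UHo t D HD.
  move=> hD K; apply: le_trans hD; apply: le_trans (bessel (Ho_L2 HUD) K).
  rewrite le_eqVlt; apply/orP; left; apply/eqP; apply: eq_nrm => k _.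
  have h1 : Ho (fun x => -1 * psi x + U h psi x) by exact: Ho_ZD.
  rewrite (cU _ _ _ _ _ hc h1) (cU _ _ _ _ _ hp hU) -(cadd _ _ _ _ hp); ring.
(* The domain is invariant and the generator commutes with the group, so the equation holds at every
   time. *)
have dom2 t psi chi : G psi chi -> G (U t psi) (U t chi).
  move=> gp; have /GE[hp hc _] := gp; have hU := UHo t psi hp; have hV := UHo t chi hc.
  apply/(Ugen _ _ hU hV)/cvgrPdist_le => e e0.
  have [d [d0 hd]] := dom t psi chi gp e e0.
  apply: filterS2 (_ : \forall h \near (0 : R)^', `|h| <= d) (nbhs_dnbhs_neq (0 : R)) => [h hh h0|].
    have hW := UHo h _ hU; have hB := Ho_B hW hU.
    have hZ := Ho_Z (h^-1)%:C hB.
    rewrite sub0r normrN ger0_norm ?L2norm_ge0 //; apply: parseval_le; first exact: Ho_B.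
    move=> K; have tp : 0 < `|h| by rewrite normr_gt0.
    rewrite -(ler_pM2l tp) -nrmZr [leRHS]mulrC; apply: le_trans (hd _ hh K).
    rewrite le_eqVlt; apply/orP; left; apply/eqP; apply: eq_nrm => k _.
    rewrite coefB; try exact: Ho_L2.
    have -> : coef (fun x => (h^-1)%:C * (U h (U t psi) x - U t psi x)) k =
       (h^-1)%:C * coef (fun x => U h (U t psi) x - U t psi x) k.
      by apply: innerZr; [apply: L2_phi|apply: Ho_L2].
    rewrite coefB; try exact: Ho_L2.
    by rewrite -(cadd _ _ _ _ hp) [h + t]addrC mulrBr mulrA -rmorphM mulfV // rmorph1 mul1r.
  by apply: dnbhs0_le.
have domE t psi chi : G psi chi -> coef (U t psi) = grp t (coef psi).
  move=> gp; have /GE[hp hc _] := gp.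
  rewrite (_ : coef psi = coef (U 0 psi)); last first.
    apply/funext => k; have h1 : L2 (U 0 psi) by apply: Ho_L2; apply: UHo.
    apply: (ae_inner (L2_phi k) (L2_phi k) (Ho_L2 hp) h1); first exact: aeW.
    by apply: (@filterS _ _ (ae_filter_ringOfSetsType mu)) (ae_eqTE (U0 _ hp)) => x ->.
  apply: (@grp_unique _ lam c (fun t => coef (U t psi)) (fun t => coef (U t chi))).
  - by move=> s; apply: coef_l2; apply: UHo.
  - by move=> s; apply: coef_l2; apply: UHo.
  - move=> s k; have /GE[h1 h2 h3] := dom2 s psi chi gp.
    by case: k => [|k]; [rewrite /seq_gen !coef0 /= !mulr0 addr0|exact: h3].
  - by move=> s e e0; apply: dom.
move=> t psi hp; have lp := coef_l2 hp; apply: l2le0_eq => e e0.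
have e2 : 0 < e / 2 by rewrite divr_gt0.
have [m /(_ m (leqnn m)) hm] := l2_tail lp e2.
(* Finite sums of modes are dense and lie in the domain, because the generator maps finite support
   to finite support. *)
pose f := fsyn m (coef psi); have hf : Ho f by apply: Ho_fsyn.
have fE : coef f = trunc m (coef psi).
  apply/funext => k; rewrite coef_fsyn /trunc; case: k => [|k] //.
  by rewrite coef0; case: ifP.
have [chi [hc cE _]] : exists chi, [/\ Ho chi, forall k, coef chi k = gen (coef f) k &
    forall e, l2le (gen (coef f)) e -> L2norm chi <= e].
  apply: synthesis; last by rewrite /seq_gen coef0 /= !mulr0 addr0.
  exists (nrm m.+1 (gen (coef f))); apply: (@l2le_from _ m.+1) => K mK.
  rewrite (@nrm_supp _ m.+1 K) // => k mk; rewrite /seq_gen fE trunc_supp 1?ltnW //.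
  rewrite (@tri_supp _ _ _ m) //; first by rewrite !mulr0 addr0.
  by move=> j; apply: trunc_supp.
have gf : G f chi by apply/GE; split => // k _; apply: cE.
rewrite [e]splitr; apply: (@l2le_triangle _ (coef (U t f))).
  apply/parsevalB_le; try exact: UHo.
  by rewrite UB //; apply/parsevalB_le => //; rewrite fE.
rewrite (domE t _ _ gf) -grpB //; last exact: coef_l2.
by apply: grp_le; apply: l2le_distC; rewrite fE.
Qed.

End UnitaryGroup.

(** * The propagator in coordinates *)

Section ControlledPropagator.
Context {R : realType}.
Implicit Types psi chi : wave R.
Variable alpha : R.

Definition freq (k : nat) : R := k%:R `^ (2 * alpha).

Lemma opAcB_diag c psi chi : opAcB alpha c psi chi <-> diag_graph freq c psi chi.
Proof.
have E k : L2 psi -> L2 chi -> coef (fun x => chi x - c%:C * opB psi x) k =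
    coef chi k - c%:C * tri bco (coef psi) k.
  move=> hp hc; rewrite coefB //; last by apply: L2Z; apply: L2_opB.
  by congr (_ - _); rewrite -coef_opB //; apply: innerZr; [apply: L2_phi|apply: L2_opB].
split.
  move=> [hp h h3]; have hc : Ho chi.
    have := Ho_D h (Ho_Z c%:C (Ho_opB hp)).
    by under eq_fun do rewrite subrK.
  split => // k /h3; rewrite -!/(coef _ k) (E k (Ho_L2 hp) (Ho_L2 hc)) => /eqP.
  by rewrite subr_eq => /eqP ->.
move=> [hp hc h]; split => //; first by apply: Ho_B => //; apply: Ho_Z; apply: Ho_opB.
by move=> k k0; rewrite -!/(coef _ k) (E k (Ho_L2 hp) (Ho_L2 hc)) h // /seq_gen addrK.
Qed.

Lemma exp_op_unitary c : unitary_group (opAcB alpha c) (exp_op (opAcB alpha c)).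
Proof.
have h := unitary_wgrp (opAcB_diag c).
by rewrite /exp_op; case: xgetP => [U _ //|/(_ _ h)].
Qed.

Lemma exp_op_Ho c t psi : Ho psi -> Ho (exp_op (opAcB alpha c) t psi).
Proof. by have [h _ _ _ _] := exp_op_unitary c; apply: h. Qed.

Lemma coef_exp_op c t psi : Ho psi ->
  coef (exp_op (opAcB alpha c) t psi) = grp freq c t (coef psi).
Proof. exact: unitary_group_coef (opAcB_diag c) (exp_op_unitary c) t psi. Qed.

Lemma propagate_flow l psi : Ho psi ->
  Ho (propagate alpha l psi) /\ coef (propagate alpha l psi) = flow freq l (coef psi).
Proof.
elim: l psi => [|[s c] l IH] psi hp //=.
have [h1 h2] := IH _ (exp_op_Ho c s hp); split => //.
by rewrite h2 coef_exp_op.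
Qed.

End ControlledPropagator.

(** * Approximate steering between sequences *)

Section Steering.
Context {R : realType}.
Variable lam : nat -> R.
Implicit Types (x y z : nat -> R[i]) (l : seq (R * R)) (e s t : R).
Local Notation flow := (flow lam).

Lemma flow_l2 l x : l2 x -> l2 (flow l x).
Proof. by elim: l x => [|[s c] l IH] x lx //=; apply: IH; apply: grp_l2. Qed.

Lemma flow_cat l l' x : flow (l ++ l') x = flow l' (flow l x).
Proof. by elim: l x => [|[s c] l IH] x //=. Qed.

Lemma flow_dist l x y e : l2 x -> l2 y -> l2le (fun k => x k - y k) e ->
  l2le (fun k => flow l x k - flow l y k) e.
Proof.
elim: l x y => [|[s c] l IH] x y lx ly h //=.
apply: IH; [exact: grp_l2|exact: grp_l2|].
by rewrite -(grpB lam c s lx ly); apply: grp_le.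
Qed.

(** The total duration is prescribed exactly while the target is met up to [e]; all durations are
    positive, as [steps] requires. *)
Definition steer x z (T e : R) := exists l : seq (R * R),
  [/\ all (fun p => 0 < p.1) l, \sum_(p <- l) p.1 = T & l2le (fun k => flow l x k - z k) e].

Lemma steer_refl x : steer x x 0 0.
Proof.
exists [::]; split; rewrite ?big_nil // => K.
by rewrite (@eq_nrm _ _ _ (fun=> 0)) ?nrm0 // => k _; rewrite subrr.
Qed.

(** Errors merely add under concatenation, because each flow is a contraction and never amplifies an
    earlier error. *)
Lemma steer_trans x y z (T1 T2 e1 e2 : R) : l2 x -> l2 y ->
  steer x y T1 e1 -> steer y z T2 e2 -> steer x z (T1 + T2) (e1 + e2).
Proof.
move=> lx ly [l1 [p1 s1 h1]] [l2 [p2 s2 h2]]; exists (l1 ++ l2); split.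
- by rewrite all_cat p1.
- by rewrite big_cat /= s1 s2.
rewrite flow_cat; apply: l2le_triangle h2; apply: flow_dist => //; exact: flow_l2.
Qed.

Lemma steer_near x x' z z' (T e d d' : R) : l2 x -> l2 x' ->
  l2le (fun k => x k - x' k) d -> l2le (fun k => z k - z' k) d' ->
  steer x' z T e -> steer x z' T (d + e + d').
Proof.
move=> lx lx' hd hd' [l [p s h]]; exists l; split => //.
by apply: l2le_triangle hd'; apply: l2le_triangle h; apply: flow_dist.
Qed.

Lemma steer_weak x z (T e e' : R) : e <= e' -> steer x z T e -> steer x z T e'.
Proof. by move=> ee [l [p s h]]; exists l; split => //; apply: l2le_weak h. Qed.

Lemma steer_cst c s x : 0 < s -> steer x (grp lam c s x) s 0.
Proof.
move=> s0; exists [:: (s, c)]; split; rewrite ?big_seq1 //= ?s0 // => K.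
by rewrite (@eq_nrm _ _ _ (fun=> 0)) ?nrm0 // => k _; rewrite subrr.
Qed.

Lemma l2_supp J x : (forall k, (J <= k)%N -> x k = 0) -> l2 x.
Proof.
move=> h; exists (nrm J x); apply: (@l2le_from _ J) => K JK.
by rewrite (@nrm_supp _ J K).
Qed.

(** A Lipschitz control is sampled with step [h]: freezing it adds a residual [L * h * Y] to the
    residual [e], and small steps push its total contribution below [d]. *)
Lemma steer_var J (y r : R -> nat -> R[i]) (u : R -> R) (e Y L tau d : R) :
  0 <= e -> 0 <= L -> 0 < tau -> 0 < d ->
  (forall s k, (J <= k)%N -> y s k = 0) ->
  (forall s k, cderive (y^~ k) s (seq_gen lam (u s) (y s) k + r s k)) ->
  (forall s, l2le (r s) e) -> (forall s, l2le (y s) Y) ->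
  (forall s t, `|u s - u t| <= L * `|s - t|) ->
  steer (y 0) (y tau) tau (e * tau + d).
Proof.
move=> e0 L0 t0 d0 ys yd re yY uL; have Y0 := l2le_ge0 (yY 0).
have step a h : 0 < h -> steer (y a) (y (a + h)) h ((e + L * h * Y) * h).
  move=> h0.
  have H : l2le (fun k => y (a + h) k - grp lam (u a) h (y a) k) ((e + L * h * Y) * h).
    have := @grp_duhamel _ lam (u a) J (fun s => y (a + s))
      (fun s k => r (a + s) k + (u (a + s) - u a)%:C * tri bco (y (a + s)) k)
      (e + L * h * Y) h; rewrite addr0 (gtr0_norm h0); apply.
    - by rewrite addr_ge0 // !mulr_ge0 // ltW.
    - by move=> s k; apply: ys.
    - move=> s k; apply: eq_cderive (_ : cderive (fun s => y (1 * s + a) k) s _) _; last first.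
        by move=> s'; rewrite mul1r addrC.
      apply: cderive_eq (cderive_affine (yd _ k)) _.
      by rewrite mul1r [s + a]addrC rmorphB rmorph1 mul1r /seq_gen; ring.
    move=> s sh; apply: l2leD => // K; rewrite nrmZr; apply: ler_pM; rewrite ?nrm_ge0 //.
      by apply: le_trans (uL _ _) _; rewrite addrAC subrr add0r; apply: ler_wpM2l.
    by apply: le_trans (nrm_B _ _) _; apply: yY.
  have := steer_near (l2_supp (ys a)) (l2_supp (ys a)) _ (l2le_distC H) (steer_cst (u a) (y a) h0).
  move=> /(_ 0); rewrite !add0r; apply => K.
  by rewrite (@eq_nrm _ _ _ (fun=> 0)) ?nrm0 // => k _; rewrite subrr.
have iter n h : 0 < h -> steer (y 0) (y (n%:R * h)) (n%:R * h) ((e + L * h * Y) * (n%:R * h)).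
  move=> h0; elim: n => [|n IH]; first by rewrite !mul0r mulr0; apply: steer_refl.
  have := steer_trans (l2_supp (ys _)) (l2_supp (ys _)) IH (step (n%:R * h) h h0).
  by rewrite -mulrDr; have -> : n%:R * h + h = n.+1%:R * h by rewrite -natr1; ring.
(* With [h = tau / n] the sampling error over the whole interval is [L * Y * tau ^+ 2 / n], hence at
   most [d]. *)
pose n := (Num.bound (L * Y * tau * tau / d)).+1.
have n0 : 0 < n%:R :> R by rewrite ltr0n.
have := iter n (tau / n%:R) (divr_gt0 t0 n0).
have -> : n%:R * (tau / n%:R) = tau by rewrite mulrC divfK // gt_eqF.
apply: steer_weak; rewrite mulrDl lerD2l.
have h : L * Y * tau * tau / d <= n%:R.
  apply: le_trans (ltW (archi_boundP _)) _; first by rewrite divr_ge0 ?mulr_ge0 // ltW.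
  by rewrite ler_nat.
rewrite ler_pdivrMr // in h.
have -> : L * (tau / n%:R) * Y * tau = L * Y * tau * tau / n%:R by ring.
by rewrite ler_pdivrMr // [leRHS]mulrC.
Qed.

Lemma grp_free t x J : (forall k, (J <= k)%N -> x k = 0) ->
  grp lam 0 t x = fun k => expi (lam k * t) * x k.
Proof.
move=> xs; symmetry; apply: l2le0_eq => e e0.
have E : (fun k => expi (lam k * 0) * x k) = x by apply/funext => k; rewrite mulr0 expi0 mul1r.
have := @grp_duhamel _ lam 0 J (fun t k => expi (lam k * t) * x k) (fun _ _ => 0) 0 t (lexx _).
rewrite mul0r E => H; apply: l2le_weak (ltW e0) _; apply: H => [s k Jk|s k|s _ K].
- by rewrite xs ?mulr0.
- have := cderive_expi (lam k) 0 s; rewrite addr0.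
  move=> h; apply: cderive_eq (cderiveM (eq_cderive h _) (cderive_cst (x k) s)) _.
    by move=> s'; rewrite addr0.
  by rewrite /seq_gen addr0 rmorph0 mul0r mulr0 !addr0 mulrA.
by rewrite nrm0.
Qed.

End Steering.

(** * Resonant rotation in the plane of two consecutive modes *)

Section Rotation.
Context {R : realType}.
Implicit Types (x y z : nat -> R[i]) (e s t : R).

(** The exponential of [- i * th] times the matrix that exchanges the coordinates [k] and [k.+1]
    with the phases [expi (- ga)] and [expi ga]. *)
Definition rot (k : nat) (th ga : R) x (j : nat) : R[i] :=
  if j == k then (cos th)%:C * x k - 'i%C * expi (- ga) * (sin th)%:C * x k.+1
  else if j == k.+1 then (cos th)%:C * x k.+1 - 'i%C * expi ga * (sin th)%:C * x k
  else x j.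

Lemma rot0 k ga x : rot k 0 ga x = x.
Proof.
apply/funext => j; rewrite /rot cos0 sin0 rmorph0 rmorph1 !mulr0 !mul0r !subr0 !mul1r.
by case: eqP => [->|_] //; case: eqP => [->|].
Qed.

Lemma rot_supp k th ga x J : (k.+1 < J)%N -> (forall j, (J <= j)%N -> x j = 0) ->
  forall j, (J <= j)%N -> rot k th ga x j = 0.
Proof.
move=> kJ h j Jj; rewrite /rot; case: eqP => [jk|_]; first by move: Jj; rewrite jk leqNgt ltnW.
by case: eqP => [jk|_]; [move: Jj; rewrite jk leqNgt kJ|exact: h].
Qed.

Lemma rotN k th ga x : rot k (- th) ga (rot k th ga x) = x.
Proof.
have h : (cos th)%:C * (cos th)%:C + (sin th)%:C * (sin th)%:C = 1 :> R[i].
  by rewrite -!rmorphM -rmorphD /= -!expr2 cos2Dsin2.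
have ii : 'i%C * 'i%C = -1 :> R[i] by rewrite -expr2 sqr_i.
have e1 : expi ga * expi (- ga) = 1 by exact: expiMN.
apply/funext => j; rewrite /rot cosN sinN !eqxx (gtn_eqF (ltnSn k)).
case: eqP => [->|_]; last case: eqP => [->|//].
  rewrite (_ : _ - _ = ((cos th)%:C * (cos th)%:C - ('i%C * 'i%C) * (expi ga * expi (- ga)) *
    ((sin th)%:C * (sin th)%:C)) * x k); last by rewrite rmorphN; ring.
  by rewrite ii e1 mulr1 mulN1r opprK h mul1r.
rewrite (_ : _ - _ = ((cos th)%:C * (cos th)%:C - ('i%C * 'i%C) * (expi ga * expi (- ga)) *
  ((sin th)%:C * (sin th)%:C)) * x k.+1); last by rewrite rmorphN; ring.
by rewrite ii e1 mulr1 mulN1r opprK h mul1r.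
Qed.

Lemma nrm_rot k th ga x J : (k.+1 < J)%N -> nrm J (rot k th ga x) = nrm J x.
Proof.
move=> kJ; rewrite /nrm; congr Num.sqrt.
have kJ' : (k < J)%N by apply: ltnW.
rewrite (bigD1 (Ordinal kJ')) //= [RHS](bigD1 (Ordinal kJ')) //=.
rewrite (bigD1 (Ordinal kJ)) /=; last by rewrite -val_eqE /= gtn_eqF.
rewrite [in RHS](bigD1 (Ordinal kJ)) /=; last by rewrite -val_eqE /= gtn_eqF.
rewrite !addrA; congr (_ + _); last first.
  apply: eq_bigr => j /andP[]; rewrite -!val_eqE /= => /negbTE h1 /negbTE h2.
  by rewrite /rot h1 h2.
rewrite /rot !eqxx (gtn_eqF (ltnSn k)).
have h := cos2Dsin2 th; have h2 := cos2Dsin2 ga.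
rewrite /sqn /expi cosN sinN !cpxE /=.
set a := complex.Re (x k); set b := complex.Im (x k).
set c := complex.Re (x k.+1); set d := complex.Im (x k.+1).
move: h h2; set C := cos th; set S := sin th; set g := cos ga; set f := sin ga => h h2.
rewrite [LHS](_ : _ = (C ^+ 2 + S ^+ 2 * (g ^+ 2 + f ^+ 2)) * (a ^+ 2 + b ^+ 2 + (c ^+ 2 + d ^+ 2))).
  by rewrite h2 mulr1 h mul1r; ring.
ring.
Qed.

Lemma l2le_rot k th ga x e : l2le x e -> l2le (rot k th ga x) e.
Proof.
move=> h; apply: (@l2le_from _ k.+2) => K hK.
by rewrite nrm_rot //; apply: h.
Qed.

(** The angle is [eta * t / 2] because a link of strength [eta] enters [tri] with the factor [mhi]
    of modulus 1/2. *)
Lemma cderive_rot k (eta ga : R) x j t : (0 < k)%N ->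
  cderive (fun s => rot k (eta * s / 2) ga x j) t
    (tri (fun j => if j == k then eta%:C * expi (- ga) else 0) (rot k (eta * t / 2) ga x) j).
Proof.
case: k => // k _.
have dc : cderive (fun s => (cos (eta * s / 2))%:C : R[i]) t (- (eta / 2 * sin (eta * t / 2)))%:C.
  apply: cderive_real; rewrite (_ : (fun s => _) = (fun s => cos (eta / 2 * s))); last first.
    by apply/funext => s; congr cos; ring.
  apply: is_derive_eq; rewrite /GRing.scale /= !mulr1 ?mulr0 ?addr0 ?add0r.
  by rewrite mulrC -mulrN; congr (_ * - sin _); ring.
have ds : cderive (fun s => (sin (eta * s / 2))%:C : R[i]) t (eta / 2 * cos (eta * t / 2))%:C.
  apply: cderive_real; rewrite (_ : (fun s => _) = (fun s => sin (eta / 2 * s))); last first.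
    by apply/funext => s; congr sin; ring.
  apply: is_derive_eq; rewrite /GRing.scale /= !mulr1 ?mulr0 ?addr0 ?add0r.
  by rewrite mulrC; congr (_ * cos _); ring.
have kk : (k == k.+1) = false by rewrite ltn_eqF.
have kk2 : (k.+2 == k.+1) = false by rewrite gtn_eqF.
rewrite /rot; case: (eqVneq j k.+1) => [->|jk].
  rewrite /tri !eqxx kk kk2 conjC0 mul0r addr0.
  have h1 := cderiveM dc (cderive_cst (x k.+1) t).
  have h2 := cderiveM (cderiveZ ('i%C * expi (- ga)) ds) (cderive_cst (x k.+2) t).
  apply: cderive_eq (cderiveB h1 h2) _.
  rewrite mhiE !mulr0 !addr0 rmorphN !rmorphM [RHS](_ : _ = - 'i%C * (2^-1)%:C * eta%:C *
    expi (- ga) * (cos (eta * t / 2))%:C * x k.+2 + ('i%C * 'i%C) * (expi ga * expi (- ga)) *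
    (2^-1)%:C * eta%:C * (sin (eta * t / 2))%:C * x k.+1); last by ring.
  by rewrite expiMN -expr2 sqr_i; ring.
case: (eqVneq j k.+2) => [->|jk2].
  rewrite /tri !eqxx kk2 mul0r add0r.
  have h1 := cderiveM dc (cderive_cst (x k.+2) t).
  have h2 := cderiveM (cderiveZ ('i%C * expi ga) ds) (cderive_cst (x k.+1) t).
  apply: cderive_eq (cderiveB h1 h2) _.
  have -> : (eta%:C * expi (- ga))^* = eta%:C * expi ga.
    by apply: cplxP; rewrite !cpxE /= ?cosN ?sinN; ring.
  rewrite mhiE !mulr0 !addr0 rmorphN !rmorphM [RHS](_ : _ = - 'i%C * (2^-1)%:C * eta%:C *
    expi ga * (cos (eta * t / 2))%:C * x k.+1 + ('i%C * 'i%C) * (expi ga * expi (- ga)) *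
    (2^-1)%:C * eta%:C * (sin (eta * t / 2))%:C * x k.+2); last by ring.
  by rewrite expiMN -expr2 sqr_i; ring.
apply: cderive_eq (cderive_cst _ _) _; rewrite /tri; case: j jk jk2 => // j jk jk2.
by rewrite (negbTE jk) -(eqSS j) (negbTE jk2) conjC0 !mul0r addr0 mulr0.
Qed.

Lemma cderive_tri2 (f df y dy : R -> nat -> R[i]) j t :
  (forall k, cderive (f^~ k) t (df t k)) -> (forall k, cderive (y^~ k) t (dy t k)) ->
  cderive (fun s => tri (f s) (y s) j) t (tri (df t) (y t) j + tri (f t) (dy t) j).
Proof.
move=> hf hy; case: j => [|j]; first by apply: cderive_eq (cderive_cst _ _) _; rewrite addr0.
apply: cderive_eq (cderiveZ mhi (cderiveD (cderiveM (hf j.+1) (hy j.+2))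
  (cderiveM (cderiveJ (hf j)) (hy j)))) _.
by rewrite /tri; ring.
Qed.

Lemma cmod_expiB1 s : Num.sqrt (sqn (expi s - 1)) <= `|s|.
Proof.
have := @nrm_mvt _ 1 (fun _ s => expi (1 * s + 0) - 1) (fun _ s => 'i%C * (1%:C * expi (1 * s + 0))) 1 s ler01.
rewrite !mul1r !addr0 expi0 subrr nrm0 add0r /nrm big_ord1; apply.
  move=> k u _ _; apply: cderive_eq (cderiveB (cderive_expi 1 0 u) (cderive_cst 1 u)) _.
  by rewrite subr0 mulrA.
by move=> u _; rewrite big_ord1 !sqnM sqn_i sqn_expi sqn_real expr1n !mul1r sqrtr1.
Qed.

Lemma cos_lipschitz (a b : R) : `|cos a - cos b| <= `|a - b|.
Proof.
apply: le_trans (cmod_expiB1 (a - b)).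
have -> : sqn (expi (a - b) - 1) = sqn (expi a - expi b).
  by rewrite -[LHS]mul1r -(sqn_expi b) -sqnM mulrBr -expiD mulr1 [b + _]addrC subrK.
by rewrite -sqrtr_sqr; apply: ler_wsqrtr; rewrite /sqn !cpxE /= lerDl sqr_ge0.
Qed.

Lemma cosE_expi (a : R) : (2 * cos a)%:C = expi a + expi (- a).
Proof. by apply: cplxP; rewrite !cpxE /= ?cosN ?sinN; ring. Qed.

(** The primitive of [expi (w * t)] vanishing at 0; its modulus is at most 2 / |w|. *)
Definition osc (w t : R) : R[i] := - 'i%C * (w^-1)%:C * (expi (w * t) - 1).

Lemma osc0 w : osc w 0 = 0. Proof. by rewrite /osc mulr0 expi0 subrr mulr0. Qed.

Lemma cderive_osc w t : w != 0 -> cderive (osc w) t (expi (w * t)).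
Proof.
move=> w0; have := cderive_expi w 0 t; rewrite addr0.
move=> /(eq_cderive (g := fun s => expi (w * s))) h.
apply: cderive_eq (cderiveZ (- 'i%C * (w^-1)%:C) (cderiveB (h _) (cderive_cst 1 t))) _.
  by move=> s; rewrite addr0.
rewrite subr0 [LHS](_ : _ = - ('i%C * 'i%C) * ((w^-1)%:C * w%:C) * expi (w * t)); last by ring.
by rewrite -expr2 sqr_i opprK -rmorphM mulVf // !mul1r.
Qed.

Lemma sqn_osc w t (D : R) : 0 < D -> D <= `|w| -> sqn (osc w t) <= 4 / D ^+ 2.
Proof.
move=> D0 Dw; rewrite /osc sqnM (sqnM (- _)) sqnN sqn_i sqn_real mul1r mulrC.
have h : sqn (expi (w * t) - 1) <= 4.
  apply: le_trans (sqnD_le _ _) _; rewrite sqnN sqn_expi -(expi0 (R := R)) sqn_expi; lra.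
apply: ler_pM => //; rewrite ?sqn_ge0 ?sqr_ge0 // exprVn.
have w0 : 0 < `|w| by apply: lt_le_trans D0 Dw.
rewrite -[w ^+ 2]real_normK ?num_real // lef_pV2 ?posrE; last 2 first.
- exact: exprn_gt0.
- exact: exprn_gt0.
by rewrite ler_pXn2r // nnegrE ltW.
Qed.

Variable lam : nat -> R.
Let gap j := lam j.+1 - lam j.

(** Passage to the interaction picture: once the free phases are factored out, the link [j]
    oscillates at the frequency [gap j]. *)
Lemma tri_phase t v j :
  tri bco (fun j => expi (lam j * t) * v j) j =
  expi (lam j * t) * tri (fun j => bco j * expi (gap j * t)) v j.
Proof.
case: j => [|j]; first by rewrite /= mulr0.
rewrite /tri /= mul1r (_ : lam j.+2 * t = lam j.+1 * t + gap j.+1 * t); last by rewrite /gap; ring.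
rewrite (_ : lam j * t = lam j.+1 * t + - (gap j * t)); last by rewrite /gap; ring.
rewrite !expiD expiN; have -> : (bco j * expi (gap j * t))^* = (bco j)^* * (expi (gap j * t))^* :> R[i].
  by rewrite rmorphM.
ring.
Qed.

(* In the interaction picture, the control [2 eta cos (g t + ga)] at the frequency [g] of the
   transition k -> k + 1 acts by the constant resonant matrix [tri m], which generates the rotation,
   plus terms oscillating at frequencies at least [D].  Their primitive [f] is of size [eta / D], and
   [z + tri f z], with [z] the rotating solution, solves the equation up to order [eta ^ 2 / D]. *)
Lemma steer_rot k (D th ga tau d : R) x J : (0 < k)%N -> 0 < D ->
  (forall j, (0 < j)%N -> j != k -> D <= `|gap j - gap k|) ->
  (forall j, (0 < j)%N -> D <= `|gap j + gap k|) ->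
  `|th| <= 2 -> 0 < tau -> 0 < d -> (forall j, (J <= j)%N -> x j = 0) -> l2le x 1 ->
  steer lam x (fun j => expi (lam j * tau) * rot k th ga x j) tau (208 / (tau * D) + d).
Proof.
move=> k0 D0 Dm Dp th2 tau0 d0 xs x1.
(* This amplitude brings the angle [eta * t / 2] to [th] at time [tau]. The quantity [q] bounds
   [tri f]: two primitives of modulus at most [2 / D], multiplied by [eta]. *)
pose eta := 2 * th / tau; pose q := 4 * `|eta| / D.
have eta4 : `|eta| * tau <= 4.
  by rewrite /eta normrM normfV (gtr0_norm tau0) divfK ?gt_eqF // normrM ger0_norm // ; lra.
have q0 : 0 <= q by rewrite divr_ge0 ?mulr_ge0 // ltW.
pose g := gap k.
pose f t j : R[i] := eta%:C * (bco j * (expi ga * osc (gap j + g) t +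
  (if j == k then 0 else expi (- ga) * osc (gap j - g) t))).
pose m j : R[i] := if j == k then eta%:C * expi (- ga) else 0.
pose u t := 2 * eta * cos (g * t + ga).
(* Both frequencies [gap j + g] and [gap j - g] occur in the product of the control with the link
   [j]; only the second one at [j = k] is zero, and [m] collects it. *)
pose df t j : R[i] := (u t)%:C * (bco j * expi (gap j * t)) - m j.
pose z t := rot k (eta * t / 2) ga x.
pose v t j := z t j + tri (f t) (z t) j.
pose y t j := expi (lam j * t) * v t j.
pose J' := (maxn J k.+2).+1.
have bJ j : (bco j)^* = bco j :> R[i] by case: j => [|j]; rewrite /= ?conjC0 ?conjC1.
have bsq j : sqn (bco j) <= 1 :> R by have := @sqn_bco R j; rewrite expr1n.
have fd t j : cderive (f^~ j) t (df t j).
  case: j => [|j].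
    have k0' : (0%N == k) = false by rewrite ltn_eqF.
    rewrite /f /df /m k0'.
    apply: eq_cderive (cderive_eq (cderive_cst 0 t) _) _; first by rewrite mul0r mulr0 subr0.
    by move=> s; rewrite mul0r mulr0.
  rewrite /f /df /m /u.
  have hp : gap j.+1 + g != 0 by rewrite -normr_gt0; apply: lt_le_trans D0 (Dp _ _).
  have E1 : (2 * eta * cos (g * t + ga))%:C = eta%:C * (expi (g * t) * expi ga + expi (- (g * t)) * expi (- ga)) :> R[i].
    by rewrite -!expiD -opprD -cosE_expi -rmorphM; congr (_%:C); ring.
  have E2 : expi ((gap j.+1 + g) * t) = expi (gap j.+1 * t) * expi (g * t) by rewrite mulrDl expiD.
  have h1 := cderiveZ (expi ga) (cderive_osc t hp).
  rewrite E1; case: (eqVneq j.+1 k) => [jk|jk].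
    apply: eq_cderive (cderive_eq (cderiveZ eta%:C (cderiveZ (bco j.+1)
      (cderiveD h1 (cderive_cst 0 t)))) _) _ => //.
    have E3 : expi (gap j.+1 * t) * expi (- (g * t)) = 1 by rewrite /g -jk expiMN.
    rewrite E2 addr0 /= !mul1r.
    rewrite [RHS](_ : _ = eta%:C * (expi (g * t) * expi ga * expi (gap j.+1 * t)) +
      (eta%:C * expi (- ga)) * (expi (gap j.+1 * t) * expi (- (g * t)) - 1)); last by ring.
    by rewrite E3 subrr mulr0 addr0; ring.
  have hm : gap j.+1 - g != 0 by rewrite -normr_gt0; apply: lt_le_trans D0 (Dm _ _ jk).
  have E3 : expi ((gap j.+1 - g) * t) = expi (gap j.+1 * t) * expi (- (g * t)) by rewrite mulrDl expiD mulNr.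
  have h2 := cderiveZ (expi (- ga)) (cderive_osc t hm).
  apply: cderive_eq (cderiveZ eta%:C (cderiveZ (bco j.+1) (cderiveD h1 h2))) _.
  by rewrite E2 E3 /=; ring.
have fb t j : sqn (f t j) <= q ^+ 2.
  rewrite /f sqnM sqn_real.
  have -> : q ^+ 2 = eta ^+ 2 * (2 * (4 / D ^+ 2 + 4 / D ^+ 2)).
    by rewrite /q expr_div_n exprMn real_normK ?num_real //; field; rewrite gt_eqF.
  rewrite ler_wpM2l ?sqr_ge0 //; case: j => [|j].
    by rewrite mul0r sqn0 !mulr_ge0 ?addr_ge0 ?divr_ge0 ?exprn_ge0 // ltW.
  rewrite mul1r; apply: le_trans (sqnD_le _ _) _; apply: ler_wpM2l => //; apply: lerD.
    by rewrite sqnM sqn_expi mul1r; apply: sqn_osc => //; apply: Dp.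
  case: eqVneq => [_|jk]; first by rewrite sqn0 divr_ge0 ?exprn_ge0 // ltW.
  by rewrite sqnM sqn_expi mul1r; apply: sqn_osc => //; apply: Dm.
have mb j : sqn (m j) <= `|eta| ^+ 2.
  rewrite /m real_normK ?num_real //; case: ifP; rewrite ?sqn0 ?sqr_ge0 //.
  by rewrite sqnM sqn_expi mulr1 sqn_real.
have eb t j : sqn (bco j * expi (gap j * t)) <= 1 ^+ 2.
  by rewrite expr1n sqnM sqn_expi mulr1 bsq.
have zd t j : cderive (z^~ j) t (tri m (z t) j) by apply: cderive_rot.
have zb t : l2le (z t) 1 by apply: l2le_rot.
have zs t j : (maxn J k.+2 <= j)%N -> z t j = 0.
  apply: (@rot_supp _ _ _ _ (maxn J k.+2)); first by rewrite leq_max ltnSn orbT.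
  by move=> i; rewrite geq_max => /andP[/xs].
have fzb t : l2le (tri (f t) (z t)) q.
  move=> K; apply: le_trans (nrm_tri K _ q0 (fb t)) _; rewrite -[leRHS]mulr1.
  by apply: ler_wpM2l => //; apply: zb.
(* Since the derivative of [f] cancels the nonresonant terms of first order, only products of the
   corrector with [m] or with the control remain, of sizes [q * |eta|] and [2 * |eta| * q]. *)
pose r t j := expi (lam j * t) * (tri (f t) (tri m (z t)) j -
  (u t)%:C * tri (fun j => bco j * expi (gap j * t)) (tri (f t) (z t)) j).
have sE t j : sqn (expi (lam j * t)) = 1 by apply: sqn_expi.
have ph t w e : l2le w e -> l2le (fun j => expi (lam j * t) * w j) e.
  move=> h K; rewrite (_ : nrm K _ = nrm K w) //; rewrite /nrm; congr Num.sqrt.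
  by apply: eq_bigr => i _; rewrite sqnM sE mul1r.
have vb t : l2le (y t) (1 + q) by apply: ph; apply: l2leD.
have ub t : `|u t| <= 2 * `|eta|.
  rewrite /u normrM [`|2 * _|]normrM ger0_norm // -[leRHS]mulr1 ler_wpM2l ?mulr_ge0 //.
  by rewrite ler_norml cos_geN1 cos_le1.
have rb t : l2le (r t) (3 * `|eta| * q).
  rewrite (_ : 3 * _ * q = q * `|eta| + 2 * `|eta| * q); last by ring.
  apply: ph; apply: l2leB => K.
    apply: le_trans (nrm_tri K _ q0 (fb t)) _; apply: ler_wpM2l => //.
    apply: le_trans (nrm_tri K.+1 _ (normr_ge0 eta) mb) _; rewrite -[leRHS]mulr1.
    by apply: ler_wpM2l => //; apply: zb.
  rewrite nrmZr; apply: ler_pM; rewrite ?nrm_ge0 //.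
  by apply: le_trans (nrm_tri K _ ler01 (eb t)) _; rewrite mul1r; apply: fzb.
have ys s j : (J' <= j)%N -> y s j = 0.
  move=> Jj; have Kj : (maxn J k.+2 < j)%N by [].
  by rewrite /y /v (zs s j (ltnW Kj)) (tri_supp _ (zs s) Kj) addr0 mulr0.
have yd s j : cderive (y^~ j) s (seq_gen lam (u s) (y s) j + r s j).
  have hE := cderive_expi (lam j) 0 s; rewrite addr0 in hE.
  have h1 := cderiveD (zd s j) (@cderive_tri2 f df z (fun s => tri m (z s)) j s (fd s) (zd s)).
  apply: cderive_eq (cderiveM (eq_cderive hE _) h1) _.
    by move=> s'; rewrite addr0.
  rewrite /seq_gen (tri_phase s (v s) j) /r /y.
  have -> : tri (fun j => bco j * expi (gap j * s)) (v s) j =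
    tri (fun j => bco j * expi (gap j * s)) (z s) j +
    tri (fun j => bco j * expi (gap j * s)) (tri (f s) (z s)) j by rewrite triD.
  have -> : tri (df s) (z s) j = (u s)%:C * tri (fun j => bco j * expi (gap j * s)) (z s) j -
      tri m (z s) j.
    apply/eqP; rewrite eq_sym subr_eq -tri_coefZ -tri_coefD; apply/eqP; congr (tri _ _ _).
    by apply/funext => i; rewrite /df subrK.
  by rewrite /v; ring.
have uL s t : `|u s - u t| <= 2 * `|eta| * `|g| * `|s - t|.
  rewrite /u -mulrBr normrM normrM ger0_norm // -!mulrA ler_wpM2l // ler_wpM2l //.
  apply: le_trans (cos_lipschitz _ _) _; rewrite -normrM.
  by rewrite (_ : _ - _ = g * (s - t)) //; ring.
have L0 : 0 <= 2 * `|eta| * `|g| by rewrite !mulr_ge0.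
have e0 : 0 <= 3 * `|eta| * q by apply: mulr_ge0 => //; apply: mulr_ge0.
have main := steer_var e0 L0 tau0 d0 ys yd rb vb uL.
have y0E : y 0 = x.
  apply/funext => j; rewrite /y mulr0 expi0 mul1r /v /z mulr0 mul0r rot0.
  have f0 i : f 0 i = 0 by rewrite /f !osc0 !mulr0; case: ifP; rewrite addr0 !mulr0.
  case: j => [|j]; rewrite /tri ?addr0 // !f0 conjC0 !mul0r addr0 mulr0 addr0 //.
have fin : l2le (fun j => y tau j - expi (lam j * tau) * rot k th ga x j) q.
  have -> : (fun j => y tau j - expi (lam j * tau) * rot k th ga x j) =
      (fun j => expi (lam j * tau) * tri (f tau) (z tau) j).
    apply/funext => j; rewrite /y /v -mulrBr; congr (_ * _).
    rewrite /z (_ : eta * tau / 2 = th); last by rewrite /eta; field; rewrite gt_eqF.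
    by rewrite addrAC subrr add0r.
  exact: ph.
rewrite y0E in main.
have lx := l2_supp xs.
have := steer_near lx lx _ fin main.
move=> /(_ 0) H; have {}H := H _; apply: steer_weak (H _); last first.
  by move=> K; rewrite (@eq_nrm _ _ _ (fun=> 0)) ?nrm0 // => j _; rewrite subrr.
rewrite add0r addrAC lerD2r /q.
(* With [a = |eta| * tau <= 4], the residual and the corrector at the final time cost
   [12 * a ^+ 2 + 4 * a <= 208]. *)
have -> : 3 * `|eta| * (4 * `|eta| / D) * tau + 4 * `|eta| / D =
    (12 * (`|eta| * tau) ^+ 2 + 4 * (`|eta| * tau)) / (tau * D).
  by field; rewrite !gt_eqF.
rewrite ler_pM2r ?invr_gt0 ?mulr_gt0 //.
have : 0 <= `|eta| * tau by rewrite mulr_ge0 // ltW.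
move: eta4; set a := `|eta| * tau => a4 a0; nra.
Qed.

End Rotation.

(** * Separation of the transition frequencies *)

Section SpectralGap.
Context {R : realType}.
Implicit Types (a x : R).

(** The graph of a convex power lies above its tangents; this is Young's inequality for [x / y] and
    1 with exponents [a] and [a / (a - 1)]. *)
Lemma powR_tangent a x y : 1 < a -> 0 <= x -> 0 < y ->
  y `^ a + a * (y `^ a / y) * (x - y) <= x `^ a.
Proof.
move=> a1 x0 y0; have a0 : 0 < a by lra.
have ya : 0 < y `^ a by apply: powR_gt0.
have r0 : 0 <= x / y by rewrite divr_ge0 // ltW.
have := @conjugate_powR R (x / y) 1 a (a / (a - 1)) r0 ler01 a0.
rewrite powR1 !mulr1 => H; have {H} : x / y <= (x / y) `^ a / a + 1 / (a / (a - 1)).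
  apply: H; first by rewrite divr_gt0 // subr_gt0.
  by field; rewrite !gt_eqF // subr_gt0.
rewrite -(ler_pM2l (mulr_gt0 a0 ya)).
have -> : a * y `^ a * ((x / y) `^ a / a + 1 / (a / (a - 1))) =
   ((x / y) `^ a * y `^ a) + y `^ a * (a - 1).
  by field; rewrite !gt_eqF // subr_gt0.
rewrite -powRM ?(ltW y0) // divfK ?gt_eqF //.
have -> : a * (y `^ a / y) * (x - y) = a * y `^ a * (x / y) - a * y `^ a.
  by field; rewrite gt_eqF.
by lra.
Qed.

Variable alpha : R.
Hypothesis halpha : 5 / 2 < alpha.
Local Notation lam := (freq alpha).
Local Notation gap j := (lam j.+1 - lam j).

Lemma freq_pow (k : nat) : lam k = (k%:R ^+ 5) `^ (2 * alpha / 5).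
Proof. by rewrite /freq -powR_mulrn // -powRrM; congr (_ `^ _); field. Qed.

(** This is where [alpha > 5 / 2] enters: the frequency is a power of exponent
    [a = 2 * alpha / 5 > 1] of [k ^+ 5]. The tangent at [n ^+ 5] has slope at least 1, and the
    second difference of the fifth power is [20 * n ^+ 3 + 10 * n]. *)
Lemma gap_increment k : 20 * k.+1%:R ^+ 3 <= gap k.+1 - gap k :> R.
Proof.
have a1 : 1 < 2 * alpha / 5 by have := halpha; lra.
set a := 2 * alpha / 5 in a1 *; pose n : R := k.+1%:R.
have n1 : 1 <= n by rewrite ler1n.
have y0 : 0 < n ^+ 5 by rewrite exprn_gt0 // (lt_le_trans ltr01).
have E2 : k.+2%:R = n + 1 :> R by rewrite natr1.
have E0 : k%:R = n - 1 :> R by rewrite /n -natr1 addrK.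
have h2 := @powR_tangent a (k.+2%:R ^+ 5) _ a1 (exprn_ge0 5 (ler0n _ _)) y0.
have h0 := @powR_tangent a (k%:R ^+ 5) _ a1 (exprn_ge0 5 (ler0n _ _)) y0.
have yy : 1 <= (n ^+ 5) `^ a / n ^+ 5.
  have h : (n ^+ 5) `^ 1 <= (n ^+ 5) `^ a.
    by apply: ler_powR; [exact: exprn_ege1|exact: ltW].
  by rewrite ler_pdivlMr // mul1r; rewrite powRr1 // in h; apply: ltW.
have c1 : 1 <= a * ((n ^+ 5) `^ a / n ^+ 5).
  by rewrite -[leLHS]mulr1 ler_pM // ltW.
rewrite !freq_pow -/a -/n; set c := a * _ in h2 h0 c1.
have : 20 * n ^+ 3 <= c * (k.+2%:R ^+ 5 - n ^+ 5) + c * (k%:R ^+ 5 - n ^+ 5).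
  rewrite E2 E0 (_ : _ + _ = c * (20 * n ^+ 3 + 10 * n)); last by ring.
  have n3 : 0 <= 20 * n ^+ 3 by rewrite mulr_ge0 // exprn_ge0 //; lra.
  rewrite -[leLHS]mul1r; apply: ler_pM => //; lra.
lra.
Qed.

Lemma gap_mono i j : (i <= j)%N -> gap i <= gap j :> R.
Proof.
move=> /subnKC <-; elim: (j - i)%N => [|n IH]; first by rewrite addn0.
rewrite addnS; apply: le_trans IH _; have := gap_increment (i + n).
have : 0 <= 20 * (i + n).+1%:R ^+ 3 :> R by rewrite mulr_ge0 // exprn_ge0.
lra.
Qed.

Lemma gap_ge0 j : 0 <= gap j :> R.
Proof.
apply: le_trans (gap_mono (leq0n j)).
have -> : lam 1 = 1 by rewrite /freq powR1.
by rewrite /freq powR0 ?subr0 // gt_eqF //; have := halpha; lra.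
Qed.

Lemma gap_separated j k : (0 < k)%N -> j != k -> 20 * k%:R ^+ 3 <= `|gap j - gap k| :> R.
Proof.
case: k => // k _; rewrite neq_ltn => /orP[jk|kj].
  rewrite distrC; apply: le_trans (ler_norm _).
  have h := gap_increment k; have : gap j <= gap k :> R by apply: gap_mono.
  lra.
apply: le_trans (ler_norm _); have h := gap_increment k.+1.
have : gap k.+2 <= gap j :> R by apply: gap_mono.
have : k.+1%:R ^+ 3 <= k.+2%:R ^+ 3 :> R by rewrite ler_pXn2r ?nnegrE // ler_nat.
lra.
Qed.

Lemma gap_separatedD j k : (0 < k)%N -> 20 * k%:R ^+ 3 <= `|gap j + gap k| :> R.
Proof.
case: k => // k _; apply: le_trans (ler_norm _).
have := gap_increment k; have := gap_ge0 j; have := gap_ge0 k; lra.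
Qed.

End SpectralGap.

(** * Choice of the angle and phase of a rotation *)

Section PlaneRotations.
Context {R : realType}.
Implicit Types (a b z : R[i]).
Local Notation cmod z := (Num.sqrt (sqn z)).

Lemma polar z : exists t, z = (cmod z)%:C * expi t.
Proof.
have [r0|r0] := eqVneq (cmod z) 0.
  by exists 0; rewrite r0 mul0r; apply: cmod_eq0.
have rp : 0 < cmod z by rewrite lt_neqAle eq_sym r0 sqrtr_ge0.
have rr : cmod z ^+ 2 = sqn z by rewrite sqr_sqrtr // sqn_ge0.
set r := cmod z in r0 rp rr *.
pose c := complex.Re z / r; pose s := complex.Im z / r.
have cs : c ^+ 2 + s ^+ 2 = 1 by rewrite /c /s !expr_div_n -mulrDl -/(sqn z) -rr divff // expf_eq0.
have c1 : -1 <= c <= 1.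
  by rewrite -ler_norml -(@ler_pXn2r _ 2) ?nnegrE // real_normK ?num_real // expr1n -cs lerDl sqr_ge0.
have ca : cos (acos c) = c by rewrite acosK.
have sa : sin (acos c) = `|s|.
  by rewrite sin_acos // -cs [c ^+ 2 + _]addrC addrK sqrtr_sqr.
have zE : z = r%:C * (c +i* s).
  by apply: cplxP; rewrite !cpxE /= mul0r ?subr0 ?addr0 mulrC divfK.
rewrite {1}zE; have [s0|s0] := leP 0 s.
  by exists (acos c); rewrite /expi ca sa ger0_norm.
by exists (- acos c); rewrite /expi cosN sinN ca sa ltr0_norm // opprK.
Qed.

(** The phase [ga] aligns the two terms, and the sine of the angle is the proportion of [b] in the
    norm of the pair; the angle is then at most [pi / 2 < 2]. *)
Lemma rot_annihilates a b : exists th ga : R, `|th| <= 2 /\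
  (cos th)%:C * b - 'i%C * expi ga * (sin th)%:C * a = 0.
Proof.
have [pa Ea] := polar a; have [pb Eb] := polar b.
set A := cmod a in Ea; set B := cmod b in Eb.
have A0 : 0 <= A by apply: sqrtr_ge0.
have B0 : 0 <= B by apply: sqrtr_ge0.
have S0 : 0 <= A ^+ 2 + B ^+ 2 by rewrite addr_ge0 ?sqr_ge0.
pose r := Num.sqrt (A ^+ 2 + B ^+ 2).
have rr : r ^+ 2 = A ^+ 2 + B ^+ 2 by rewrite sqr_sqrtr.
have [r0|r0] := eqVneq r 0.
  move: rr; rewrite r0 expr0n /= => /esym/eqP; rewrite paddr_eq0 ?sqr_ge0 // !sqrf_eq0.
  move=> /andP[/eqP A00 /eqP B00]; exists 0, 0; rewrite normr0 sin0 rmorph0 mulr0 mul0r subr0.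
  by split => //; rewrite Eb B00 mul0r mulr0.
have rp : 0 < r by rewrite lt_neqAle eq_sym r0 sqrtr_ge0.
have cs : (A / r) ^+ 2 + (B / r) ^+ 2 = 1 by rewrite !expr_div_n -mulrDl -rr divff // expf_eq0.
have s1 : -1 <= B / r <= 1.
  by rewrite -ler_norml -(@ler_pXn2r _ 2) ?nnegrE // real_normK ?num_real // expr1n -cs lerDr sqr_ge0.
exists (asin (B / r)), (pb - pa - pi / 2); split.
  have := asin_geNpi2 s1; have := asin_lepi2 s1; have := @pihalf_lt2 R.
  by move=> h1 h2 h3; rewrite ler_norml; apply/andP; split; lra.
have Ar0 : 0 <= A / r by rewrite divr_ge0 // ltW.
rewrite cos_asin // asinK // (_ : 1 - (B / r) ^+ 2 = (A / r) ^+ 2); last by lra.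
rewrite sqrtr_sqr (ger0_norm Ar0).
have ei : 'i%C * expi (- (pi / 2)) = 1 :> R[i].
  by apply: cplxP; rewrite !cpxE /= cosN sinN cos_pihalf sin_pihalf; ring.
rewrite [in X in _ - X]Ea [in X in X - _]Eb; rewrite (expiD (pb - pa)) (expiD pb).
rewrite [LHS](_ : _ = (A / r)%:C * (B%:C * expi pb) - ('i%C * expi (- (pi / 2))) *
  (expi (- pa) * expi pa) * (expi pb * (B / r)%:C * A%:C)); last by ring.
rewrite ei expiNM !rmorphM /=; ring.
Qed.

(** A quarter turn carries [a] to the next mode with a factor [- i * expi ga], so [ga] sets the
    final phase at will, including the free phase [w]. *)
Lemma rot_phase a (w : R) (p : R) : exists ga : R,
  expi w * (- ('i%C * expi ga * a)) = (cmod a)%:C * expi p.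
Proof.
have [pa Ea] := polar a; exists (p - w - pa + pi / 2).
have ei : - 'i%C * expi (pi / 2) = 1 :> R[i].
  by apply: cplxP; rewrite !cpxE /= cos_pihalf sin_pihalf; ring.
rewrite {1}Ea (expiD (p - w - pa)) (expiD (p - w)) (expiD p).
rewrite (_ : _ * _ = (- 'i%C * expi (pi / 2)) * (expi w * expi (- w)) * (expi (- pa) * expi pa) *
  ((cmod a)%:C * expi p)); last by ring.
by rewrite ei expiMN expiNM !mul1r.
Qed.

End PlaneRotations.

(** * Durations of the rotations *)

Section Clock.
Context {R : realType}.

(* The duration spent in the plane (k, k + 1) is [clock k - clock k.+1], of order k^(-3/2): both
   this and the error, of order 1 / (duration * k^3), are then summable. *)
Definition clock (k : nat) : R := 2 / Num.sqrt k.-1%:R.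

(** With [a] and [b] the square roots of [k - 1] and [k], the step is [2 / (a * b * (a + b))], at
    least [1 / b ^+ 3] because [a <= b]. The predecessor in [clock] gives the constant 1 here. *)
Lemma clock_step k : (1 < k)%N -> 0 < clock k - clock k.+1 /\
  1 <= (clock k - clock k.+1) ^+ 2 * k%:R ^+ 3.
Proof.
case: k => [|[|k]] // _; rewrite /clock /=.
set a := Num.sqrt k.+1%:R; set b := Num.sqrt k.+2%:R.
have a0 : 0 < a by rewrite sqrtr_gt0.
have aa : a ^+ 2 = k.+1%:R by rewrite sqr_sqrtr.
have bb : b ^+ 2 = a ^+ 2 + 1 by rewrite aa natr1 sqr_sqrtr.
have ab : a <= b by apply: ler_wsqrtr; rewrite ler_nat.
have b0 : 0 < b by apply: lt_le_trans ab.
have E : 2 / a - 2 / b = 2 / (a * b * (a + b)).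
  have : (b - a) * (a + b) = 1 by rewrite -(addrK (a ^+ 2) 1) [1 + _]addrC -bb; ring.
  move=> h; have n0 : a * b * (a + b) != 0 by rewrite gt_eqF ?mulr_gt0 ?addr_gt0.
  apply: (mulIf n0); rewrite divfK //; transitivity (2 * ((b - a) * (a + b))); last by rewrite h mulr1.
  by field; rewrite !gt_eqF.
have le3 : (b ^+ 3)^-1 <= 2 / a - 2 / b.
  rewrite E ler_pdivlMr ?mulr_gt0 ?addr_gt0 // mulrC ler_pdivrMr ?exprn_gt0 //.
  rewrite (_ : 2 * b ^+ 3 = b * b * (b + b)); last by ring.
  apply: ler_pM; rewrite ?ler_pM2r ?lerD2r //; first by rewrite ltW ?mulr_gt0.
  by rewrite ltW ?addr_gt0.
have h0 : 0 < (b ^+ 3)^-1 by rewrite invr_gt0 exprn_gt0.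
split; first exact: lt_le_trans le3.
have -> : k.+2%:R ^+ 3 = (b ^+ 3) ^+ 2 by rewrite -exprM mulnC exprM sqr_sqrtr.
rewrite -exprMn -[leLHS](expr1n _ 2) ler_pXn2r ?nnegrE //; last first.
  by apply: mulr_ge0; [exact: le_trans (ltW h0) le3|apply: exprn_ge0; exact: ltW].
by rewrite -ler_pdivrMr ?exprn_gt0 // mul1r.
Qed.

Lemma clock_mono k l : (1 < k)%N -> (k <= l)%N -> clock l <= clock k.
Proof.
move=> k1 /subnKC <-; elim: (l - k)%N => [|n IH]; first by rewrite addn0.
rewrite addnS; apply: le_trans IH; have [] := @clock_step (k + n) _; last by rewrite subr_gt0 => /ltW.
by rewrite ltn_addr.
Qed.

Lemma clock_ge0 k : 0 <= clock k. Proof. by rewrite divr_ge0 ?sqrtr_ge0. Qed.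

Lemma clock_small (e : R) : 0 < e -> exists N, (1 < N)%N /\ clock N <= e.
Proof.
move=> e0; pose n := (Num.bound (4 / e ^+ 2)).+1; exists n.+1; split => //.
have n0 : 0 < Num.sqrt n%:R :> R by rewrite sqrtr_gt0 ltr0n.
rewrite /clock /= ler_pdivrMr // mulrC -ler_pdivrMr //.
rewrite -[leLHS]ger0_norm ?divr_ge0 // ?(ltW e0) // -sqrtr_sqr; apply: ler_wsqrtr.
rewrite expr_div_n (_ : 2 ^+ 2 = 4); last by ring.
apply: le_trans (ltW (archi_boundP _)) _; first by rewrite divr_ge0 // exprn_ge0 // ltW.
by rewrite ler_nat.
Qed.

(** The three terms are the times of the descent to [N], of the transfer to [N.+1] and of the ascent
    from [N.+1]. *)
Definition chain_time N n n' : R := clock N - clock (N + n) + (clock N - clock N.+1) +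
  (clock N.+1 - clock (N.+1 + n')).

Lemma chain_time_bounds N n n' : (1 < N)%N ->
  0 < chain_time N n n' /\ chain_time N n n' <= 2 * clock N.
Proof.
move=> N1; have [t0 _] := clock_step N1.
have h1 := @clock_mono N (N + n) N1 (leq_addr _ _).
have h2 := @clock_mono N.+1 (N.+1 + n') (leqW N1) (leq_addr _ _).
have h3 := clock_ge0 (N + n); have h4 := clock_ge0 (N.+1 + n').
have h5 := clock_ge0 N.+1.
by rewrite /chain_time; split; lra.
Qed.

End Clock.

(** * Chains of rotations among the high modes *)

Section Chain.
Context {R : realType}.
Variable alpha : R.
Hypothesis halpha : 5 / 2 < alpha.
Local Notation lam := (freq alpha).
Local Notation steer := (steer lam).
Implicit Types (x y z : nat -> R[i]) (a b : R[i]).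
Local Notation cmod z := (Num.sqrt (sqn z)).
Local Notation clock := (@clock R).

(** The lower bound on [tau ^+ 2 * k ^+ 3] converts the error into a multiple of the duration, so
    that the errors of a chain telescope like its times. *)
Lemma steer_plane k th ga x J : (1 < k)%N -> `|th| <= 2 ->
  (forall j, (J <= j)%N -> x j = 0) -> l2le x 1 ->
  steer x (fun j => expi (lam j * (clock k - clock k.+1)) * rot k th ga x j)
    (clock k - clock k.+1) (11 * (clock k - clock k.+1)).
Proof.
move=> k1 th2 xs x1; have [t0 t3] := @clock_step R k k1.
set tau := clock k - _ in t0 t3 *.
have kp : (0 < k)%N by apply: ltnW.
have D0 : 0 < 20 * k%:R ^+ 3 :> R by rewrite mulr_gt0 // exprn_gt0 // ltr0n.
(* The rotation errs by [208 / 20 = 104 / 10] times [tau]; the sampling allowance fills this up to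
   11. *)
have d0 : 0 < 6 / 10 * tau by rewrite mulr_gt0.
have := steer_rot ga kp D0 (fun j _ => @gap_separated _ _ halpha j k kp)
   (fun j _ => @gap_separatedD _ _ halpha j k kp) th2 t0 d0 xs x1.
apply: steer_weak.
have : 208 / (tau * (20 * k%:R ^+ 3)) <= 104 / 10 * tau.
  rewrite (ler_pdivrMr _ _ (mulr_gt0 t0 D0)).
  have -> : 104 / 10 * tau * (tau * (20 * k%:R ^+ 3)) = 208 * (tau ^+ 2 * k%:R ^+ 3) by field.
  by rewrite -[leLHS]mulr1 ler_pM2l.
move=> h; apply: le_trans (lerD h (lexx _)) _; lra.
Qed.

Definition delta N a (k : nat) : R[i] := if k == N then a else 0.

Lemma delta_supp N a k : (N.+1 <= k)%N -> delta N a k = 0.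
Proof. by move=> h; rewrite /delta gtn_eqF. Qed.

Lemma l2_delta N a : l2 (delta N a).
Proof. exact: l2_supp (@delta_supp N a). Qed.

Lemma sqn_phase t j a : sqn (expi (lam j * t) * a) = sqn a.
Proof. by rewrite sqnM sqn_expi mul1r. Qed.

Lemma nrm_phase t K x : nrm K (fun j => expi (lam j * t) * x j) = nrm K x.
Proof. by rewrite /nrm; congr Num.sqrt; apply: eq_bigr => i _; rewrite sqn_phase. Qed.

(** Each rotation empties the highest occupied mode into the one below, and preserves the norm,
    until everything sits on the mode [N]. *)
Lemma chain_down N n x : (1 < N)%N -> (forall k, (k < N)%N -> x k = 0) ->
  (forall k, (N + n.+1 <= k)%N -> x k = 0) -> l2le x 1 ->
  exists a, cmod a = nrm (N + n.+1) x /\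
    steer x (delta N a) (clock N - clock (N + n)) (11 * (clock N - clock (N + n))).
Proof.
move=> N1; elim: n x => [|n IH] x xl xs x1.
  have xE : x = delta N (x N).
    apply/funext => k; rewrite /delta; case: eqP => [->//|/eqP].
    by rewrite neq_ltn => /orP[/xl //|kN]; apply: xs; rewrite addn1.
  exists (x N); split.
    rewrite addn1 /nrm big_ord_recr /= big1 ?add0r // => i _.
    by rewrite xl ?sqn0 // ltn_ord.
  rewrite addn0 subrr mulr0 -xE; exact: steer_refl.
set k := (N + n)%N; have k1 : (1 < k)%N by rewrite ltn_addr.
have [th [ga [th2 kill]]] := rot_annihilates (x k) (x k.+1).
have st := steer_plane ga k1 th2 xs x1.
set y := (fun j => _) in st.
have kJ : (k.+1 < N + n.+2)%N by rewrite !addnS.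
have ys j : (N + n.+1 <= j)%N -> y j = 0.
  rewrite addnS leq_eqVlt => /orP[/eqP <-|h].
    by rewrite /y /rot (gtn_eqF (ltnSn k)) eqxx kill mulr0.
  by rewrite /y (rot_supp th ga kJ xs) ?mulr0 // !addnS.
have yl j : (j < N)%N -> y j = 0.
  move=> jN; have jk : (j < k)%N by rewrite (leq_trans jN) ?leq_addr.
  by rewrite /y /rot !ltn_eqF ?xl ?mulr0 // ltnW.
have y1 : l2le y 1 by move=> K; rewrite nrm_phase; apply: l2le_rot.
have [a [aE sa]] := IH y yl ys y1; exists a; split.
  rewrite aE -(nrm_supp (_ : (N + n.+1 <= N + n.+2)%N) ys) ?leq_add2l //.
  by rewrite nrm_phase nrm_rot.
have := steer_trans (l2_supp xs) (l2_supp ys) st sa.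
rewrite -mulrDr; have -> : clock k - clock k.+1 + (clock N - clock (N + n)) =
  clock N - clock (N + n.+1) by rewrite -/k addnS -/k; ring.
exact.
Qed.

(** The descent run backwards. Since time cannot be reversed, the target is first freed of the
    phases that the last step will add, and the last step is the rotation of opposite angle. *)
Lemma chain_up N n x : (1 < N)%N -> (forall k, (k < N)%N -> x k = 0) ->
  (forall k, (N + n.+1 <= k)%N -> x k = 0) -> l2le x 1 ->
  exists a, cmod a = nrm (N + n.+1) x /\
    steer (delta N a) x (clock N - clock (N + n)) (11 * (clock N - clock (N + n))).
Proof.
move=> N1; elim: n x => [|n IH] x xl xs x1.
  have xE : x = delta N (x N).
    apply/funext => k; rewrite /delta; case: eqP => [->//|/eqP].
    by rewrite neq_ltn => /orP[/xl //|kN]; apply: xs; rewrite addn1.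
  exists (x N); split.
    rewrite addn1 /nrm big_ord_recr /= big1 ?add0r // => i _.
    by rewrite xl ?sqn0 // ltn_ord.
  rewrite addn0 subrr mulr0 -xE; exact: steer_refl.
set k := (N + n)%N; have k1 : (1 < k)%N by rewrite ltn_addr.
pose tau := clock k - clock k.+1.
(* The free phases acquired during [tau] turn [w] into [x]. *)
pose w j := expi (lam j * - tau) * x j.
have [th [ga [th2 kill]]] := rot_annihilates (w k) (w k.+1).
have kJ : (k.+1 < N + n.+2)%N by rewrite !addnS.
have ws j : (N + n.+2 <= j)%N -> w j = 0 by move=> h; rewrite /w xs ?mulr0.
pose y := rot k th ga w.
have ys j : (N + n.+1 <= j)%N -> y j = 0.
  rewrite addnS leq_eqVlt => /orP[/eqP <-|h].
    by rewrite /y /rot (gtn_eqF (ltnSn k)) eqxx kill.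
  by rewrite /y (rot_supp th ga kJ ws) // !addnS.
have yl j : (j < N)%N -> y j = 0.
  move=> jN; have jk : (j < k)%N by rewrite (leq_trans jN) ?leq_addr.
  by rewrite /y /rot !ltn_eqF ?/w ?xl ?mulr0 // ltnW.
have y1 : l2le y 1 by apply: l2le_rot => K; rewrite nrm_phase.
have [a [aE sa]] := IH y yl ys y1; exists a; split.
  rewrite aE -(nrm_supp (_ : (N + n.+1 <= N + n.+2)%N) ys) ?leq_add2l //.
  by rewrite nrm_rot // nrm_phase.
have th2' : `|- th| <= 2 by rewrite normrN.
have := steer_plane ga k1 th2' ys y1; rewrite -/tau.
have -> : (fun j => expi (lam j * tau) * rot k (- th) ga y j) = x.
  by apply/funext => j; rewrite rotN /w mulrA mulrN expiMN mul1r.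
move=> st; have := steer_trans (l2_delta N a) (l2_supp ys) sa st.
rewrite -mulrDr; have -> : clock N - clock (N + n) + tau =
  clock N - clock (N + n.+1) by rewrite /tau -/k addnS -/k; ring.
exact.
Qed.

(** A quarter turn with a suitable phase gives the new mode the argument of [b]; besides the cost of
    the rotation, only the mismatch of moduli remains. *)
Lemma connect N a b : (1 < N)%N -> cmod a <= 1 ->
  steer (delta N a) (delta N.+1 b) (clock N - clock N.+1)
    (11 * (clock N - clock N.+1) + `|cmod a - cmod b|).
Proof.
move=> N1 a1; set tau := _ - _; have [p Eb] := polar b.
have [ga h] := rot_phase a (lam N.+1 * tau) p.
have th2 : `|pi / 2| <= 2 :> R.
  by rewrite ger0_norm ?divr_ge0 ?pi_ge0 // ltW // pihalf_lt2.
have n1 : l2le (delta N a) 1.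
  apply: (@l2le_from _ N.+1) => K NK; rewrite (nrm_supp NK (@delta_supp N a)).
  rewrite /nrm big_ord_recr /= big1 ?add0r ?/delta ?eqxx // => i _.
  by rewrite ltn_eqF ?ltn_ord // sqn0.
have := steer_plane ga N1 th2 (@delta_supp N a) n1; rewrite -/tau.
have -> : (fun j => expi (lam j * tau) * rot N (pi / 2) ga (delta N a) j) =
    delta N.+1 ((cmod a)%:C * expi p).
  apply/funext => j; rewrite /rot /delta cos_pihalf sin_pihalf (gtn_eqF (ltnSn N)) !eqxx.
  rewrite rmorph0 rmorph1 !mul0r !sub0r !mulr0 oppr0 mulr1.
  case: (eqVneq j N) => [->|jN]; first by rewrite (ltn_eqF (ltnSn N)) mulr0.
  by case: (eqVneq j N.+1) => [->|_]; rewrite ?mulr0.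
have d : l2le (fun k => delta N.+1 ((cmod a)%:C * expi p) k - delta N.+1 b k) `|cmod a - cmod b|.
  apply: (@l2le_from _ N.+2) => K NK; rewrite (nrm_supp NK); last first.
    by move=> k Nk; rewrite !delta_supp ?subrr.
  rewrite /nrm big_ord_recr /= big1 ?add0r; last first.
    by move=> i _; rewrite /delta ltn_eqF ?ltn_ord // subrr sqn0.
  rewrite /delta eqxx [in X in _ - X]Eb -mulrBl -rmorphB sqnM sqn_expi mulr1 cmod_real.
  exact: lexx.
move=> st; have := steer_near (l2_delta N a) (l2_delta N a) _ d st.
move=> /(_ 0) H; rewrite -[11 * tau]add0r; apply: H => K.
by rewrite (@eq_nrm _ _ _ (fun=> 0)) ?nrm0 // => j _; rewrite subrr.
Qed.

Lemma steer_high N n n' x z : (1 < N)%N ->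
  (forall k, (k < N)%N -> x k = 0) -> (forall k, (N + n.+1 <= k)%N -> x k = 0) -> l2le x 1 ->
  (forall k, (k < N.+1)%N -> z k = 0) -> (forall k, (N.+1 + n'.+1 <= k)%N -> z k = 0) -> l2le z 1 ->
  steer x z (chain_time N n n') (22 * clock N + `|nrm (N + n.+1) x - nrm (N.+1 + n'.+1) z|).
Proof.
move=> N1 xl xs x1 zl zs z1.
have [a [aE sa]] := chain_down N1 xl xs x1.
have [b [bE sb]] := chain_up (leqW N1 : (1 < N.+1)%N) zl zs z1.
have a1 : cmod a <= 1 by rewrite aE; apply: x1.
have := steer_trans (l2_supp xs) (l2_delta N.+1 b)
  (steer_trans (l2_supp xs) (l2_delta N a) sa (connect b N1 a1)) sb.
apply: steer_weak; rewrite -aE -bE.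
have [_] := @chain_time_bounds R N n n' N1; rewrite /chain_time.
set A := cmod a; set B := cmod b; set d := `|_|; lra.
Qed.

End Chain.

(** * Kicks by multiplication with exp(-i c cos) and their decay on low modes *)

Section MultiplicationFlow.
Context {R : realType}.
Local Notation mu := (torus R).
Implicit Types (psi chi : wave R) (c : R).
Local Notation cmod z := (Num.sqrt (sqn z)).

Lemma L2norm_le_scale psi chi (M : R) : 0 <= M -> L2 psi -> L2 chi ->
  (forall t, sqn (psi t) <= M ^+ 2 * sqn (chi t)) -> L2norm psi <= M * L2norm chi.
Proof.
move=> M0 hp hc h; rewrite -(@ler_pXn2r _ 2) ?nnegrE ?mulr_ge0 ?L2norm_ge0 //.
rewrite exprMn !L2norm_sqr; have [ip _] := inner_integrable hp hp.
have [ic _] := inner_integrable hc hc.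
rewrite /inner /= -RintegralZl //; apply: le_Rintegral => // [|t _].
  exact: integrable_mull.
have E (z : R[i]) : complex.Re (z^* * z) = sqn z by rewrite /sqn !cpxE; ring.
by rewrite !E.
Qed.

Lemma expi_quadratic (s : R) : cmod (expi s - 1 - 'i%C * s%:C) <= s ^+ 2.
Proof.
have := @nrm_mvt R 1 (fun _ s => expi (1 * s + 0) - 1 - 'i%C * s%:C)
  (fun _ s => 'i%C * (expi (1 * s + 0) - 1)) `|s| s (normr_ge0 s).
rewrite mul1r !addr0 mulr0 expi0 subrr rmorph0 mulr0 subr0 nrm0 add0r.
rewrite /nrm big_ord1 -expr2 real_normK ?num_real //; apply => [k u _ _|u us].
  apply: cderive_eq (cderiveB (cderiveB (cderive_expi 1 0 u) (cderive_cst 1 u))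
    (cderiveZ 'i%C (cderive_id u))) _.
  by rewrite subr0 rmorph1 mulr1; ring.
by rewrite big_ord1 sqnM sqn_i mul1r mul1r addr0; apply: le_trans (cmod_expiB1 _) us.
Qed.

Definition kicked c psi : wave R := fun t => expi (- (c * cos t)) * psi t.

Lemma bm_comp_cos (f : R -> R) c M : continuous f -> (forall u, `|f u| <= M) ->
  bm (fun t => f (c * cos t)).
Proof.
move=> cf fM; split; last by exists M.
apply: continuous_measurable_fun => t.
apply: (@continuous_comp _ _ _ (fun t => c * cos t) f); last exact: cf.
by apply: cvgMr; apply: continuous_cos.
Qed.

Lemma bm_kick_cos c : bm (fun t : R => cos (c * cos t)).
Proof. by apply: (@bm_comp_cos _ _ 1); [exact: continuous_cos|exact: cos_max]. Qed.

Lemma bm_kick_sin c : bm (fun t : R => sin (c * cos t)).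
Proof. by apply: (@bm_comp_cos _ _ 1); [exact: continuous_sin|exact: sin_max]. Qed.

Lemma Ho_kicked c psi : Ho psi -> Ho (kicked c psi).
Proof.
move=> [pL po]; split.
  have [mc [M hM]] := bm_kick_cos c; have [ms [N hN]] := bm_kick_sin c.
  have := L2ZD (- 'i%C) (L2_bmul ms hN pL) (L2_bmul mc hM pL).
  rewrite (_ : kicked c psi = fun t => - 'i%C * ((sin (c * cos t))%:C * psi t) + (cos (c * cos t))%:C * psi t) //.
  apply/funext => t; rewrite /kicked /expi cosN sinN.
  by apply: cplxP; rewrite !cpxE /=; ring.
apply: (@filterS _ _ (ae_filter_ringOfSetsType mu)) po => t h.
by rewrite /kicked cosN h mulrN.
Qed.

Lemma kicked0 psi : kicked 0 psi = psi.
Proof. by apply/funext => t; rewrite /kicked mul0r oppr0 expi0 mul1r. Qed.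

Lemma kickedZD c (a : R[i]) psi chi :
  kicked c (fun t => a * psi t + chi t) = (fun t => a * kicked c psi t + kicked c chi t).
Proof. by apply/funext => t; rewrite /kicked; ring. Qed.

Lemma kicked_opB c psi : kicked c (opB psi) = opB (kicked c psi).
Proof. by apply/funext => t; rewrite /kicked /opB; ring. Qed.

(** The explicit multiplication solves the equation with zero frequencies and control 1 at time [c],
    with a Taylor remainder at most [h ^+ 2 * L2norm psi]; uniqueness identifies it. *)
Lemma coef_kicked c psi : Ho psi -> coef (kicked c psi) = grp (fun=> 0) 1 c (coef psi).
Proof.
move=> hp; rewrite -[in RHS](kicked0 psi).
apply: (@grp_unique _ (fun=> 0) 1 (fun s => coef (kicked s psi)) (fun s => coef (opB (kicked s psi)))).
- by move=> s; apply: coef_l2; apply: Ho_kicked.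
- by move=> s; apply: coef_l2; apply: Ho_opB; apply: Ho_kicked.
- move=> s k; rewrite /seq_gen rmorph0 mulr0 mul0r add0r rmorph1 mul1r.
  by apply: coef_opB; apply: Ho_L2; apply: Ho_kicked.
move=> s e e0; pose Q := L2norm psi + 1.
have Q0 : 0 < Q by rewrite ltr_wpDl // L2norm_ge0.
exists (e / Q); split; first by rewrite divr_gt0.
move=> h hh; have h1 := Ho_kicked (s + h) hp; have h2 := Ho_kicked s hp.
have h3 := Ho_opB h2; pose D t := - h%:C * opB (kicked s psi) t + (kicked (s + h) psi t - kicked s psi t).
have hB := Ho_B h1 h2; have hD : Ho D by apply: Ho_ZD.
suff: L2norm D <= e * `|h|.
  move=> H K; apply: le_trans H; apply: le_trans (bessel (Ho_L2 hD) K).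
  rewrite le_eqVlt; apply/orP; left; apply/eqP; apply: eq_nrm => k _.
  rewrite (coefZD _ _ (Ho_L2 h3) (Ho_L2 hB)) (coefB _ (Ho_L2 h1) (Ho_L2 h2)); ring.
apply: le_trans (_ : h ^+ 2 * L2norm psi <= _).
  apply: L2norm_le_scale; rewrite ?sqr_ge0 //; try exact: Ho_L2.
  move=> t; have -> : D t = (expi (- (h * cos t)) - 1 - 'i%C * (- (h * cos t))%:C) * (kicked s psi t).
    rewrite /D /opB /kicked (_ : - ((s + h) * cos t) = - (s * cos t) + - (h * cos t)); last by ring.
    by rewrite expiD rmorphN rmorphM /=; ring.
  rewrite sqnM; have -> : sqn (kicked s psi t) = sqn (psi t) by rewrite /kicked sqnM sqn_expi mul1r.
  apply: ler_wpM2r; first exact: sqn_ge0.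
  rewrite -[leLHS]sqr_sqrtr ?sqn_ge0 //; rewrite ler_pXn2r ?nnegrE ?sqrtr_ge0 ?sqr_ge0 //.
  apply: le_trans (expi_quadratic _) _; rewrite sqrrN exprMn -[leRHS]mulr1 ler_wpM2l ?sqr_ge0 //.
rewrite -real_normK ?num_real // expr2 -mulrA mulrC ler_wpM2r //.
apply: le_trans (ler_wpM2r (L2norm_ge0 psi) hh) _.
rewrite mulrAC ler_pdivrMr // ler_pM2l // lerDl //.
Qed.

Lemma Rintegral_bound (g : R -> R) M : bm g -> (forall t, `|g t| <= M) ->
  `|\int[mu]_t g t| <= M * \int[mu]_t 1.
Proof.
move=> bg gM; have ig := bm_integrable bg.
apply: le_trans (le_normr_Rintegral measurableT ig) _.
have i1 := bm_integrable (bm_cst (1 : R)).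
rewrite -RintegralZl //; apply: le_Rintegral => //.
- exact: (integrable_norm ig).
- exact: integrable_mull.
by move=> t _; rewrite mulr1.
Qed.

Definition decays psi := forall k e, 0 < e -> exists C, forall c, C <= `|c| ->
  cmod (coef (kicked c psi) k) <= e.

Lemma decaysZD (a : R[i]) psi chi : Ho psi -> Ho chi -> decays psi -> decays chi ->
  decays (fun t => a * psi t + chi t).
Proof.
move=> hp hc dp dc k e e0; pose q := cmod a + 1.
have q0 : 0 < q by rewrite ltr_wpDl // sqrtr_ge0.
have e2 : 0 < e / 2 by rewrite divr_gt0.
have [C1 h1] := dp k _ (divr_gt0 e2 q0); have [C2 h2] := dc k _ e2.
exists (Num.max C1 C2) => c; rewrite ge_max => /andP[/h1 g1 /h2 g2].
rewrite kickedZD coefZD; try by apply: Ho_L2; apply: Ho_kicked.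
apply: le_trans (cmodD _ _) _; rewrite cmodM [e]splitr lerD //.
rewrite ler_pdivlMr // in g1; apply: le_trans g1; rewrite mulrC ler_wpM2l ?sqrtr_ge0 //.
by rewrite lerDl.
Qed.

(** The kick commutes with multiplication by the cosine, so a coefficient of the image is a
    combination of two neighbouring coefficients that decay. *)
Lemma decays_opB psi : Ho psi -> decays psi -> decays (opB psi).
Proof.
move=> hp dp [|k] e e0.
  by exists 0 => c _; rewrite coef0 sqn0 sqrtr0 ltW.
have [C1 h1] := dp k.+2 e e0; have [C2 h2] := dp k e e0.
exists (Num.max C1 C2) => c; rewrite ge_max => /andP[/h1 g1 /h2 g2].
rewrite kicked_opB coef_opB; last by apply: Ho_L2; apply: Ho_kicked.
rewrite /tri mul1r cmodM sqn_mhi.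
have -> : Num.sqrt 4^-1 = 2^-1 :> R.
  by rewrite (_ : 4^-1 = 2^-1 ^+ 2) ?sqrtr_sqr ?ger0_norm // expr2 -invfM; congr _^-1; ring.
rewrite mulrC ler_pdivrMr // mulrDr mulr1; apply: le_trans (cmodD _ _) _; apply: lerD => //.
rewrite cmodM sqnJ; apply: le_trans _ g2; rewrite -[leRHS]mul1r ler_wpM2r ?sqrtr_ge0 //.
by rewrite -[leRHS]sqrtr1 ler_wsqrtr //; have := @sqn_bco R k; rewrite expr1n.
Qed.

(** The factor [sin t] is, up to sign, the derivative of the phase [cos t], and no stationary phase
    analysis is called for: the oscillating factor is [1 / c] times a derivative. Boundary terms
    vanish because [sin (k * pi) = 0]. *)
Lemma kick_by_parts (k : nat) c : c != 0 ->
  \int[mu]_t (cos (c * cos t) * sin t * sin (k%:R * t)) =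
    c^-1 * \int[mu]_t (k%:R * sin (c * cos t) * cos (k%:R * t)) /\
  \int[mu]_t (sin (c * cos t) * sin t * sin (k%:R * t)) =
    - c^-1 * \int[mu]_t (k%:R * cos (c * cos t) * cos (k%:R * t)).
Proof.
move=> c0; have bs : bm (@sin R) by have := @bm_sinM R 1; under eq_fun do rewrite mul1r.
have bS := @bm_sinM R k%:R; have bC := @bm_cosM R k%:R.
have ks := bm_kick_sin c; have kc := bm_kick_cos c; have bk := @bm_cst R k%:R.
have i1 := bm_integrable (bmM (bmM kc bs) bS).
have i2 := bm_integrable (bmM (bmM ks bs) bS).
have i3 := bm_integrable (bmM (bmM bk ks) bC).
have i4 := bm_integrable (bmM (bmM bk kc) bC).
have dcos : continuous (fun t : R => c * cos t).
  by move=> t; apply: cvgMr; apply: continuous_cos.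
have cS : continuous (fun t : R => sin (k%:R * t)).
  move=> t; apply: (@continuous_comp _ _ _ (fun t : R => k%:R * t) sin); last exact: continuous_sin.
  by apply: cvgMr; exact: cvg_id.
have cC : continuous (fun t : R => cos (k%:R * t)).
  move=> t; apply: (@continuous_comp _ _ _ (fun t : R => k%:R * t) cos); last exact: continuous_cos.
  by apply: cvgMr; exact: cvg_id.
have cks : continuous (fun t : R => sin (c * cos t)).
  by move=> t; apply: (@continuous_comp _ _ _ (fun t => c * cos t) sin); [exact: dcos|exact: continuous_sin].
have ckc : continuous (fun t : R => cos (c * cos t)).
  by move=> t; apply: (@continuous_comp _ _ _ (fun t => c * cos t) cos); [exact: dcos|exact: continuous_cos].
have d1 (t : R) : is_derive t 1 (fun t => sin (c * cos t) * sin (k%:R * t))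
    (- c * (cos (c * cos t) * sin t * sin (k%:R * t)) + k%:R * sin (c * cos t) * cos (k%:R * t)).
  apply: is_derive_eq; rewrite /GRing.scale /= ?mulr1 ?mulr0 ?addr0 ?add0r; ring.
have d2 (t : R) : is_derive t 1 (fun t => cos (c * cos t) * sin (k%:R * t))
    (c * (sin (c * cos t) * sin t * sin (k%:R * t)) + k%:R * cos (c * cos t) * cos (k%:R * t)).
  apply: is_derive_eq; rewrite /GRing.scale /= ?mulr1 ?mulr0 ?addr0 ?add0r; ring.
have [_ [M1 b1]] := bmD (bmM (bm_cst (- c)) (bmM (bmM kc bs) bS)) (bmM (bmM bk ks) bC).
have [_ [M2 b2]] := bmD (bmM (bm_cst c) (bmM (bmM ks bs) bS)) (bmM (bmM bk kc) bC).
have c1 : continuous (fun t => - c * (cos (c * cos t) * sin t * sin (k%:R * t)) + k%:R * sin (c * cos t) * cos (k%:R * t)).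
  move=> t; apply: cvgD.
    by apply: cvgMr; apply: cvgM; [apply: cvgM; [exact: ckc|exact: continuous_sin]|exact: cS].
  by apply: cvgM; [apply: cvgMr; exact: cks|exact: cC].
have c2 : continuous (fun t => c * (sin (c * cos t) * sin t * sin (k%:R * t)) + k%:R * cos (c * cos t) * cos (k%:R * t)).
  move=> t; apply: cvgD.
    by apply: cvgMr; apply: cvgM; [apply: cvgM; [exact: cks|exact: continuous_sin]|exact: cS].
  by apply: cvgM; [apply: cvgMr; exact: ckc|exact: cC].
have := torus_FTC d2 c2 b2; have := torus_FTC d1 c1 b1.
rewrite !mulrN !sinN sin_natpi oppr0 !mulr0 subrr.
rewrite !RintegralD ?RintegralZl //; try exact: integrable_mull.
set A := \int[mu]_t _; set B := \int[mu]_t _; set C := \int[mu]_t _; set D := \int[mu]_t _.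
move=> h1 h2; split; apply: (mulfI c0); rewrite ?mulNr ?mulrN mulVKf //; lra.
Qed.

Lemma decays_phi1 : decays (@phi R 1).
Proof.
move=> k e e0; pose V := \int[mu]_t 1; pose C := 2 * k%:R * V / pi / e.
have V0 : 0 <= V by apply: Rintegral_ge0.
exists (C + 1) => c hc.
have sp0 : Num.sqrt pi != 0 :> R by rewrite sqrtr_eq0 -ltNge pi_gt0.
have spp : Num.sqrt pi ^+ 2 = pi :> R by rewrite sqr_sqrtr // ltW // pi_gt0.
have C0 : 0 <= C by rewrite !divr_ge0 ?mulr_ge0 // ?pi_ge0 // ltW.
have cp : 0 < `|c| by apply: lt_le_trans hc; rewrite ltr_wpDl.
have c0 : c != 0 by rewrite -normr_gt0.
have [P1 P2] := kick_by_parts k c0.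
have bC := @bm_cosM R k%:R; have bk := @bm_cst R k%:R.
have bound (f : R -> R) : bm f -> (forall u, `|f u| <= 1) ->
    `|\int[mu]_t (k%:R * f t * cos (k%:R * t))| <= k%:R * V.
  move=> bf f1; apply: Rintegral_bound; first exact: bmM (bmM bk bf) bC.
  move=> t; rewrite !normrM ger0_norm // -[leRHS]mulr1 ler_pM ?mulr_ge0 ?cos_max //.
  by rewrite -[leRHS]mulr1 ler_wpM2l.
have B1 := bound _ (bm_kick_sin c) (fun u => sin_max _).
have B2 := bound _ (bm_kick_cos c) (fun u => cos_max _).
have ks := bm_kick_sin c; have kc := bm_kick_cos c.
have bs : bm (@sin R) by have := @bm_sinM R 1; under eq_fun do rewrite mul1r.
have bS := @bm_sinM R k%:R.
have i1 := bm_integrable (bmM (bmM kc bs) bS).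
have i2 := bm_integrable (bmM (bmM ks bs) bS).
have E : coef (kicked c (phi 1)) k =
    (pi^-1 * \int[mu]_t (cos (c * cos t) * sin t * sin (k%:R * t))) +i*
    (- pi^-1 * \int[mu]_t (sin (c * cos t) * sin t * sin (k%:R * t))).
  rewrite /coef innerE; apply: cplxP => /=; rewrite -RintegralZl //; apply: eq_Rintegral => t _.
    set q := Num.sqrt pi in sp0 spp *; rewrite -spp cosN mul1r; field; exact: sp0.
  set q := Num.sqrt pi in sp0 spp *; rewrite -spp sinN mul1r; field; exact: sp0.
rewrite E P1 P2; set I1 := \int[mu]_t _ in B1 *; set I2 := \int[mu]_t _ in B2 *.
have cle (a b : R) : cmod (a +i* b) <= `|a| + `|b|.
  rewrite (_ : a +i* b = a%:C + 'i%C * b%:C); last by apply: cplxP; rewrite !cpxE /=; ring.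
  by apply: le_trans (cmodD _ _) _; rewrite cmodM sqn_i sqrtr1 mul1r !cmod_real.
apply: le_trans (cle _ _) _; rewrite !(normrM, normrN, normfV) (gtr0_norm (pi_gt0 R)).
have q0 : 0 <= pi^-1 * `|c|^-1 by rewrite mulr_ge0 // invr_ge0 ?pi_ge0.
rewrite !mulrA; apply: le_trans (lerD (ler_wpM2l q0 B1) (ler_wpM2l q0 B2)) _.
have hC : C <= `|c| by apply: le_trans hc; rewrite lerDl.
rewrite /C ler_pdivrMr // in hC.
rewrite (_ : _ + _ = 2 * k%:R * V / pi / `|c|); last first.
  by set p := pi^-1; ring.
by rewrite ler_pdivrMr // [leRHS]mulrC.
Qed.

(** Integration by parts handles [phi 1]; the recurrence that expresses [phi k.+2] as [2 cos] times
    [phi k.+1] minus [phi k] propagates the decay, the factor [2 i] turning [opB] into [2 cos]. *)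
Lemma decays_phi k : decays (@phi R k).
Proof.
have d0 : decays (@phi R 0).
  move=> k' e e0; exists 0 => c _; rewrite phi0E.
  rewrite (_ : kicked c (fun=> 0) = (fun t => 0 * @phi R 1 t)); last first.
    by apply/funext => t; rewrite /kicked mulr0 mul0r.
  by rewrite /coef innerZr ?mul0r ?sqn0 ?sqrtr0 ?ltW //; apply: L2_phi.
suff: decays (@phi R k) /\ decays (@phi R k.+1) by case.
elim: k => [|k [h1 h2]]; first by split; [exact: d0|exact: decays_phi1].
split; first exact: h2.
rewrite (_ : phi k.+2 = (fun t => (2 * 'i%C) * opB (phi k.+1) t + (-1 * phi k t + (fun=> 0) t))); last first.
  apply/funext => t; rewrite addr0 /opB.
  have ii : 'i%C * 'i%C = -1 :> R[i] by rewrite -expr2 sqr_i.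
  rewrite (_ : _ + _ = - ('i%C * 'i%C) * (2 * ((cos t)%:C * phi k.+1 t)) - phi k t); last by ring.
  rewrite ii opprK mul1r cos_phi mulrA.
  have -> : 2 * (2^-1)%:C = 1 :> R[i].
    by apply: cplxP; rewrite !cpxE /=; field.
  by rewrite mul1r addrK.
have hz : Ho (fun t => -1 * @phi R k t + (fun=> 0) t) by apply: Ho_ZD; [exact: Ho_phi|exact: Ho_0].
have z0 : decays (fun=> 0 : R[i]) by rewrite -phi0E.
have hB := Ho_opB (@Ho_phi R k.+1).
have d2 := decays_opB (@Ho_phi R k.+1) h2.
exact: (decaysZD (2 * 'i%C) hB hz d2 (decaysZD (-1) (@Ho_phi R k) (@Ho_0 R) h1 z0)).
Qed.

Lemma decays_fsyn K x : decays (fsyn K x).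
Proof.
elim: K => [|K IH].
  by rewrite (_ : fsyn 0 x = phi 0); [exact: decays_phi|apply/funext => t; rewrite /fsyn big_ord0 phi0E].
by rewrite fsynS; apply: decaysZD; [exact: Ho_phi|exact: Ho_fsyn|exact: decays_phi|].
Qed.

(** One threshold serves all modes below [N] and both signs of [c], which matters because source and
    target are kicked with opposite signs. *)
Lemma escape J x N e : x 0%N = 0 -> (forall k, (J <= k)%N -> x k = 0) -> 0 < e ->
  exists C, forall c, C <= `|c| -> nrm N (grp (fun=> 0) 1 c x) <= e.
Proof.
move=> x0 xs; have hf := Ho_fsyn J x.
have xE : coef (fsyn J x) = x.
  apply/funext => k; rewrite coef_fsyn; case: k => [|k] /=; first by rewrite x0.
  by case: ltnP => // /xs ->.
elim: N e => [|N IH] e e0.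
  by exists 0 => c _; rewrite /nrm big_ord0 sqrtr0 ltW.
have e2 : 0 < e / 2 by rewrite divr_gt0.
have [C1 h1] := IH _ e2; have [C2 h2] := decays_fsyn J x N e2.
exists (Num.max C1 C2) => c; rewrite ge_max => /andP[/h1 g1 /h2].
rewrite coef_kicked // xE => g2; rewrite [e]splitr; apply: le_trans (lerD g1 g2).
rewrite nrm_leP ?addr_ge0 ?nrm_ge0 ?sqrtr_ge0 // big_ord_recr /= -nrm_sqr.
set w := grp _ _ _ _; rewrite -[X in _ + X <= _]sqr_sqrtr ?sqn_ge0 //.
have := nrm_ge0 N w; have := sqrtr_ge0 (sqn (w N)).
set a := Num.sqrt _; set b := nrm N w => a0 b0.
by rewrite -subr_ge0 (_ : _ - _ = 2 * (a * b)) ?mulr_ge0 //; ring.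
Qed.


End MultiplicationFlow.

(** * Steering between arbitrary unit sequences *)

Section Assembly.
Context {R : realType}.
Implicit Types (x y z : nat -> R[i]) (a b : R[i]).
Local Notation cmod z := (Num.sqrt (sqn z)).
Local Notation kick c := (grp (fun=> 0 : R) 1 c).

Lemma l2le_ext x y e : (forall k, x k = y k) -> l2le x e -> l2le y e.
Proof. by move=> /funext ->. Qed.

Lemma l2le_delta N a : l2le (delta N a) (cmod a).
Proof.
apply: (@l2le_from _ N.+1) => K NK; rewrite (nrm_supp NK (@delta_supp _ N a)).
rewrite /nrm big_ord_recr /= big1 ?add0r ?/delta ?eqxx // => i _.
by rewrite ltn_eqF ?ltn_ord // sqn0.
Qed.

Lemma l2le_supp J x : (forall k, (J <= k)%N -> x k = 0) -> l2le x (nrm J x).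
Proof. by move=> xs; apply: (@l2le_from _ J) => K JK; rewrite (@nrm_supp _ J K). Qed.

(* In time [s] with control [c / s] the free evolution contributes only [s * lam] on the modes
   retained by the Galerkin approximation of the group generated by [B]. *)
Lemma short_kick (lam : nat -> R) J x c e T : (forall k, (J <= k)%N -> x k = 0) -> 0 < e -> 0 < T ->
  exists s, [/\ 0 < s, s <= T &
    l2le (fun k => grp lam (c / s) s x k - kick c x k) e].
Proof.
move=> xs e0 T0; have e3 : 0 < e / 3 by rewrite divr_gt0.
have lx := l2_supp xs; pose X := nrm J x.
have X0 : 0 <= X by apply: nrm_ge0.
pose W := nrm J (fun k => k%:R * x k) + X * `|c|.
have W0 : 0 <= W by rewrite addr_ge0 ?nrm_ge0 ?mulr_ge0.
have [N1 h1] := grp_cvg (fun=> 0) 1 c lx e3.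
(* The truncation is taken so large that its leak, integrated over the kick, is at most [e / 3]. *)
pose n := maxn (maxn J N1) (Num.bound (`|c| * W / (e / 3))).
have hn : `|c| * W / n.+1%:R <= e / 3.
  rewrite ler_pdivrMr // [leRHS]mulrC -ler_pdivrMr //.
  apply: le_trans (ltW (archi_boundP _)) _; first by rewrite divr_ge0 ?mulr_ge0 // ltW.
  by rewrite ler_nat /n leqW // leq_maxr.
pose N := n.+2.
have JN : (J <= N)%N by rewrite /N !leqW // /n !leq_max leqnn.
have N1N : (N1 <= N)%N by rewrite /N !leqW // /n !leq_max leqnn orbT.
have [L [L0 hL]] := lam_bound lam N.
(* The missing free evolution has norm at most [L * X], so it costs at most [e / 3] during [s]. *)
pose s := Num.min T (e / 3 / (L * X + 1)).
have LX : 0 < L * X + 1 by rewrite ltr_wpDl ?mulr_ge0.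
have s0 : 0 < s by rewrite lt_min T0 divr_gt0.
exists s; split => //; first by rewrite ge_min lexx.
(* The truncated kick is run at speed [c / s]; it solves the controlled equation up to the missing
   free term and the leak into row [N]. *)
pose w r := gal (fun=> 0) 1 N r x; pose y t := w (c / s * t).
have [ws wd] := gal_solves (fun=> 0) 1 N x.
have ys t k : (N <= k)%N -> y t k = 0 by apply: ws.
have nX : nrm N x = X by rewrite (nrm_supp JN).
have yb t : l2le (y t) X by move=> K; rewrite -nX; apply: nrm_galK.
have hW t : `|t| <= s -> cmod (y t n.+1) <= W / n.+1%:R.
  move=> ts; have := gal_weight (fun=> 0) 1 N (c / s * t) x.
  rewrite [nrm N (fun k => k%:R * x k)](nrm_supp JN) => [|k Jk]; last by rewrite xs ?mulr0.
  rewrite nX normr1 mul1r => h; rewrite ler_pdivlMr //.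
  have := @coord_le_nrm _ N (fun k => k%:R * gal (fun=> 0) 1 N (c / s * t) x k) n.+1 (ltnSn _).
  rewrite cmodM sqn_nat sqrtr_sqr ger0_norm // mulrC => h2; apply: le_trans h2 _.
  apply: le_trans h _; rewrite lerD2l ler_wpM2l // normrM normrM normfV (gtr0_norm s0).
  by rewrite mulrAC ler_pdivrMr // ler_wpM2l.
pose r t k := (if (k < N)%N then - ('i%C * (lam k)%:C * y t k) else 0) +
  delta N (- ((c / s)%:C * (mhi * y t n.+1))) k.
have yd t k : cderive (y^~ k) t (seq_gen lam (c / s) (y t) k + r t k).
  have [kN|Nk] := ltnP k N.
    have := wd (c / s * t + 0) k kN; move=> /cderive_affine h.
    apply: cderive_eq (eq_cderive h _) _; first by move=> u; rewrite addr0.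
    rewrite /r kN /delta (ltn_eqF kN) addr0 /seq_gen /y /w addr0 rmorph0 rmorph1; ring.
  rewrite (_ : y^~ k = fun=> 0); last by apply/funext => u; apply: ys.
  apply: cderive_eq (cderive_cst 0 t) _; rewrite /r ltnNge Nk /= add0r /seq_gen (ys t k Nk) mulr0 add0r.
  move: Nk; rewrite leq_eqVlt => /orP[/eqP <-|Nk].
    rewrite /delta eqxx /tri /= (ys t N.+1) // conjC1 !mul1r add0r; ring.
  rewrite /delta gtn_eqF // addr0 (@tri_supp _ _ _ N) ?mulr0 // => j; exact: ys.
pose E := L * X + `|c / s| * (W / n.+1%:R).
have E0 : 0 <= E by rewrite addr_ge0 ?mulr_ge0 ?divr_ge0.
have rb t : `|t| <= `|s| -> l2le (r t) E.
  rewrite (gtr0_norm s0) => ts; apply: l2leD => [K|].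
    apply: le_trans (_ : L * nrm K (y t) <= _); last by apply: ler_wpM2l => //; apply: yb.
    apply: nrm_scale => // k _; case: ifP => kN; last first.
      by rewrite sqn0 mulr_ge0 ?sqr_ge0 ?sqn_ge0.
    rewrite sqnN !sqnM sqn_i mul1r sqn_real ler_wpM2r ?sqn_ge0 //.
    by rewrite -[_ ^+ 2]real_normK ?num_real // ler_pXn2r ?nnegrE // hL.
  apply: l2le_weak (l2le_delta N _); rewrite sqnN cmodM cmod_real ler_wpM2l //.
  apply: le_trans (hW t ts); rewrite cmodM -[leRHS]mul1r ler_wpM2r ?sqrtr_ge0 //.
  by rewrite -[leRHS]sqrtr1 ler_wsqrtr // sqn_mhi invf_le1 // ler1n.
have := grp_duhamel E0 ys yd rb.
have -> : y 0 = x.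
  rewrite /y mulr0 /w gal0; apply/funext => k; rewrite /trunc; case: ltnP => // Nk.
  by rewrite xs // (leq_trans JN).
have -> : y s = w c by rewrite /y divfK // gt_eqF.
rewrite (gtr0_norm s0) => h.
have := l2le_triangle (l2le_distC h) (h1 N N1N).
apply: l2le_weak; rewrite [leRHS](_ : e = e / 3 + e / 3 + e / 3); last by field.
rewrite lerD2r /E mulrDl; apply: lerD.
  apply: le_trans (_ : (L * X + 1) * (e / 3 / (L * X + 1)) <= _); last by rewrite mulrC divfK ?gt_eqF.
  apply: ler_pM; rewrite ?mulr_ge0 ?(ltW s0) //; first by rewrite lerDl.
  by rewrite ge_min lexx orbT.
rewrite normrM normfV (gtr0_norm s0); apply: le_trans hn.
rewrite [leLHS](_ : _ = `|c| * W / n.+1%:R) //; field; rewrite (gt_eqF s0) /=.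
by rewrite nat1r pnatr_eq0.
Qed.

Lemma nrm_kick J x c : (forall k, (J <= k)%N -> x k = 0) -> l2le (kick c x) (nrm J x) /\
  forall e, l2le (kick c x) e -> nrm J x <= e.
Proof.
move=> xs; have lx := l2_supp xs; split; first by apply: grp_le; apply: l2le_supp.
move=> e h; have := grp_le (fun=> 0) 1 (- c) h J.
by rewrite -grp_add // addNr grp0.
Qed.

(* A kick moves [x] to the high modes, up to [e]; [w'] is the resulting state cut to finitely
   many of them. *)
Lemma kick_high J x N e : x 0%N = 0 -> (forall k, (J <= k)%N -> x k = 0) -> l2le x 1 -> 0 < e ->
  exists C, forall c, C <= `|c| -> exists n w', [/\ forall k, (k < N)%N -> w' k = 0,
    forall k, (N + n.+1 <= k)%N -> w' k = 0, l2le w' 1,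
    l2le (fun k => kick c x k - w' k) e & `|nrm (N + n.+1) w' - nrm J x| <= e].
Proof.
move=> x0 xs x1 e0; have e2 : 0 < e / 2 by rewrite divr_gt0.
have lx := l2_supp xs; have [C hC] := escape N x0 xs e2; exists C => c /hC low.
have [m0 tail] := l2_tail (grp_l2 (fun=> 0) 1 c lx) e2.
set w := kick c x in low tail *; have mM : (m0 <= N + m0.+1)%N by rewrite addnS ltnW // ltnS leq_addl.
pose M := (N + m0.+1)%N; pose w' k : R[i] := if (k < N)%N then 0 else trunc M w k.
have w's k : (M <= k)%N -> w' k = 0 by move=> h; rewrite /w' trunc_supp // if_same.
have w1 : l2le w 1 by apply: grp_le.
have ww : l2le (fun k => w k - w' k) e.
  rewrite [e]splitr addrC; have {tail} := tail _ mM; rewrite -/M => tail.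
  have : l2le (trunc N w) (e / 2).
    move=> K; apply: le_trans low; have [h|h] := leqP K N.
      by apply: le_trans (nrm_trunc_le _ _ _) _; apply: nrm_mono.
    by rewrite (nrm_supp (ltnW h)) ?nrm_trunc // => k; apply: trunc_supp.
  move=> h; have := l2leD h tail; apply: l2le_ext => k.
  rewrite /w' /trunc; case: ifP => kN; last by rewrite add0r.
  by rewrite (leq_trans kN) ?leq_addr // subrr addr0 subr0.
exists m0, w'; split => //.
- by move=> k kN; rewrite /w' kN.
- move=> K; apply: le_trans (w1 K); rewrite -[leRHS]mul1r; apply: nrm_scale => // k _.
  rewrite expr1n mul1r /w' /trunc; by case: ifP => _; last case: ifP => _; rewrite ?sqn0 ?sqn_ge0.
have [k1 k2] := nrm_kick c xs; rewrite -/w in k1 k2.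
rewrite ler_distl; apply/andP; split.
  rewrite lerBlDr addrC; apply: k2 => K.
  apply: le_trans (_ : nrm K (fun k => (w k - w' k) + w' k) <= _).
    by rewrite le_eqVlt; apply/orP; left; apply/eqP; apply: eq_nrm => k _; rewrite subrK.
  by apply: le_trans (nrmD _ _ _) _; apply: lerD; [exact: ww|exact: l2le_supp].
apply: le_trans (_ : nrm M (fun k => w k - (w k - w' k)) <= _).
  by rewrite le_eqVlt; apply/orP; left; apply/eqP; apply: eq_nrm => k _; rewrite opprB addrC subrK.
by apply: le_trans (nrmB _ _ _) _; apply: lerD; [exact: k1|exact: ww].
Qed.

Variable alpha : R.
Hypothesis halpha : 5 / 2 < alpha.
Local Notation lam := (freq alpha).
Local Notation steer := (steer lam).

(** The target is sent to high modes by the kick of opposite sign, so that the kick [c] brings the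
    result back to it. Since rotations preserve norms, the mismatch of the two norms stays in the
    error. *)
Lemma steer_finite J J' x z e T : x 0%N = 0 -> (forall k, (J <= k)%N -> x k = 0) -> l2le x 1 ->
  z 0%N = 0 -> (forall k, (J' <= k)%N -> z k = 0) -> l2le z 1 -> 0 < e -> 0 < T ->
  steer x z T (e + `|nrm J x - nrm J' z|).
Proof.
move=> x0 xs x1 z0 zs z1 e0 T0; have e9 : 0 < e / 9 by rewrite divr_gt0.
have T8 : 0 < T / 8 by rewrite divr_gt0.
have e200 : 0 < e / 200 by rewrite divr_gt0.
(* The two kicks and twice [clock N] take at most half of [T]. The errors are two kicks of
   [2 * (e / 9)], the chains with [22 * (e / 200)], and [2 * (e / 9)] for the norms, less than [e]
   in all. *)
have d0 : 0 < Num.min (T / 8) (e / 200) by rewrite lt_min T8 e200.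
have [N [N1]] := clock_small d0; rewrite le_min => /andP[clT cle].
have [C1 h1] := kick_high N x0 xs x1 e9; have [C2 h2] := kick_high N.+1 z0 zs z1 e9.
pose c := Num.max `|C1| `|C2|.
have c0 : 0 <= c by rewrite le_max normr_ge0.
have [n [w [wl ws w1 ww wn]]] : exists n w', [/\ forall k, (k < N)%N -> w' k = 0,
    forall k, (N + n.+1 <= k)%N -> w' k = 0, l2le w' 1,
    l2le (fun k => kick c x k - w' k) (e / 9) & `|nrm (N + n.+1) w' - nrm J x| <= e / 9].
  by apply: h1; rewrite ger0_norm //; apply: le_trans (ler_norm _) _; rewrite le_max lexx.
have [n' [v [vl vs v1 vv vn]]] : exists n w', [/\ forall k, (k < N.+1)%N -> w' k = 0,
    forall k, (N.+1 + n.+1 <= k)%N -> w' k = 0, l2le w' 1,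
    l2le (fun k => kick (- c) z k - w' k) (e / 9) & `|nrm (N.+1 + n.+1) w' - nrm J' z| <= e / 9].
  by apply: h2; rewrite normrN ger0_norm //; apply: le_trans (ler_norm _) _; rewrite le_max lexx orbT.
have lx := l2_supp xs; have lz := l2_supp zs; have lw := l2_supp ws; have lv := l2_supp vs.
have [s1 [s10 s1T k1]] := short_kick lam c xs e9 T8.
have [s2 [s20 s2T k2]] := short_kick lam c vs e9 T8.
have kz : l2le (fun k => kick c v k - z k) (e / 9).
  have -> : (fun k => kick c v k - z k) = kick c (fun k => v k - kick (- c) z k).
    by rewrite (grpB _ _ _ lv (grp_l2 _ _ _ lz)) -(grp_add _ _ _ _ lz) subrr grp0.
  by apply: grp_le; apply: l2le_distC.
have st1 : steer x w s1 (2 * (e / 9)).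
  have h := l2le_triangle k1 ww; exists [:: (s1, c / s1)]; split; rewrite ?big_seq1 //= ?s10 //.
  by apply: l2le_weak h; lra.
have st4 : steer v z s2 (2 * (e / 9)).
  have h := l2le_triangle k2 kz; exists [:: (s2, c / s2)]; split; rewrite ?big_seq1 //= ?s20 //.
  by apply: l2le_weak h; lra.
pose tau : R := chain_time N n n'; have [tau0 tau1] := @chain_time_bounds R N n n' N1.
(* The idle time is spent between the first kick and the chain, where free evolution changes only
   phases and leaves the hypotheses of the chain intact. *)
pose r := T - s1 - s2 - tau; have r0 : 0 < r by rewrite /r /tau; lra.
pose w' k := expi (lam k * r) * w k.
have w's k : (N + n.+1 <= k)%N -> w' k = 0 by move=> h; rewrite /w' ws // mulr0.
have st2 : steer w w' r 0.
  by have := steer_cst lam 0 w r0; rewrite (grp_free _ _ ws).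
have st3 : steer w' v tau (22 * clock N + `|nrm (N + n.+1) w' - nrm (N.+1 + n'.+1) v|).
  apply: (steer_high halpha) => //.
    by move=> k kN; rewrite /w' wl // mulr0.
  by move=> K; rewrite nrm_phase.
rewrite nrm_phase in st3.
have lw' := l2_supp w's.
have := steer_trans lx lv (steer_trans lx lw' (steer_trans lx lw st1 st2) st3) st4.
have -> : s1 + r + tau + s2 = T by rewrite /r; ring.
apply: steer_weak.
have : `|nrm (N + n.+1) w - nrm (N.+1 + n'.+1) v| <= e / 9 + `|nrm J x - nrm J' z| + e / 9.
  rewrite distrC in vn; rewrite (_ : _ - nrm _ v = (nrm (N + n.+1) w - nrm J x) + (nrm J x - nrm J' z) +
    (nrm J' z - nrm (N.+1 + n'.+1) v)); last by ring.
  by apply: le_trans (ler_normD _ _) _; apply: lerD => //; apply: le_trans (ler_normD _ _) _; apply: lerD.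
set q := `|_ - nrm J' z|; set q' := `|_ - _|; lra.
Qed.

(** The pair of conditions on each sequence says that its l^2 norm is exactly 1. Cutting both
    sequences then leaves norms within [e / 8] of 1, which bounds the mismatch in [steer_finite]. *)
Lemma steer_l2 x z e T : x 0%N = 0 -> l2le x 1 -> (forall d, l2le x d -> 1 <= d) ->
  z 0%N = 0 -> l2le z 1 -> (forall d, l2le z d -> 1 <= d) -> 0 < e -> 0 < T -> steer x z T e.
Proof.
move=> x0 x1 x1' z0 z1 z1' e0 T0; have e8 : 0 < e / 8 by rewrite divr_gt0.
have lx : l2 x by exists 1. have lz : l2 z by exists 1.
have cut y : y 0%N = 0 -> l2le y 1 -> (forall d, l2le y d -> 1 <= d) -> exists J y',
    [/\ y' 0%N = 0, forall k, (J <= k)%N -> y' k = 0, l2le y' 1, l2le (fun k => y k - y' k) (e / 8) &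
     `|nrm J y' - 1| <= e / 8].
  move=> y0 y1 y1'; have ly : l2 y by exists 1.
  have [m /(_ m (leqnn m)) tail] := l2_tail ly e8; exists m, (trunc m y).
  have t1 : l2le (trunc m y) 1 by move=> K; apply: le_trans (nrm_trunc_le _ _ _) (y1 K).
  split => //; first by rewrite /trunc y0 if_same.
    by move=> k; apply: trunc_supp.
  rewrite ler_distl; apply/andP; split.
    rewrite lerBlDr; apply: y1'.
    have := l2leD (l2le_supp (@trunc_supp _ m y)) tail.
    by apply: l2le_ext => k; rewrite addrC subrK.
  by apply: le_trans (t1 m) _; rewrite lerDl ltW.
have [J [x' [x'0 x's x'1 xx xn]]] := cut x x0 x1 x1'.
have [J' [z' [z'0 z's z'1 zz zn]]] := cut z z0 z1 z1'.
have st := steer_finite x'0 x's x'1 z'0 z's z'1 e8 T0.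
have := steer_near lx (l2_supp x's) xx (l2le_distC zz) st.
apply: steer_weak.
have : `|nrm J x' - nrm J' z'| <= e / 8 + e / 8.
  rewrite distrC in zn; rewrite (_ : _ - _ = (nrm J x' - 1) + (1 - nrm J' z')); last by ring.
  by apply: le_trans (ler_normD _ _) _; apply: lerD.
set q := `|_|; lra.
Qed.


End Assembly.

(** * Controls as functions and as lists of steps *)

Section PiecewiseControls.
Context {R : realType}.
Implicit Types (u v : R -> R) (l : seq (R * R)) (a b : R).

Lemma steps_le u a l b : steps u a l b -> a <= b.
Proof.
elim: l a => [|[s c] l IH] a /=; first by move=> ->.
by move=> [s0 _ /IH]; apply: le_trans; rewrite lerDl ltW.
Qed.

Lemma steps_ext u v a l b : (forall x, a < x -> u x = v x) -> steps u a l b -> steps v a l b.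
Proof.
elim: l a => [|[s c] l IH] a h //= [s0 uc st]; split => //.
  by move=> x /andP[ax xs]; rewrite -h // uc // ax.
by apply: IH st => x ax; apply: h; apply: le_lt_trans ax; rewrite lerDl ltW.
Qed.

Fixpoint control a l : R -> R := fun x =>
  if l is (s, c) :: l' then if x < a + s then c else control (a + s) l' x else 0.

Lemma steps_control a l : all (fun p => 0 < p.1) l ->
  steps (control a l) a l (a + \sum_(p <- l) p.1).
Proof.
elim: l a => [|[s c] l IH] a /=; first by rewrite big_nil addr0.
move=> /andP[s0 h]; split => // [x /andP[_ ->] //|].
rewrite big_cons /= addrA; apply: steps_ext (IH (a + s) h) => x ax.
by rewrite ltNge (ltW ax).
Qed.

Lemma steps_value u a s c s' c' : 0 < s -> 0 < s' ->
  (forall x, a < x < a + s -> u x = c) -> (forall x, a < x < a + s' -> u x = c') -> c = c'.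
Proof.
move=> s0 s'0 h h'; pose m := Num.min s s' / 2.
have m0 : 0 < m by rewrite divr_gt0 // lt_min s0.
have ms : m < Num.min s s' by rewrite /m gtr_pMr ?invf_lt1 ?ltr1n // lt_min s0.
move: ms; rewrite lt_min => /andP[ms ms'].
by rewrite -(h (a + m)) ?(h' (a + m)) // !ltrD2l ltrDl m0.
Qed.

(** [Upsilon] picks an arbitrary subdivision adapted to the control, so its independence of the
    choice has to be shown. The first steps have the same value; the longer one is split at the end
    of the shorter one by the group law, and the total number of steps decreases. *)
Lemma flow_steps (lam : nat -> R) u a b l l' x : l2 x -> steps u a l b -> steps u a l' b ->
  flow lam l x = flow lam l' x.
Proof.
have [n] := ubnP (size l + size l'); elim: n => // n IH in a l l' x *.
case: l => [|[s c] l]; case: l' => [|[s' c'] l'] //=.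
- by move=> _ _ -> [s0 _ /steps_le]; rewrite leNgt ltrDl s0.
- by move=> _ _ [s0 _ /steps_le h] ab; move: h; rewrite ab leNgt ltrDl s0.
rewrite !(addSn, addnS) !ltnS => sz lx [s0 uc st] [s'0 uc' st'].
have cc := steps_value s0 s'0 uc uc'; rewrite -cc in uc' *.
have shrink r r' : 0 < r' -> r < r' -> (forall x, a < x < a + r' -> u x = c) ->
    forall x, a + r < x < a + r + (r' - r) -> 0 < r -> u x = c.
  move=> r'0 rr h y /andP[y1 y2] r0; apply: h.
  rewrite (le_lt_trans _ y1) ?lerDl ?(ltW r0) //.
  by rewrite (lt_le_trans y2) // -addrA [r + _]addrC subrK.
have [ss|ss|ss] := ltgtP s s'.
- have e1 : grp lam c s' x = grp lam c (s' - s) (grp lam c s x).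
    by rewrite -grp_add // subrK.
  rewrite e1; apply: (IH (a + s) l ((s' - s, c) :: l')) => //=.
  + by rewrite addnS.
  + exact: grp_l2.
  split; rewrite ?subr_gt0 //; last by rewrite -addrA [s + _]addrC subrK.
  by move=> y hy; apply: (shrink s s').
- have e1 : grp lam c s x = grp lam c (s - s') (grp lam c s' x).
    by rewrite -grp_add // subrK.
  rewrite e1; apply: (IH (a + s') ((s - s', c) :: l) l') => //=.
  + exact: grp_l2.
  split; rewrite ?subr_gt0 //; last by rewrite -addrA [s' + _]addrC subrK.
  by move=> y hy; apply: (shrink s' s).
rewrite -ss in st' *; apply: (IH (a + s)) => //; last exact: grp_l2.
by apply: leq_ltn_trans sz.
Qed.

End PiecewiseControls.

(** * Approximate controllability and the temporal diameter *)

Section Reachability.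
Context {R : realType}.
Variable alpha : R.
Implicit Types (psi chi : wave R) (u : R -> R) (l : seq (R * R)).

Lemma propagate_norm l psi : Ho psi -> L2norm (propagate alpha l psi) = L2norm psi.
Proof.
elim: l psi => [|[s c] l IH] psi hp //=.
rewrite IH; last exact: exp_op_Ho.
have [_ [_ hin] _ _ _] := exp_op_unitary alpha c.
by rewrite /L2norm hin.
Qed.

Lemma Upsilon_sphere u t psi : sphere psi -> sphere (Upsilon alpha u t psi).
Proof.
move=> [hp p1]; split; first by have [] := propagate_flow alpha (xget [::] [set l | steps u 0 l t]) hp.
by rewrite /Upsilon propagate_norm.
Qed.

Lemma Upsilon_flow u t l psi : Ho psi -> steps u 0 l t ->
  coef (Upsilon alpha u t psi) = flow (freq alpha) l (coef psi).
Proof.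
move=> hp st; rewrite /Upsilon; case: xgetP => [l' _ st'|/(_ l) //].
have [_ ->] := propagate_flow alpha l' hp.
exact: flow_steps (coef_l2 hp) st' st.
Qed.

Lemma sphere_phi1 : sphere (@phi R 1).
Proof.
split; first exact: Ho_phi.
by apply: L2normE => //; rewrite inner_phi expr1n.
Qed.

Hypothesis halpha : 5 / 2 < alpha.

Lemma approximate_control psi0 psi1 e T : sphere psi0 -> sphere psi1 -> 0 < e -> 0 < T ->
  exists u, piecewise_constant u T /\ L2norm (fun x => Upsilon alpha u T psi0 x - psi1 x) < e.
Proof.
move=> s0 s1 e0 T0; have [h0 n0] := s0; have [h1 n1] := s1.
have unit psi : sphere psi -> l2le (coef psi) 1 /\ forall d, l2le (coef psi) d -> 1 <= d.
  move=> [hp pn]; split; first by rewrite -pn; apply: bessel; apply: Ho_L2.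
  by move=> d hd; rewrite -pn; apply: parseval_le.
have [a1 a2] := unit _ s0; have [b1 b2] := unit _ s1.
have e2 : 0 < e / 2 by rewrite divr_gt0.
have [l [pl sl hl]] := steer_l2 halpha (coef0 psi0) a1 a2 (coef0 psi1) b1 b2 e2 T0.
have st : steps (control 0 l) 0 l T by have := steps_control 0 pl; rewrite add0r sl.
exists (control 0 l); split; first by exists l.
apply: le_lt_trans (_ : e / 2 < e); last by rewrite gtr_pMr // invf_lt1 // ltr1n.
have [hU _] := Upsilon_sphere (control 0 l) T s0.
by apply/(parsevalB_le _ hU h1); rewrite (Upsilon_flow h0 st).
Qed.

(** The states reached at one single positive time are already dense in the sphere, and limits of
    unit vectors are unit vectors. This covers both the full reachable set and the one before time
    [T]. *)
Lemma closure_reach (X : set (wave R)) t : 0 < t -> reach_at alpha (phi 1) t `<=` X ->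
  X `<=` @sphere R -> L2closure X = @sphere R.
Proof.
move=> t0 tX Xs; apply/seteqP; split=> psi; last first.
  move=> sp; split; first by case: sp.
  move=> e e0; have [u [pu hu]] := approximate_control sphere_phi1 sp e0 t0.
  by exists (Upsilon alpha u t (phi 1)) => //; apply: tX; exists u.
move=> [hp h]; split => //.
have close e : 0 < e -> `|L2norm psi - 1| <= e.
  move=> e0; have [chi /Xs[hc c1] d] := h e e0.
  have L1 := Ho_L2 hp; have L2' := Ho_L2 hc.
  rewrite ler_distl -!c1; apply/andP; split.
    by rewrite lerBlDr -lerBlDl; apply: le_trans (L2norm_dist_ge L2' L1) (ltW d).
  rewrite -lerBlDl; apply: le_trans (L2norm_dist_ge L1 L2') _.
  by rewrite (L2norm_distC L1 L2') ltW.
apply/eqP; rewrite -subr_eq0 -normr_le0; apply/ler_addgt0Pr => e e0.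
by rewrite add0r; apply: close.
Qed.

End Reachability.

Theorem theorem11 (R : realType) (alpha : R) (halpha : 5 / 2 < alpha) :
  (forall psi0 psi1 : wave R, sphere psi0 -> sphere psi1 ->
   forall e : R, 0 < e -> forall T : R, 0 < T ->
   exists u : R -> R, piecewise_constant u T /\
     L2norm (fun x => Upsilon alpha u T psi0 x - psi1 x) < e) /\
  (L2closure (reach_all alpha (phi 1)) = @sphere R /\
   temporal_diameter alpha = 0%E).
Proof.
have reach t : reach_at alpha (phi 1) t `<=` @sphere R.
  by move=> psi [u _ ->]; apply: Upsilon_sphere; apply: sphere_phi1.
split; first by move=> psi0 psi1 s0 s1 e e0 T T0; apply: approximate_control.
split.
  apply: (closure_reach halpha ltr01) => [psi h|psi [T _ h]]; last exact: reach h.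
  by exists 1 => //=; apply: ltr01.
have dense T : 0 < T -> L2closure (reach_before alpha (phi 1) T) = @sphere R.
  move=> T0; have T2 : 0 < T / 2 by rewrite divr_gt0.
  apply: (closure_reach halpha T2) => [psi h|psi [t _ h]]; last exact: reach h.
  (* The union runs over times strictly below [T], and [T / 2] is one of them. *)
  exists (T / 2) => //=; rewrite (ltW T2) /=; by rewrite gtr_pMr // invf_lt1 // ltr1n.
apply/eqP; rewrite eq_le; apply/andP; split.
  (* Every positive time qualifies, so the infimum is at most any [e > 0]. *)
  apply/lee_addgt0Pr => e e0; rewrite add0e; apply: ereal_inf_lbound.
  by exists e => //; split; [exact: ltW|exact: dense].
by apply: le_ereal_inf_tmp => _ [T [T0 _] <-]; rewrite lee_fin.
Qed.
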